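(* Let $n\geq 1$ be an integer, $\mu\geq 0$, $b(t)=\frac{\mu}{1+t}$, and $R>0$. Let $(u_0,u_1,v_0,v_1)\in \big(W^{1,1}_{\mathrm{loc}}(\mathbb{R}^n)\times L^1_{\mathrm{loc}}(\mathbb{R}^n)\big)^2$ be such that each of $u_0,u_1,v_0,v_1$ is nonnegative and nontrivial (not a.e. zero) and has support contained in $B_R$. Let $p,q>1$ be such that $$\Gamma(n,p,q,\mu) \doteq \max \left\{\frac{2+p^{-1}}{pq-1}-\frac{n+\mu-1}{2},\ \frac{q+2}{pq-1}-n+[1-\mu]_+,\ \frac{2p+1}{pq-1}-n\right\}>0 .$$ Then there exist $\varepsilon_0=\varepsilon_0(n,\mu,p,q,R,u_0,u_1,v_0,v_1)>0$ and a constant $C>0$ independent of $\varepsilon$ such that for any $\varepsilon\in(0,\varepsilon_0]$ the following holds: if $(u,v)$ is a local (in time) weak solution on $[0,T(\varepsilon))$ of $$\begin{cases} \partial_t^2u-\Delta u+\partial_tu=\vert v\vert^p, & t>0, \ x\in \mathbb{R}^n,\\ \partial_t^2v-\Delta v+b(t)\partial_tv=\vert u\vert^q, & t>0, \ x\in \mathbb{R}^n,\\ (u,\partial_tu,v,\partial_tv)(0,x)=\varepsilon(u_0,u_1,v_0,v_1)(x), &x\in\mathbb{R}^n, \end{cases}$$ then $(u,v)$ blows up in finite time (i.e. $T(\varepsilon)<\infty$) and $$T(\varepsilon)\leq C\, \varepsilon^{-\frac{1}{\Gamma(n,p,q,\mu)}} .$$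
   Context: Notation: $B_\varrho=\{x\in\mathbb{R}^n:|x|\leq \varrho\}$ for $\varrho>0$; $[y]_+=\max\{y,0\}$. Weak solution. Let $\varepsilon>0$, $p,q>1$, and let the data $(u_0,u_1,v_0,v_1)\in\big(W^{1,1}_{\mathrm{loc}}(\mathbb{R}^n)\times L^1_{\mathrm{loc}}(\mathbb{R}^n)\big)^2$ have supports contained in $B_R$. A pair $(u,v)$ is a weak solution of the Cauchy problem on $[0,T)$, $0<T\leq\infty$, if $$u\in \mathcal{C}\big([0,T),W^{1,1}_{\mathrm{loc}}(\mathbb{R}^n)\big)\cap \mathcal{C}^1\big([0,T),L^1_{\mathrm{loc}}(\mathbb{R}^n)\big)\cap L^q_{\mathrm{loc}}([0,T)\times\mathbb{R}^n),$$ $$v\in \mathcal{C}\big([0,T),W^{1,1}_{\mathrm{loc}}(\mathbb{R}^n)\big)\cap \mathcal{C}^1\big([0,T),L^1_{\mathrm{loc}}(\mathbb{R}^n)\big)\cap L^p_{\mathrm{loc}}([0,T)\times\mathbb{R}^n),$$ $\mathrm{supp}\,(u,v)(t,\cdot)\subset B_{R+t}$ for any $t\in(0,T)$, $u(0,\cdot)=\varepsilon u_0$ and $v(0,\cdot)=\varepsilon v_0$ in $L^1_{\mathrm{loc}}(\mathbb{R}^n)$, and for any $\phi,\psi\in\mathcal{C}_0^\infty([0,T)\times\mathbb{R}^n)$ and any $t\in(0,T)$ $$\int_0^t\!\int_{\mathbb{R}^n}\big(-\partial_su\,\partial_s\phi+\partial_su\,\phi+\nabla u\cdot\nabla\phi\big)\,dx\,ds+\int_{\mathbb{R}^n}\partial_tu(t,x)\phi(t,x)\,dx=\varepsilon\int_{\mathbb{R}^n}u_1(x)\phi(0,x)\,dx+\int_0^t\!\int_{\mathbb{R}^n}|v|^p\phi\,dx\,ds,$$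 $$\int_0^t\!\int_{\mathbb{R}^n}\big(-\partial_sv\,\partial_s\psi+\nabla v\cdot\nabla\psi+b(s)\partial_sv\,\psi\big)\,dx\,ds+\int_{\mathbb{R}^n}\partial_tv(t,x)\psi(t,x)\,dx=\varepsilon\int_{\mathbb{R}^n}v_1(x)\psi(0,x)\,dx+\int_0^t\!\int_{\mathbb{R}^n}|u|^q\psi\,dx\,ds.$$ Here ''blows up in finite time'' means that the solution cannot exist for all times: any $T(\varepsilon)$ for which a weak solution on $[0,T(\varepsilon))$ exists is finite. *)

(* Defs.v *)
From HB Require Import structures.
From mathcomp Require Import all_boot all_order all_algebra.
From mathcomp Require Import all_classical all_reals all_analysis.
From mathcomp Require Import measurable_realfun.

Set Implicit Arguments.
Unset Strict Implicit.
Unset Printing Implicit Defensive.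
Import Order.TTheory GRing.Theory Num.Theory.
Import numFieldNormedType.Exports.
Local Open Scope classical_set_scope.
Local Open Scope ring_scope.

Definition rv_display : measure_display. Proof. exact. Qed.

Section measurable_rv.
Context {R : realType} (n : nat).

Let coors : 'I_n -> 'rV[R]_n -> R := fun i x => x ord0 i.

Let rv_set0 : g_sigma_preimage coors set0.
Proof. exact: sigma_algebra0. Qed.

Let rv_setC A : g_sigma_preimage coors A -> g_sigma_preimage coors (~` A).
Proof. exact: sigma_algebraC. Qed.

Let rv_bigcup (F : (set 'rV[R]_n)^nat) :
  (forall i, g_sigma_preimage coors (F i)) ->
  g_sigma_preimage coors (\bigcup_i (F i)).
Proof. exact: sigma_algebra_bigcup. Qed.

HB.instance Definition _ := @isMeasurable.Build rv_display
  'rV[R]_n (g_sigma_preimage coors) rv_set0 rv_setC rv_bigcup.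

End measurable_rv.

Lemma measurable_coor (R : realType) n (i : 'I_n) :
  measurable_fun [set: 'rV[R]_n] (fun x : 'rV[R]_n => x ord0 i).
Proof.
move=> _ Y mY; rewrite setTI; apply: sub_sigma_algebra => /=.
rewrite -bigcup_seq/=; exists i => /=; first by rewrite mem_index_enum.
by exists Y => //; rewrite setTI.
Qed.

Lemma measurable_fun_coorP (R : realType) d (T : measurableType d) n
    (f : T -> 'rV[R]_n) :
  (forall i, measurable_fun [set: T] (fun t => f t ord0 i)) ->
  measurable_fun [set: T] f.
Proof.
move=> mf.
suff H : g_sigma_preimage (fun (i : 'I_n) (t : T) => f t ord0 i) `<=` measurable.
  move=> _ A mA; apply: H.
  have := @g_sigma_preimage_comp _ R n _ (fun i (x : 'rV[R]_n) => x ord0 i) _ f.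
  by rewrite /comp/= => ->; exists A.
apply: smallest_sub; first exact: sigma_algebra_measurable.
case: n => [|n] in f mf *; first by rewrite big_ord0.
rewrite -bigcup_mkord_ord; apply: bigcup_sub => i Ii.
by move=> A [B mB <-]; exact: mf.
Qed.

Definition cons_rv (R : realType) n (z : R * 'rV[R]_n) : 'rV[R]_n.+1 :=
  row_mx (const_mx z.1 : 'rV_1) z.2.

Definition uncons_rv (R : realType) n (x : 'rV[R]_n.+1) : R * 'rV[R]_n :=
  (x ord0 ord0, rsubmx (x : 'rV_(1 + n))).

Lemma cons_rv0 (R : realType) n (z : R * 'rV[R]_n) : cons_rv z ord0 ord0 = z.1.
Proof.
rewrite (_ : ord0 = lshift n (ord0 : 'I_1)); last exact/val_inj.
by rewrite [LHS](@row_mxEl _ 1 1 n) mxE.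
Qed.

Lemma cons_rvS (R : realType) n (z : R * 'rV[R]_n) i :
  cons_rv z ord0 (lift ord0 i) = z.2 ord0 i.
Proof.
rewrite (_ : lift ord0 i = rshift 1 i); last exact/val_inj.
by rewrite [LHS](@row_mxEr _ 1 1 n).
Qed.

Lemma cons_rvK (R : realType) n : cancel (@cons_rv R n) (@uncons_rv R n).
Proof.
by move=> [a x]; rewrite /uncons_rv cons_rv0 /cons_rv row_mxKr.
Qed.

Lemma measurable_cons_rv (R : realType) n :
  measurable_fun [set: measurableTypeR R * 'rV[R]_n] (@cons_rv R n).
Proof.
apply: measurable_fun_coorP => i; case: (unliftP ord0 i) => [j|] ->.
  rewrite (_ : (fun _ => _) = (fun x : 'rV[R]_n => x ord0 j) \o snd).
    by apply: measurableT_comp; [exact: measurable_coor|exact: measurable_snd].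
  by apply/funext => z; rewrite cons_rvS.
rewrite (_ : (fun _ => _) = fst); first exact: measurable_fst.
by apply/funext => z; rewrite cons_rv0.
Qed.

Lemma measurable_uncons_rv (R : realType) n :
  measurable_fun [set: 'rV[R]_n.+1]
    (@uncons_rv R n : 'rV[R]_n.+1 -> measurableTypeR R * 'rV[R]_n).
Proof.
apply: measurable_fun_pair; first exact: measurable_coor.
apply: measurable_fun_coorP => i.
rewrite (_ : (fun _ => _) = fun x : 'rV[R]_n.+1 => x ord0 (rshift 1 i)).
  exact: (@measurable_coor R n.+1).
by apply/funext => x; rewrite mxE.
Qed.

Section lebesgue_rvS.
Context (R : realType) (n : nat).
Variable m : {sigma_finite_measure set 'rV[R]_n -> \bar R}.

Definition lebesgue_rvS : set 'rV[R]_n.+1 -> \bar R :=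
  pushforward (lebesgue_measure \x m)%E (@cons_rv R n).

HB.instance Definition _ := Measure.copy lebesgue_rvS
  (measure_function_pushforward__canonical__measure_function_Measure
    (lebesgue_measure \x m)%E (@measurable_cons_rv R n)).

Let lebesgue_rvS_sigma_finite : sigma_finite setT lebesgue_rvS.
Proof.
have /sigma_finiteP[F [TF ndF Foo]] := sigma_finiteT (@lebesgue_measure R).
have /sigma_finiteP[G [TG ndG Goo]] := sigma_finiteT m.
have mFG k : measurable (F k `*` G k).
  by have [? _] := Foo k; have [? _] := Goo k; exact: measurableX.
exists (fun k => @uncons_rv R n @^-1` (F k `*` G k)).
  rewrite -preimage_bigcup (_ : \bigcup_k _ = setT) ?preimage_setT//.
  apply/seteqP; split=> // -[x y] _.
  have [k _ Fkx] : (\bigcup_k F k) x by rewrite -TF.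
  have [l _ Gly] : (\bigcup_k G k) y by rewrite -TG.
  exists (maxn k l) => //; split.
  - by move: x Fkx; exact/subsetPset/ndF/leq_maxl.
  - by move: y Gly; exact/subsetPset/ndG/leq_maxr.
move=> k; split.
  by rewrite -[X in measurable X]setTI; exact: measurable_uncons_rv.
rewrite /lebesgue_rvS /pushforward -comp_preimage.
rewrite (_ : _ \o _ = id); last by apply/funext => z /=; rewrite cons_rvK.
have [? ?] := Foo k; have [? ?] := Goo k.
by rewrite preimage_id product_measure1E// lte_mul_pinfty// ge0_fin_numE.
Qed.

HB.instance Definition _ := Measure_isSigmaFinite.Build _ _ _
  lebesgue_rvS lebesgue_rvS_sigma_finite.

End lebesgue_rvS.

Fixpoint lebesgue_rv (R : realType) (n : nat) :
    {sigma_finite_measure set 'rV[R]_n -> \bar R} :=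
  match n with
  | 0 => [the {sigma_finite_measure set 'rV[R]_0 -> \bar R} of dirac (0 : 'rV[R]_0)]
  | n'.+1 => [the {sigma_finite_measure set 'rV[R]_n'.+1 -> \bar R} of
              lebesgue_rvS (lebesgue_rv R n')]
  end.

(* Sanity checks: the expected value on boxes, and the coordinate
   sigma-algebra contains the open sets. *)
Lemma lebesgue_rv_box (R : realType) n (A : 'I_n -> set R) :
  (forall i, measurable (A i)) ->
  lebesgue_rv R n [set x | forall i, A i (x ord0 i)] =
  (\prod_(i < n) lebesgue_measure (A i))%E.
Proof.
elim: n A => [|n IHn] A mA.
  rewrite big_ord0 /= diracE [X in _ \in X](_ : _ = setT) ?in_setT//.
  by apply/seteqP; split=> // x _ [].
rewrite big_ord_recl -IHn; last by move=> i; exact: mA.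
have mB : measurable [set x : 'rV[R]_n | forall i, A (lift ord0 i) (x ord0 i)].
  rewrite (_ : mkset _ = \bigcap_(i in [set: 'I_n])
      ((fun x : 'rV[R]_n => x ord0 i) @^-1` A (lift ord0 i))).
    apply: fin_bigcap_measurable => // i _.
    by rewrite -[X in measurable X]setTI; exact: measurable_coor.
  by apply/seteqP; split=> x /= Ax i => [_|]; exact: Ax.
rewrite -product_measure1E//=; last exact: mA.
rewrite /lebesgue_rvS /pushforward; congr (_ _).
apply/seteqP; split=> -[a x] /=.
  move=> Aax; split=> [|i]; first by have := Aax ord0; rewrite cons_rv0.
  by have := Aax (lift ord0 i); rewrite cons_rvS.
move=> [Aa Ax] i.
by case: (unliftP ord0 i) => [j|] ->; rewrite ?cons_rvS ?cons_rv0.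
Qed.

Lemma open_rv_measurable (R : realType) n (A : set 'rV[R]_n) :
  open A -> measurable A.
Proof.
move=> oA.
pose B (q : 'rV[rat]_n * nat) : set 'rV[R]_n :=
  [set x | forall i, `|ratr (q.1 ord0 i) - x ord0 i| < q.2.+1%:R^-1].
have mB q : measurable (B q).
  rewrite (_ : B q = \bigcap_(i in [set: 'I_n]) ((fun x : 'rV[R]_n => x ord0 i)
      @^-1` (ball (ratr (q.1 ord0 i) : R) q.2.+1%:R^-1))).
    apply: fin_bigcap_measurable => // i _.
    by rewrite -[X in measurable X]setTI; apply: measurable_coor => //; 
    exact: measurable_ball.
  by apply/seteqP; split=> x /= Bx i => [_|]; exact: Bx.
rewrite (_ : A = \bigcup_q (if `[< B q `<=` A >] then B q else set0)).
  by apply: countable_bigcupT_measurable => // q; case: ifP.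
apply/seteqP; split=> [x Ax|x [q _]]; last first.
  by case: ifPn => // /asboolP BA; exact: BA.
have [e/= e0 eA] : exists2 e : R, 0 < e & ball x e `<=` A.
  by have /nbhs_ballP[e] := open_nbhs_nbhs (conj oA Ax); exists e.
have [k ke] : exists k : nat, k.+1%:R^-1 < e / 2.
  have e20 : 0 < e / 2 by rewrite divr_gt0.
  by have [k _ kP] := near_infty_natSinv_lt (PosNum e20); exists k; apply: (kP k); exact: leqnn.
have qE i : exists q : rat, `|ratr q - x ord0 i| < k.+1%:R^-1 :> R.
  have k0 : 0 < k.+1%:R^-1 :> R by rewrite invr_gt0.
  have /rat_in_itvoo[q] : x ord0 i - k.+1%:R^-1 < x ord0 i + k.+1%:R^-1.
    by rewrite ltrBlDr -addrA ltrDl addr_gt0.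
  by rewrite in_itv/= -ltr_distl distrC => ?; exists q; rewrite distrC.
have [q qP] := choice qE.
exists (\row_i q i, k) => //.
rewrite ifT; first by move=> i /=; rewrite mxE.
apply/asboolP => y /= By; apply: eA; split=> // a i; rewrite [a]ord1 /ball/=.
have := By i; rewrite mxE => yq.
rewrite (le_lt_trans (ler_distD (ratr (q i)) _ _))// [ltRHS]splitr ltrD//.
  by rewrite distrC (lt_trans (qP i)).
exact: lt_trans ke.
Qed.

Section function_spaces.
Context {R : realType} {n : nat}.

Definition enorm (x : 'rV[R]_n) : R := Num.sqrt (\sum_(i < n) x ord0 i ^+ 2).

Definition eball (r : R) : set 'rV[R]_n := [set x | enorm x <= r].

Definition basis_rv (i : 'I_n) : 'rV[R]_n := delta_mx ord0 i.

(* For functions given up to a.e. equality, [supported_in r f] says that the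
   support of [f] is contained in [eball r]. *)
Definition supported_in (r : R) (f : 'rV[R]_n -> R) :=
  {ae lebesgue_rv R n, forall x, ~ eball r x -> f x = 0}.

Fixpoint Ck (V : normedModType R) (k : nat) (f : V -> R) : Prop :=
  match k with
  | 0 => continuous f
  | k'.+1 => (forall x, differentiable f x) /\ forall v, Ck k' ('D_v f)
  end.

Definition smooth (V : normedModType R) (f : V -> R) := forall k, Ck k f.

Definition L1loc (f : 'rV[R]_n -> R) :=
  measurable_fun [set: 'rV[R]_n] f /\
  forall r, (lebesgue_rv R n).-integrable (eball r) (EFin \o f).

Definition test_rv (phi : 'rV[R]_n -> R) :=
  smooth phi /\ exists r, forall x, ~ eball r x -> phi x = 0.

Definition weak_gradient (f : 'rV[R]_n -> R) (g : 'I_n -> 'rV[R]_n -> R) :=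
  forall i phi, test_rv phi ->
    \int[lebesgue_rv R n]_x (f x * 'D_(basis_rv i) phi x) =
    - \int[lebesgue_rv R n]_x (g i x * phi x).

Definition W11loc (f : 'rV[R]_n -> R) :=
  L1loc f /\ exists g, (forall i, L1loc (g i)) /\ weak_gradient f g.

Definition time_itv (T : \bar R) : set R := [set t | 0 <= t /\ (t%:E < T)%E].

(* The topology of L^1_loc is generated by the L^1 seminorms over the balls. *)
Definition C_L1loc (T : \bar R) (w : R -> 'rV[R]_n -> R) :=
  (forall t, time_itv T t -> L1loc (w t)) /\
  forall t0 r, time_itv T t0 ->
    (\int[lebesgue_rv R n]_(x in eball r) `|w t x - w t0 x|%:E)%E
      @[t --> within (time_itv T) (nbhs t0)] --> 0%E.

Definition C_W11loc (T : \bar R) (w : R -> 'rV[R]_n -> R)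
    (gw : 'I_n -> R -> 'rV[R]_n -> R) :=
  [/\ C_L1loc T w, forall i, C_L1loc T (gw i) &
      forall t, time_itv T t -> weak_gradient (w t) (fun i => gw i t)].

Definition C1_L1loc (T : \bar R) (w wt : R -> 'rV[R]_n -> R) :=
  [/\ C_L1loc T w, C_L1loc T wt &
      forall t0 r, time_itv T t0 ->
        (\int[lebesgue_rv R n]_(x in eball r)
           `|(w t x - w t0 x) / (t - t0) - wt t0 x|%:E)%E
          @[t --> within (time_itv T) t0^'] --> 0%E].

Definition Lloc_spacetime (T : \bar R) (p : R) (w : R -> 'rV[R]_n -> R) :=
  measurable_fun
    (time_itv T `*` [set: 'rV[R]_n] : set (measurableTypeR R * 'rV[R]_n))
    (fun z => w z.1 z.2) /\
  forall S r, time_itv T S ->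
    (\int[lebesgue_measure \x lebesgue_rv R n]_(z in `[0%R, S] `*` eball r)
       (`|w z.1 z.2| `^ p)%:E < +oo)%E.

(* A function in C_0^infty([0, T) x R^n) is represented by a smooth extension
   to R x R^n; the compactness of the support only concerns t >= 0. *)
Definition test_spacetime (T : \bar R) (phi : R * 'rV[R]_n -> R) :=
  smooth phi /\
  exists S r, time_itv T S /\
    forall t x, 0 <= t -> phi (t, x) != 0 -> t <= S /\ eball r x.

Definition weak_equation (T : \bar R) (b : R -> R) (p eps : R)
    (w1 : 'rV[R]_n -> R) (wt : R -> 'rV[R]_n -> R)
    (gw : 'I_n -> R -> 'rV[R]_n -> R) (z : R -> 'rV[R]_n -> R) :=
  forall phi, test_spacetime T phi -> forall t, 0 < t -> (t%:E < T)%E ->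
    \int[lebesgue_measure]_(s in `[0, t]) \int[lebesgue_rv R n]_x
       (- wt s x * 'D_(1, 0) phi (s, x) + b s * wt s x * phi (s, x)
        + \sum_(i < n) gw i s x * 'D_(0, basis_rv i) phi (s, x))
    + \int[lebesgue_rv R n]_x (wt t x * phi (t, x))
    = eps * \int[lebesgue_rv R n]_x (w1 x * phi (0, x))
      + \int[lebesgue_measure]_(s in `[0, t]) \int[lebesgue_rv R n]_x
          (`|z s x| `^ p * phi (s, x)).

Definition weak_solution (b : R -> R) (p q rho eps : R) (u0 u1 v0 v1 : 'rV[R]_n -> R)
    (T : \bar R) (u v : R -> 'rV[R]_n -> R) :=
  exists (ut vt : R -> 'rV[R]_n -> R) (gu gv : 'I_n -> R -> 'rV[R]_n -> R),
  [/\ [/\ C_W11loc T u gu, C1_L1loc T u ut & Lloc_spacetime T q u],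
      [/\ C_W11loc T v gv, C1_L1loc T v vt & Lloc_spacetime T p v],
      forall t, 0 < t -> (t%:E < T)%E ->
        supported_in (rho + t) (u t) /\ supported_in (rho + t) (v t),
      {ae lebesgue_rv R n, forall x, u 0 x = eps * u0 x} /\
      {ae lebesgue_rv R n, forall x, v 0 x = eps * v0 x} &
      weak_equation T (fun=> 1) p eps u1 ut gu v /\
      weak_equation T b q eps v1 vt gv u].

Definition admissible_datum (rho : R) (f : 'rV[R]_n -> R) :=
  [/\ {ae lebesgue_rv R n, forall x, 0 <= f x},
      ~ {ae lebesgue_rv R n, forall x, f x = 0} &
      supported_in rho f].

End function_spaces.

Definition Gamma_exponent (R : realType) (n : nat) (p q mu : R) : R :=
  Num.max (Num.max
    ((2 + p^-1) / (p * q - 1) - (n%:R + mu - 1) / 2)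
    ((q + 2) / (p * q - 1) - n%:R + Num.max (1 - mu) 0))
    ((2 * p + 1) / (p * q - 1) - n%:R).

(* Main.v *)
Require Import Defs.
From HB Require Import structures.
From mathcomp Require Import all_boot all_order all_algebra.
From mathcomp Require Import all_classical all_reals all_analysis.
From mathcomp Require Import measurable_realfun.
From mathcomp Require Import ring lra zify.

Set Implicit Arguments.
Unset Strict Implicit.
Unset Printing Implicit Defensive.
Import Order.TTheory GRing.Theory Num.Theory.
Import numFieldNormedType.Exports.
Local Open Scope classical_set_scope.
Local Open Scope ring_scope.

(* Test functions [a(s) Y(x)] with [lap Y = lam Y] on the ball [L = rho + S]
   that contains the supports up to time [S < T] turn the weak equations into
   scalar identities.
   With [Y = 1] ([lam = 0]) and [a = eta], resp. [a = (1 + s)^nu eta] with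
   [nu = min(mu, 1)] and [eta] a power of a cutoff at time [S], integration by
   parts and Young's inequality bound [eps] plus the space-time integral [X] of
   [|v|^p] by that of [|u|^q], and [eps] plus the integral [Z] of
   [(1 + s)^nu |u|^q] by that of [|v|^p]. For suitable powers of [S] as Young
   parameters the two inequalities close up, and give
   [eps + X <= C S^(n - (2p + 1)/(pq - 1))] and
   [eps <= C S^(n - 1 + nu - (q + 2)/(pq - 1))], the last two entries of [Gamma].
   With [lam = 1] and [Y] the positive radial (Bessel) solution of [lap Y = Y],
   [U(t) = \int v(t) Y] satisfies
   [(1 + t)^mu U' >= c eps + \int_0^t (1 + s)^mu U], so it dominates a multiple
   of an explicit subsolution: [U(t) >= c eps e^t (1 + t)^(-mu/2)]. Young's
   inequality and the growth of [Y] then bound [X] from below, and with the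
   upper bound for [X] this gives the first entry of [Gamma]. *)

(** * Smooth functions *)

(** Each of the three estimates has the form [eps <= C * S^(-G)] for all [S >= 4] below [T], with
    [C] independent of [S] and [eps]; inserting the claimed lifespan bound itself for [S] excludes a
    larger [T]. The choice of [nu] is dictated by the equation for [v]. With [a = (1 + s)^nu eta]
    the multiplier of [vt] is [-a' + b a], and its derivative contains
    [(mu - nu) (nu - 1) (1 + s)^(nu - 2) eta], the only term not confined to [s >= S / 2]. It
    disappears exactly for [nu = mu] or [nu = 1], and the smaller of the two also keeps the boundary
    term at time 0, whose coefficient is [mu - nu], nonnegative. A constant in space does not see
    where the mass of [v] sits. The Bessel function grows like [exp |x|], and its power integrals
    over a ball are bounded by the size of a unit layer at the boundary, hence a better power of [S]
    than the volume gives. As [v] is only once differentiable in time, with values in [L^1_loc], the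
    mode [U] comes with no second derivative; it is therefore compared with the subsolution through
    an equation integrated once in time. *)

Section smooth_functions.
Context {R : realType} {V : normedModType R}.
Implicit Types (f g : V -> R) (h : R -> R) (I : set R) (k : nat).

(** Smoothness of the outer function of a composition. Derivatives are asked only at points of [I],
    so that real powers on the positive half-line qualify. *)
Fixpoint Cn I k h : Prop :=
  match k with
  | 0 => forall x, I x -> {for x, continuous h}
  | k'.+1 => exists2 h' : R -> R, (forall x, I x -> is_derive x 1 h (h' x)) & Cn I k' h'
  end.

Lemma CkS k f : Ck k.+1 f -> Ck k f.
Proof.
elim: k f => [|k IH] f [df Df]; first by move=> x; exact: differentiable_continuous.
by split=> // v; apply: IH; exact: Df.
Qed.

Lemma Ck_cst k (c : R) : Ck k (cst c : V -> R).
Proof.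
elim: k c => [|k IH] c /=; first by move=> x; exact: cvg_cst.
split=> [x|v]; first exact: differentiable_cst.
rewrite (_ : 'D_v (cst c) = cst 0); first exact: IH.
by apply/funext => x; rewrite derive_cst.
Qed.

Lemma CkD k f g : Ck k f -> Ck k g -> Ck k (f \+ g).
Proof.
elim: k f g => [|k IH] f g /=.
  by move=> cf cg x; apply: cvgD; [exact: cf|exact: cg].
move=> [df Df] [dg Dg]; split=> [x|v]; first exact: differentiableD.
rewrite (_ : 'D_v _ = 'D_v f \+ 'D_v g); first exact: IH.
by apply/funext => x; rewrite deriveD//; exact: diff_derivable.
Qed.

Lemma CkM k f g : Ck k f -> Ck k g -> Ck k (f \* g).
Proof.
elim: k f g => [|k IH] f g.
  by move=> cf cg x; apply: cvgM; [exact: cf|exact: cg].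
move=> Cf Cg; have [df Df] := Cf; have [dg Dg] := Cg.
split=> [x|v]; first exact: differentiableM.
rewrite (_ : 'D_v _ = (f \* 'D_v g) \+ (g \* 'D_v f)).
  by apply: CkD; apply: IH; [exact: (CkS Cf)|exact: Dg|exact: (CkS Cg)|exact: Df].
by apply/funext => x; rewrite deriveM//; exact: diff_derivable.
Qed.

Lemma derive_compR h (h' : R) f x v : differentiable f x ->
  is_derive (f x) 1 h h' -> 'D_v (h \o f) x = h' * 'D_v f x.
Proof.
move=> df [/derivable1_diffP dh hE].
rewrite !deriveE//; last exact: differentiable_comp.
rewrite diff_comp//= diff1E//= -hE.
by rewrite derive1E mulrC.
Qed.

(** The derivative is [h' \o f] times ['D_v f], again a composition times a function of class [k],
    so the induction closes through [CkM]. *)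
Lemma Ck_comp I k h f : (forall x, I (f x)) -> Cn I k h -> Ck k f ->
  Ck k (h \o f).
Proof.
move=> If; elim: k h => [|k IH] h.
  by move=> ch cf x; apply: continuous_comp; [exact: cf|exact: ch].
move=> [h' dh Ch] Cf; have [df Df] := Cf; split=> [x|v].
  apply: differentiable_comp => //.
  by apply/derivable1_diffP; case: (dh (f x) (If x)).
rewrite (_ : 'D_v _ = (h' \o f) \* 'D_v f).
  by apply: CkM; [exact: (IH _ Ch (CkS Cf))|exact: Df].
by apply/funext => x; apply: derive_compR => //; exact: dh.
Qed.

End smooth_functions.

Section Cn_theory.
Context {R : realType}.
Implicit Types (h : R -> R) (I : set R) (k : nat).

Lemma Ck_Cn k h : Ck k h -> Cn setT k h.
Proof.
elim: k h => [|k IH] h; first by move=> ch x _; exact: ch.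
move=> [dh Dh]; exists ('D_1 h); last exact: (IH _ (Dh 1)).
by move=> x _; apply: derivableP; exact: diff_derivable.
Qed.

Lemma Cn_cst I k (c : R) : Cn I k (cst c).
Proof.
elim: k c => [|k IH] c; first by move=> x _; exact: cvg_cst.
by exists (cst 0) => // x _; exact: is_derive_cst.
Qed.

Lemma CnZ I k (c : R) h : Cn I k h -> Cn I k (fun x => c * h x).
Proof.
elim: k h => [|k IH] h.
  by move=> ch x Ix; apply: cvgM; [exact: cvg_cst|exact: ch].
move=> [h' dh Ch]; exists (fun x => c * h' x); last exact: IH.
by move=> x /dh ?; exact: is_deriveZ.
Qed.

Lemma Cn_powR k (a : R) : Cn [set x | 0 < x] k (@powR R ^~ a).
Proof.
elim: k a => [|k IH] a.
  move=> x x0; apply: differentiable_continuous; apply/derivable1_diffP.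
  by case: (is_derive1_powR a x0).
exists (fun x => a * x `^ (a - 1)); last exact/CnZ/IH.
by move=> x x0; exact: is_derive1_powR.
Qed.

Lemma CnD I k h1 h2 : Cn I k h1 -> Cn I k h2 -> Cn I k (h1 \+ h2).
Proof.
elim: k h1 h2 => [|k IH] h1 h2.
  by move=> c1 c2 x Ix; apply: cvgD; [exact: c1|exact: c2].
move=> [h1' d1 C1] [h2' d2 C2]; exists (h1' \+ h2'); last exact: IH.
by move=> x Ix; apply: is_deriveD; [exact: d1|exact: d2].
Qed.

(** A family closed under differentiation: the derivative of a member is a combination of those with
    indices [k + 1] and [k + 2], so one induction for all [k] at once gives smoothness of every
    order. *)
Definition flat k (y : R) : R := if 0 < y then y^-1 ^+ k * expR (- y^-1) else 0.

(** From [z^(k+2) / (k+2)! <= exp z] at [z = 1/y]. A quadratic bound is enough for differentiability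
    at the origin with derivative zero. *)
Lemma flat_le k y : 0 <= flat k y <= (k.+2)`!%:R * y ^+ 2.
Proof.
rewrite /flat; case: ifPn => [y0|_]; last first.
  by rewrite lexx/= mulr_ge0// sqr_ge0.
have z0 : 0 < y^-1 by rewrite invr_gt0.
rewrite mulr_ge0 ?expR_ge0 ?exprn_ge0 ?(ltW z0)//=.
have E : y^-1 ^+ k.+2 / k.+2`!%:R <= expR y^-1.
  by apply: le_trans (@expR_ge1Dxn R y^-1 k.+1 (ltW z0)); rewrite lerDr.
rewrite expRN -(@ler_pM2r _ (expR y^-1)) ?expR_gt0// mulfVK ?gt_eqF ?expR_gt0//.
rewrite -mulrA -ler_pdivrMl ?ltr0n ?fact_gt0//.
rewrite -(@ler_pM2l _ (y^-1 ^+ 2)) ?exprn_gt0// [leRHS]mulrA -exprMn.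
rewrite mulVf ?gt_eqF// expr1n mul1r; apply: le_trans E.
by rewrite mulrCA -exprD mulrC.
Qed.

Lemma is_derive0_quadratic (f : R -> R) (c : R) : 0 <= c ->
  (forall y, `|f y| <= c * y ^+ 2) -> is_derive (0 : R) (1 : R) f (0 : R).
Proof.
move=> c0 fc.
have f0 : f 0 = 0 by apply/eqP; rewrite -normr_le0 (le_trans (fc 0))// expr0n mulr0.
suff H : (fun h : R => h^-1 *: (f (h *: (1 : R) + 0) - f 0) : R) @ 0^' --> (0 : R).
  by apply: DeriveDef; [apply/cvg_ex; exists 0|exact: cvg_lim].
apply/norm_cvg0P.
apply: (@squeeze_cvgr R (0^'%classic) _ R (cst (0 : R)) (fun h : R => c * `|h|)).
- near=> h; rewrite normr_ge0/= f0 subr0 addr0 scaler1.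
  have h0 : h != 0 by near: h; exact: nbhs_dnbhs_neq.
  rewrite normrZ normfV ler_pdivrMl ?normr_gt0// mulrCA -normrM -expr2.
  by rewrite ger0_norm ?sqr_ge0.
- exact: cvg_cst.
- apply: cvg_within_filter.
  have : c * `|h| @[h --> (0 : R)] --> c * `|0 : R|.
    by apply: cvgM; [exact: cvg_cst|apply: cvg_norm; exact: cvg_id].
  by rewrite normr0 mulr0.
Unshelve. all: by end_near. Qed.

Lemma is_derive_flat k (y : R) :
  is_derive y 1 (flat k) (flat k.+2 y - k%:R * flat k.+1 y).
Proof.
have [y0|y0|->] := ltgtP y 0.
- rewrite /flat [in X in is_derive _ _ _ X]ltNge (ltW y0)/= mulr0 subr0.
  apply: (@near_eq_is_derive _ _ _ (cst 0)).
  by near=> z; rewrite /cst ltNge ltW//; near: z; exact: lt_nbhsl.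
- rewrite /flat y0.
  apply: (@near_eq_is_derive _ _ _ (fun y : R => y^-1 ^+ k * expR (- y^-1))).
    by near=> z; rewrite ifT//; near: z; exact: lt_nbhsr.
  have yn0 : y != 0 by rewrite gt_eqF.
  have dV : is_derive y 1 (fun y : R => y^-1) (- y ^- 2).
    apply: DeriveDef; first by apply: derivableV => //; exact: derivable_id.
    by rewrite deriveV// derive_id scaler1.
  have dE : is_derive y 1 (fun y => expR (- y^-1)) (expR (- y^-1) * y ^- 2).
    have := @is_derive1_comp R expR (fun y => - y^-1) y _ _ (is_derive_expR _)
      (is_deriveN dV).
    by rewrite opprK.
  have dX := is_deriveX k dV; rewrite exprfctE in dX.
  apply: (is_derive_eq (is_deriveM dX dE)).
  rewrite /GRing.scale/= -exprVn; case: k {dX} => [|k] /=; first by ring.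
  rewrite !exprS.
  ring.
- rewrite /flat ltxx mulr0 subr0.
  apply: (@is_derive0_quadratic _ (k.+2)`!%:R) => // y'.
  by have /andP[a b] := flat_le k y'; rewrite ger0_norm.
Unshelve. all: by end_near. Qed.

Lemma Cn_flat m k : Cn setT m (flat k).
Proof.
elim: m k => [|m IH] k.
  move=> x _; apply: differentiable_continuous; apply/derivable1_diffP.
  by case: (is_derive_flat k x).
exists (fun y => flat k.+2 y - k%:R * flat k.+1 y).
  by move=> x _; exact: is_derive_flat.
apply: CnD; first exact: IH.
rewrite (_ : (fun _ => _) = fun y => - k%:R * flat k.+1 y); first exact/CnZ/IH.
by apply/funext => y; rewrite mulNr.
Qed.

End Cn_theory.

Section smooth_step.
Context {R : realType}.

Lemma Ck_id k : Ck k (id : R -> R).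
Proof.
case: k => [|k]; first by move=> x; exact: cvg_id.
split=> [x|v]; first exact: ex_diff.
rewrite (_ : 'D_v id = cst v); first exact: Ck_cst.
by apply/funext => x; rewrite derive_id.
Qed.

Lemma Cn_affine k (a b : R) : Ck k (fun y : R => a * y + b).
Proof.
apply: CkD; last exact: Ck_cst.
by apply: CkM; [exact: Ck_cst|exact: Ck_id].
Qed.

(** Two derivatives are recorded with a common bound because the time multipliers contain up to two.
    Both vanish below [1/2], so after rescaling by [S] they act only at times comparable to [S]. *)
Record is_step (chi chi1 chi2 : R -> R) (C : R) : Prop := IsStep {
  step_smooth : forall k, Cn setT k chi ;
  step_ge0 : forall y, 0 <= chi y ;
  step_le1 : forall y, chi y <= 1 ;
  step1 : forall y, y <= 2^-1 -> chi y = 1 ;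
  step0 : forall y, 1 <= y -> chi y = 0 ;
  step_der1 : forall y : R, is_derive y 1 chi (chi1 y) ;
  step_der2 : forall y : R, is_derive y 1 chi1 (chi2 y) ;
  step_bnd1 : forall y, `|chi1 y| <= C ;
  step_bnd2 : forall y, `|chi2 y| <= C ;
  step_loc1 : forall y, y < 2^-1 -> chi1 y = 0 ;
  step_loc2 : forall y, y < 2^-1 -> chi2 y = 0 }.

Lemma is_derive_unique (f : R -> R) (x a b : R) :
  is_derive x (1 : R) f a -> is_derive x (1 : R) f b -> a = b.
Proof. by move=> [_ <-] [_ <-]. Qed.

Lemma is_derive_locally_cst (f : R -> R) (x a c : R) :
  (\forall y \near x, f y = c) -> is_derive x (1 : R) f a -> a = 0.
Proof.
move=> fc df; apply: (is_derive_unique df).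
apply: (@near_eq_is_derive _ _ _ (cst c)) => //.
by apply: filterS fc => y ->.
Qed.

Lemma bounded_compact_support (f : R -> R) (a b : R) : a <= b ->
  continuous f -> (forall y, y < a -> f y = 0) -> (forall y, b < y -> f y = 0) ->
  exists2 C, 0 <= C & forall y, `|f y| <= C.
Proof.
move=> ab cf fa fb.
have cF : {within `[a, b], continuous (fun y => `|f y|)}.
  apply: continuous_subspaceT => y; apply: cvg_norm; exact: cf.
have [c _ cP] := EVT_max ab cF.
exists `|f c| => // y.
have [ya|ay] := ltP y a; first by rewrite fa// normr0.
have [yb|by_] := ltP b y; first by rewrite fb// normr0.
by apply: cP; rewrite in_itv/= ay.
Qed.

Lemma flat_le0 k (y : R) : y <= 0 -> flat k y = 0.
Proof. by rewrite /flat ltNge => ->. Qed.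

Lemma exists_smooth_step : exists chi chi1 chi2 C, is_step chi chi1 chi2 C.
Proof.
(* The denominator is positive because [1 - y] and [y - 1/2] are never both nonpositive. The
   quotient is written with the power [-1], which is covered by [Cn_powR] on the positive
   half-line. *)
pose den (y : R) := flat 0 (1 - y) + flat 0 (y - 2^-1).
pose chi (y : R) := flat 0 (1 - y) * den y `^ (-1).
have den0 y : 0 < den y.
  rewrite /den; have [y1|y1] := ltP y 1.
    rewrite ltr_pwDl//; last by have /andP[] := flat_le 0 (y - 2^-1).
    by rewrite /flat subr_gt0 y1 expr0 mul1r expR_gt0.
  rewrite ltr_wpDl//; first by have /andP[] := flat_le 0 (1 - y).
  by rewrite /flat subr_gt0 ifT ?expr0 ?mul1r ?expR_gt0// (lt_le_trans _ y1)// invf_lt1// ltr1n.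
have smooth k : Ck k chi.
  have H1 : Ck k (fun y : R => flat 0 (1 - y)).
    rewrite (_ : (fun _ => _) = flat 0 \o (fun y : R => (-1) * y + 1)).
      by apply: (@Ck_comp _ _ setT) => //; [exact: Cn_flat|exact: Cn_affine].
    by apply/funext => y /=; rewrite mulN1r addrC.
  have H2 : Ck k (fun y : R => flat 0 (y - 2^-1)).
    rewrite (_ : (fun _ => _) = flat 0 \o (fun y : R => 1 * y + (- 2^-1))).
      by apply: (@Ck_comp _ _ setT) => //; [exact: Cn_flat|exact: Cn_affine].
    by apply/funext => y /=; rewrite mul1r.
  apply: CkM => //.
  apply: (@Ck_comp _ _ [set x | 0 < x] k (@powR R ^~ (-1)) den) => //; first exact: Cn_powR.
  exact: CkD.
have Csmooth k : Cn setT k chi by apply: Ck_Cn; exact: smooth.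
(* The third derivative makes [chi2] continuous, hence bounded. *)
have /= [chi1 d1 [chi2 d2 [chi3 d3 _]]] := Csmooth 3%N.
have chi_1 y : y <= 2^-1 -> chi y = 1.
  move=> yh; have := den0 y; rewrite /chi /den.
  rewrite (@flat_le0 0 (y - 2^-1)) ?subr_le0// addr0 => d0.
  by rewrite powR_inv1 ?ltW// divff// gt_eqF.
have chi_0 y : 1 <= y -> chi y = 0.
  by move=> yh; rewrite /chi (@flat_le0 0 (1 - y)) ?subr_le0// mul0r.
have l1 y : y < 2^-1 -> chi1 y = 0.
  move=> yh; apply: (is_derive_locally_cst (c := 1) _ (d1 _ I)).
  by near=> z; apply: chi_1; near: z; exact: lt_le_nbhsl.
have r1 y : 1 < y -> chi1 y = 0.
  move=> yh; apply: (is_derive_locally_cst (c := 0) _ (d1 _ I)).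
  by near=> z; apply: chi_0; apply: ltW; near: z; exact: lt_nbhsr.
have l2 y : y < 2^-1 -> chi2 y = 0.
  move=> yh; apply: (is_derive_locally_cst (c := 0) _ (d2 _ I)).
  by near=> z; apply: l1; near: z; exact: lt_nbhsl.
have r2 y : 1 < y -> chi2 y = 0.
  move=> yh; apply: (is_derive_locally_cst (c := 0) _ (d2 _ I)).
  by near=> z; apply: r1; near: z; exact: lt_nbhsr.
have c1 : continuous chi1.
  by move=> y; apply: differentiable_continuous; apply/derivable1_diffP; case: (d2 y I).
have c2 : continuous chi2.
  by move=> y; apply: differentiable_continuous; apply/derivable1_diffP; case: (d3 y I).
have h1 : 2^-1 <= 1 :> R by rewrite invf_le1// ler1n.
have [C1 C10 C1P] := bounded_compact_support h1 c1 l1 r1.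
have [C2 C20 C2P] := bounded_compact_support h1 c2 l2 r2.
exists chi, chi1, chi2, (C1 + C2); split => //.
- by move=> y; rewrite /chi mulr_ge0 ?powR_ge0//; have /andP[] := flat_le 0 (1 - y).
- move=> y; rewrite /chi powR_inv1; last exact/ltW.
  rewrite ler_pdivrMr// mul1r /den lerDl.
  by have /andP[] := flat_le 0 (y - 2^-1).
- by move=> y; exact: d1.
- by move=> y; exact: d2.
- by move=> y; rewrite (le_trans (C1P y))// lerDl.
- by move=> y; rewrite (le_trans (C2P y))// lerDr.
Unshelve. all: by end_near. Qed.

End smooth_step.

Section smooth_linear.
Context {R : realType}.

Lemma derive_comp_linear (V W : normedModType R) (l : {linear V -> W})
    (f : W -> R) (x v : V) : continuous l -> differentiable f (l x) ->
  'D_v (f \o l) x = 'D_(l v) f (l x).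
Proof.
move=> cl df; have dl := linear_differentiable x cl.
rewrite !deriveE//; last exact: differentiable_comp.
by rewrite diff_comp//= diff_lin.
Qed.

Lemma Ck_comp_linear (V W : normedModType R) (l : {linear V -> W}) k
    (f : W -> R) : continuous l -> Ck k f -> Ck k (f \o l).
Proof.
move=> cl; elim: k f => [|k IH] f.
  by move=> cf x; apply: continuous_comp; [exact: cl|exact: cf].
move=> [df Df]; split=> [x|v].
  by apply: differentiable_comp => //; exact: linear_differentiable.
rewrite (_ : 'D_v _ = 'D_(l v) f \o l); first exact: (IH _ (Df _)).
by apply/funext => x; exact: derive_comp_linear.
Qed.

End smooth_linear.

Section product_test.
Context {R : realType} {n : nat}.
Local Notation ST := (R * 'rV[R]_n)%type.
Implicit Types (a : R -> R) (Y : 'rV[R]_n -> R).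

Definition tensor a Y (z : ST) : R := a z.1 * Y z.2.

Lemma fst_linear : linear (fst : ST -> R). Proof. by []. Qed.
Lemma snd_linear : linear (snd : ST -> 'rV[R]_n). Proof. by []. Qed.

Lemma smooth_tensor a Y : smooth a -> smooth Y -> smooth (tensor a Y).
Proof.
move=> sa sY k.
(* The projections are packed as linear maps, so that [Ck_comp_linear] applies to each factor. *)
pose f1 := GRing.isLinear.Build _ _ _ _ fst fst_linear.
pose f2 := GRing.isLinear.Build _ _ _ _ snd snd_linear.
pose l1 : {linear ST -> R} := HB.pack (fst : ST -> R) f1.
pose l2 : {linear ST -> 'rV[R]_n} := HB.pack (snd : ST -> 'rV[R]_n) f2.
apply: (@CkM _ _ _ (a \o l1) (Y \o l2)).
  by apply: Ck_comp_linear (sa k) => z; exact: cvg_fst.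
by apply: Ck_comp_linear (sY k) => z; exact: cvg_snd.
Qed.

Lemma derive_tensor a Y s x (v : ST) : smooth a -> smooth Y ->
  'D_v (tensor a Y) (s, x) = 'D_(v.1) a s * Y x + a s * 'D_(v.2) Y x.
Proof.
move=> sa sY.
pose f1 := GRing.isLinear.Build _ _ _ _ fst fst_linear.
pose f2 := GRing.isLinear.Build _ _ _ _ snd snd_linear.
pose l1 : {linear ST -> R} := HB.pack (fst : ST -> R) f1.
pose l2 : {linear ST -> 'rV[R]_n} := HB.pack (snd : ST -> 'rV[R]_n) f2.
have [da _] := sa 1%N; have [dY _] := sY 1%N.
have c1 : continuous l1 by move=> z; exact: cvg_fst.
have c2 : continuous l2 by move=> z; exact: cvg_snd.
have d1 : differentiable (a \o l1) (s, x).
  by apply: differentiable_comp; [exact: linear_differentiable|exact: da].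
have d2 : differentiable (Y \o l2) (s, x).
  by apply: differentiable_comp; [exact: linear_differentiable|exact: dY].
rewrite [LHS](@deriveM _ _ (a \o l1) (Y \o l2)); [|exact: diff_derivable..].
rewrite !derive_comp_linear//=.
by rewrite addrC mulrC.
Qed.

End product_test.

(** * Radial functions and their Laplacian *)

Section radial.
Context {R : realType} {n : nat}.
Local Notation rV := 'rV[R]_n.
Implicit Types (x v : rV) (H : R -> R) (Y : rV -> R).

Lemma is_derive_coord i x v : is_derive x v (fun y : rV => y ord0 i) (v ord0 i).
Proof.
have dc : differentiable (fun y : rV => y ord0 i) x by exact: differentiable_coord.
apply: DeriveDef; first exact: diff_derivable.
have : (h^-1 *: ((h *: v + x) ord0 i - x ord0 i) : R) @[h --> 0^'] --> v ord0 i.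
  apply: (@cvg_trans _ (cst (v ord0 i) h @[h --> 0^'])); last exact: cvg_cst.
  apply: near_eq_cvg; near=> h.
  have h0 : h != 0 by near: h; exact: nbhs_dnbhs_neq.
  by rewrite !mxE addrK scalerA mulVf// scale1r.
by move=> /cvg_lim; apply.
Unshelve. all: by end_near. Qed.

Lemma Ck_coord k i : Ck k (fun y : rV => y ord0 i).
Proof.
case: k => [|k]; first by move=> x; exact: coord_continuous.
split=> [x|v]; first exact: differentiable_coord.
rewrite (_ : 'D_v _ = cst (v ord0 i)); first exact: Ck_cst.
by apply/funext => x; have [_ ->] := is_derive_coord i x v.
Qed.

Definition nrm2 x : R := \sum_(i < n) x ord0 i ^+ 2.

Lemma nrm2_ge0 x : 0 <= nrm2 x.
Proof. by apply: sumr_ge0 => i _; rewrite sqr_ge0. Qed.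

Lemma enormE x : enorm x = Num.sqrt (nrm2 x). Proof. by []. Qed.

Lemma sqr_enorm x : enorm x ^+ 2 = nrm2 x.
Proof. by rewrite enormE sqr_sqrtr// nrm2_ge0. Qed.

Lemma enorm_ge0 x : 0 <= enorm x. Proof. exact: sqrtr_ge0. Qed.

Lemma eballP (r : R) x : 0 <= r -> (enorm x <= r) = (nrm2 x <= r ^+ 2).
Proof. by move=> r0; rewrite -sqr_enorm ler_sqr// nnegrE// enorm_ge0. Qed.

Lemma nrm2E : nrm2 = \sum_(i < n) (fun y : rV => y ord0 i) ^+ 2.
Proof. by apply/funext => x; rewrite fct_sumE; apply: eq_bigr => i _. Qed.

Lemma Ck_sum (V : normedModType R) m k (f : 'I_m -> V -> R) :
  (forall i, Ck k (f i)) -> Ck k (fun z => \sum_(i < m) f i z).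
Proof.
elim: m f => [|m IH] f Cf.
  by rewrite (_ : (fun _ => _) = cst 0); [exact: Ck_cst|apply/funext => x; rewrite big_ord0].
rewrite (_ : (fun _ => _) = (f ord0) \+ (fun z => \sum_(i < m) f (lift ord0 i) z)).
  by apply: CkD => //; exact: IH.
by apply/funext => x; rewrite big_ord_recl.
Qed.

Lemma Ck_nrm2 k : Ck k nrm2.
Proof.
by apply: Ck_sum => i; apply: CkM; exact: Ck_coord.
Qed.

Lemma is_derive_nrm2 i x : is_derive x (basis_rv i : rV) nrm2 (2 * x ord0 i).
Proof.
rewrite nrm2E.
apply: is_derive_eq; first by apply: is_derive_sum => j; exact: is_deriveX (is_derive_coord j x _).
rewrite (bigD1 i)//= big1 => [|j ji].
  by rewrite addr0 mxE !eqxx/= expr1 -[LHS]/(_ * _) mulr1.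
by rewrite mxE eqxx (negPf ji)/= scaler0.
Qed.

(** The profile is a function of the squared norm, a polynomial, so smoothness at the origin comes
    for free. *)
Definition radial H : rV -> R := H \o nrm2.

Lemma smooth_radial H : (forall k, Cn setT k H) -> smooth (radial H).
Proof. by move=> CH k; apply: (@Ck_comp _ _ setT) => //; exact: Ck_nrm2. Qed.

Lemma derive_radial H H1 i : (forall y : R, is_derive y 1 H (H1 y)) ->
  'D_(basis_rv i) (radial H) = fun x => H1 (nrm2 x) * (2 * x ord0 i).
Proof.
move=> dH; apply/funext => x.
have [d0 _] := Ck_nrm2 1%N.
by rewrite (derive_compR _ (d0 x) (dH _)); have [_ ->] := is_derive_nrm2 i x.
Qed.

Definition lap Y x : R := \sum_(i < n) 'D_(basis_rv i) ('D_(basis_rv i) Y) x.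

Lemma lap_radial H H1 H2 x :
  (forall y : R, is_derive y 1 H (H1 y)) ->
  (forall y : R, is_derive y 1 H1 (H2 y)) ->
  lap (radial H) x = 4 * nrm2 x * H2 (nrm2 x) + 2 * n%:R * H1 (nrm2 x).
Proof.
move=> dH dH1.
have [d0 _] := Ck_nrm2 1%N.
transitivity (\sum_(i < n) (4 * H2 (nrm2 x) * x ord0 i ^+ 2 + 2 * H1 (nrm2 x))).
  apply: eq_bigr => i _; rewrite (derive_radial _ dH).
  have dc := is_derive_coord i x (basis_rv i).
  have dn : is_derive x (basis_rv i : rV) (H1 \o nrm2) (H2 (nrm2 x) * (2 * x ord0 i)).
    apply: DeriveDef; last by rewrite (derive_compR _ (d0 x) (dH1 _)); have [_ ->] := is_derive_nrm2 i x.
    apply: diff_derivable; apply: differentiable_comp; first exact: d0.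
    by apply/derivable1_diffP; case: (dH1 (nrm2 x)).
  have [_ ->] := is_deriveM dn (is_deriveZ 2 dc).
  rewrite mxE !eqxx/= /GRing.scale/=.
  ring.
rewrite big_split/= -mulr_sumr sumr_const card_ord.
rewrite -/(nrm2 x) -mulr_natr.
ring.
Qed.

Lemma enorm_continuous : continuous (@enorm R n).
Proof.
move=> x; apply: (@continuous_comp _ _ _ nrm2 Num.sqrt); first exact: Ck_nrm2 0%N x.
exact: sqrt_continuous.
Qed.

Lemma test_rv_derive Y v : test_rv Y -> test_rv ('D_v Y).
Proof.
move=> [sY [r Yr]]; split=> [k|]; first by have [_] := sY k.+1; apply.
exists r => x xr; rewrite (@near_eq_derive _ _ _ _ (cst 0)) ?derive_cst//.
have {}xr : r < enorm x by rewrite ltNge; apply/negP.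
have nE : \forall z \near x, r < enorm z by exact: (@enorm_continuous x _ (lt_nbhsr xr)).
by apply: filterS nE => z rz; apply: Yr; apply/negP; rewrite -ltNge.
Qed.

Lemma test_rv_radial H r : (forall k, Cn setT k H) ->
  (forall y, r ^+ 2 < y -> H y = 0) -> 0 <= r -> test_rv (radial H).
Proof.
move=> CH Hr r0; split; first exact: smooth_radial.
by exists r => x /negP; rewrite /eball/= eballP// -ltNge => /Hr.
Qed.

Lemma test_spacetime_tensor (T : \bar R) (S : R) (a : R -> R) Y : time_itv T S ->
  smooth a -> (forall s, S < s -> a s = 0) -> test_rv Y ->
  test_spacetime T (tensor a Y).
Proof.
move=> TS sa a0 [sY [r Yr]]; split; first exact: smooth_tensor.
exists S, r; split=> // t x t0; rewrite /tensor/= mulf_eq0 negb_or => /andP[at0 Yx0].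
split; first by rewrite leNgt; apply: contra at0 => /a0 ->.
by apply: contrapT => /Yr; apply/eqP.
Qed.

End radial.

(** * Lebesgue measure of balls *)

Section lebesgue_rv_theory.
Context {R : realType}.

Lemma measurable_fun_open d (X : measurableType d) (D : set X) (f : X -> R) :
  measurable D -> (forall U, open U -> measurable (D `&` f @^-1` U)) ->
  measurable_fun D f.
Proof.
move=> mD mf; apply: (measurability _ (RGenOpens.measurableE R)).
by move=> _ [_ [a [b ->] <-]]; apply: mf; exact: interval_open.
Qed.

Lemma continuous_measurable_rv n (f : 'rV[R]_n -> R) :
  continuous f -> measurable_fun setT f.
Proof.
move=> /continuousP cf; apply: measurable_fun_open => // U oU; rewrite setTI.
by apply: open_rv_measurable; exact: cf.
Qed.

Lemma measurable_eball n (r : R) : measurable (@eball R n r).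
Proof.
rewrite (_ : eball r = (@enorm R n) @^-1` `]-oo, r]); last first.
  by apply/seteqP; split => x; rewrite /eball/= in_itv.
rewrite -[X in measurable X]setTI.
by apply: continuous_measurable_rv => //; exact: enorm_continuous.
Qed.

(** The ball lies in the cube of side [2 r]. This is enough for volumes up to a constant; the shells
    below require the exact scaling law. *)
Lemma lebesgue_eball_le n (r : R) : 0 <= r ->
  (lebesgue_rv R n (eball r) <= ((2 * r) ^+ n)%:E)%E.
Proof.
move=> r0; pose B := [set x : 'rV[R]_n | forall i, `[- r, r]%classic (x ord0 i)].
have <- : lebesgue_rv R n B = ((2 * r) ^+ n)%:E.
  rewrite (@lebesgue_rv_box R n (fun=> `[- r, r]%classic)); last by [].
  rewrite lebesgue_measure_itv/= lte_fin.
  have E : (if - r < r then (r%:E - (- r)%:E)%E else 0%E) = (2 * r)%:E.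
    case: ifPn => [_|]; first by rewrite -EFinB; congr EFin; ring.
    rewrite -leNgt => rr; have -> : r = 0 by apply/eqP; rewrite eq_le r0 andbT; lra.
    by rewrite mulr0.
  by rewrite E prodEFin prodr_const card_ord.
apply: le_measure; rewrite ?inE.
- exact: measurable_eball.
- rewrite (_ : B = \bigcap_(i in [set: 'I_n])
      ((fun x : 'rV[R]_n => x ord0 i) @^-1` `[- r, r])).
    apply: fin_bigcap_measurable => // i _.
    by rewrite -[X in measurable X]setTI; exact: measurable_coor.
  by apply/seteqP; split=> x /= Ax i => [_|]; exact: Ax.
- move=> x /=; rewrite /eball/= eballP// => xr i.
  rewrite /= in_itv/= -ler_norml -ler_sqr ?nnegrE//.
  apply: le_trans xr; rewrite /nrm2 (bigD1 i)//= real_normK ?num_real// lerDl.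
  by apply: sumr_ge0 => j _; exact: sqr_ge0.
Qed.

Lemma lebesgue_eball_fin n (r : R) : (lebesgue_rv R n (eball r) < +oo)%E.
Proof.
apply: (@le_lt_trans _ _ (lebesgue_rv R n (eball (Num.max r 0)))).
  apply: le_measure; rewrite ?inE; try exact: measurable_eball.
  by move=> x; rewrite /eball/= le_max => ->.
by apply: le_lt_trans (lebesgue_eball_le _ _) (ltry _); rewrite le_max lexx orbT.
Qed.

End lebesgue_rv_theory.

Section scaling.
Context {R : realType}.

(** By uniqueness of Lebesgue measure: the left side is a measure with the right value on every
    half-open interval. *)
Lemma lebesgue_scale1 (c : R) (A : set R) : 0 < c ->
  measurable (A : set (measurableTypeR R)) ->
  (c%:E * lebesgue_measure ((fun x : measurableTypeR R => (c * x)%R : measurableTypeR R) @^-1` A)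
   = lebesgue_measure A)%E.
Proof.
move=> c0 mA.
have mc : measurable_fun setT (fun x : measurableTypeR R => (c * x)%R : measurableTypeR R).
  exact: mulrl_measurable.
pose m1 := measure_function_pushforward__canonical__measure_function_Measure
    lebesgue_measure mc.
pose m2 : {measure set (measurableTypeR R) -> \bar R} := mscale (NngNum (ltW c0)) m1.
rewrite [RHS](@lebesgue_measure_unique R m2)//.
move=> _ [[a b]] _ <-; rewrite /m2/= /mscale/= /pushforward/=.
rewrite (_ : _ @^-1` _ = `]c^-1 * a, c^-1 * b]%classic); last first.
  apply/seteqP; split => x /=; rewrite !in_itv/=.
    by rewrite ltr_pdivrMl// ler_pdivlMl.
  by rewrite ltr_pdivrMl// ler_pdivlMl.
rewrite !lebesgue_measure_itv/= !lte_fin ltr_pM2l ?invr_gt0//.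
case: ifPn => _; last by rewrite mule0.
by rewrite -!EFinB -EFinM -mulrBr mulVKf// gt_eqF.
Qed.

(** Both sides are measures. Read on [R * 'rV_n], they agree on rectangles by the one-dimensional
    case and the induction hypothesis, and these determine the product measure. *)
Lemma lebesgue_scale n (c : R) (A : set 'rV[R]_n) : 0 < c -> measurable A ->
  ((c ^+ n)%:E * lebesgue_rv R n ((fun x => c *: x) @^-1` A) = lebesgue_rv R n A)%E.
Proof.
move=> c0; elim: n A => [|n IH] A mA.
  rewrite expr0 mul1e; congr (_ _); apply/seteqP; split => x /=;
    by rewrite [X in A X]thinmx0 [X in _ -> A X]thinmx0.
pose f (z : measurableTypeR R * 'rV[R]_n) : measurableTypeR R * 'rV[R]_n := ((c * z.1)%R, c *: z.2).
have mf : measurable_fun setT f.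
  apply: measurable_fun_pair.
    rewrite (_ : (fun _ => _) = (fun x : R => c * x) \o fst)//.
    by apply: measurableT_comp; [exact: mulrl_measurable|exact: measurable_fst].
  apply: measurable_fun_coorP => i.
  rewrite (_ : (fun _ => _) = (fun x => c * x) \o (fun z : measurableTypeR R * 'rV[R]_n => z.2 ord0 i)).
    apply: measurableT_comp; first exact: mulrl_measurable.
    apply: (@measurableT_comp _ _ _ _ _ _ (fun x : 'rV[R]_n => x ord0 i)).
      exact: measurable_coor.
    exact: measurable_snd.
  by apply/funext => z /=; rewrite mxE.
have mcons : measurable (@cons_rv R n @^-1` A).
  by rewrite -[X in measurable X]setTI; exact: measurable_cons_rv.
pose m := (lebesgue_measure \x lebesgue_rv R n)%E.
pose m1 := measure_function_pushforward__canonical__measure_function_Measure m mf.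
have cn0 : 0 <= c ^+ n.+1 by rewrite exprn_ge0// ltW.
pose m2 : {measure set (measurableTypeR R * 'rV[R]_n) -> \bar R} := mscale (NngNum cn0) m1.
rewrite /= /lebesgue_rvS /pushforward.
rewrite [RHS](@product_measure_unique _ _ _ _ _ lebesgue_measure (lebesgue_rv R n) m2 _ _ mcons).
  rewrite /m2/= /mscale/= /pushforward; congr (_ * _)%E; congr (m _).
  have E z : c *: cons_rv z = cons_rv (f z).
    apply/rowP => i; rewrite mxE.
    by case: (unliftP ord0 i) => [j|] ->; rewrite ?cons_rvS ?cons_rv0 ?mxE.
  by apply/seteqP; split => z /=; rewrite E.
move=> X Y mX mY; rewrite /m2/= /mscale/= /pushforward.
rewrite (_ : f @^-1` _ = ((fun x : measurableTypeR R => (c * x)%R : measurableTypeR R) @^-1` X) `*`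
   ((fun x => c *: x) @^-1` Y)); last by apply/seteqP; split => z.
have m1' : measurable ((fun x : measurableTypeR R => (c * x)%R : measurableTypeR R) @^-1` X).
  by rewrite -[X in measurable X]setTI; exact: mulrl_measurable.
have m2' : measurable ((fun x : 'rV[R]_n => c *: x) @^-1` Y).
  rewrite -[X in measurable X]setTI.
  suff : measurable_fun setT (fun x : 'rV[R]_n => c *: x) by apply.
  apply: measurable_fun_coorP => i.
  rewrite (_ : (fun _ => _) = (fun x => c * x) \o (fun x : 'rV[R]_n => x ord0 i)).
    by apply: measurableT_comp; [exact: mulrl_measurable|exact: measurable_coor].
  by apply/funext => z /=; rewrite mxE.
by rewrite /m product_measure1E// exprS EFinM muleACA lebesgue_scale1// IH.
Qed.

(** An equality is wanted because volumes of concentric balls will be subtracted. *)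
Lemma lebesgue_eball n (r : R) : 0 < r ->
  lebesgue_rv R n (eball r) = ((r ^+ n)%:E * lebesgue_rv R n (eball 1))%E.
Proof.
move=> r0; rewrite -(lebesgue_scale r0 (@measurable_eball R n r)).
congr (_ * _)%E; congr (lebesgue_rv R n _); apply/seteqP.
have E x : (enorm (r *: x : 'rV[R]_n) <= r) = (enorm x <= 1).
  rewrite (eballP _ (ltW r0)) (eballP _ ler01) expr1n.
  rewrite (_ : nrm2 _ = r ^+ 2 * nrm2 x); last first.
    by rewrite /nrm2 mulr_sumr; apply: eq_bigr => i _; rewrite mxE exprMn.
  by rewrite -[leRHS]mulr1 ler_pM2l// exprn_gt0.
by split => x; rewrite /eball/= E.
Qed.

End scaling.

(** * The Bessel series *)

Section bessel.
Context {R : realType}.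
Implicit Types (c : nat -> R) (m k : nat).

(** A class of coefficients stable under [pseries_diffs]: its power series converge everywhere and
    can be differentiated termwise any number of times. *)
Definition fact_bounded c := forall k, `|c k| <= (k`!%:R)^-1.

Definition psum c (y : R) : R := limn (pseries c y).

Lemma is_cvg_fact_bounded c (y : R) : fact_bounded c -> cvgn (pseries c y).
Proof.
move=> cb; apply: normed_cvg; apply: (series_le_cvg _ _ _ (is_cvg_series_exp_coeff `|y|)).
- by move=> k /=.
- by move=> k; exact: (exp_coeff_ge0 k (normr_ge0 y)).
- move=> k; rewrite /= normrM normrX mulrC.
  by rewrite ler_wpM2l// exprn_ge0.
Qed.

Lemma fact_bounded_diffs c : fact_bounded c -> fact_bounded (pseries_diffs c).
Proof.
move=> cb k; rewrite /pseries_diffs normrM ger0_norm//.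
rewrite (le_trans (ler_wpM2l _ (cb k.+1)))//.
by rewrite factS natrM invfM mulVKf// pnatr_eq0.
Qed.

Lemma is_derive_psum c (y : R) : fact_bounded c ->
  is_derive y (1 : R) (psum c) (psum (pseries_diffs c) y).
Proof.
move=> cb.
have cb1 := fact_bounded_diffs cb; have cb2 := fact_bounded_diffs cb1.
apply: (@pseries_snd_diffs _ _ (`|y| + 1)); try exact: is_cvg_fact_bounded.
by rewrite [ltRHS]ger0_norm ?ltrDl// addr_ge0.
Qed.

Lemma Cn_psum c k : fact_bounded c -> Cn setT k (psum c).
Proof.
elim: k c => [|k IH] c cb.
  move=> x _; apply: differentiable_continuous; apply/derivable1_diffP.
  by case: (is_derive_psum x cb).
exists (psum (pseries_diffs c)); last exact/IH/fact_bounded_diffs.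
by move=> x _; exact: is_derive_psum.
Qed.

(** With [n = m + 1] this is the mean of [w_1^(2k)] over the unit sphere of [R^n]. Hence the series
    with coefficients [bessel_c], taken at [|x|^2], is the spherical mean of [exp (x . w)], a
    multiple of [r^(1 - n/2) I_(n/2 - 1)(r)] at [r = |x|]; for [n = 1] it is [cosh r]. *)
Definition bessel_d m k : R := \prod_(j < k) ((2 * j + 1)%:R / (2 * j + m.+1)%:R).

Definition bessel_c m k : R := bessel_d m k / (2 * k)`!%:R.

Lemma bessel_dS m k :
  bessel_d m k.+1 = bessel_d m k * ((2 * k + 1)%:R / (2 * k + m.+1)%:R).
Proof. by rewrite /bessel_d big_ord_recr. Qed.

Lemma bessel_d_ge0 m k : 0 <= bessel_d m k.
Proof. by apply: prodr_ge0 => j _; rewrite divr_ge0. Qed.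

Lemma bessel_d_le1 m k : bessel_d m k <= 1.
Proof.
elim: k => [|k IH]; first by rewrite /bessel_d big_ord0.
rewrite bessel_dS mulr_ile1 ?bessel_d_ge0 ?divr_ge0//.
rewrite ler_pdivrMr ?ltr0n ?addnS// mul1r ler_nat; lia.
Qed.

Lemma fact_bounded_bessel m : fact_bounded (bessel_c m).
Proof.
move=> k; rewrite /bessel_c ger0_norm ?divr_ge0 ?bessel_d_ge0//.
rewrite ler_pdivrMr ?ltr0n ?fact_gt0// (le_trans (bessel_d_le1 m k))//.
rewrite ler_pdivlMl ?ltr0n ?fact_gt0// mulr1 ler_nat.
by apply: leq_fact; lia.
Qed.

(* Sequence form of [4 y F'' + 2 n F' = F] for [n = m.+1]. *)
Lemma bessel_cS m k :
  (2 * k.+1)%:R * (2 * k + m.+1)%:R * bessel_c m k.+1 = bessel_c m k.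
Proof.
rewrite /bessel_c bessel_dS (_ : (2 * k.+1)%N = (2 * k).+2); last by lia.
rewrite !factS !natrM.
have h1 : (2 * k).+1%:R != 0 :> R by rewrite pnatr_eq0.
have h2 : (2 * k).+2%:R != 0 :> R by rewrite pnatr_eq0.
have h3 : (2 * k)`!%:R != 0 :> R by rewrite pnatr_eq0 -lt0n fact_gt0.
have h4 : (2 * k + m.+1)%:R != 0 :> R by rewrite addnS pnatr_eq0.
rewrite addn1; move: h1 h2 h3 h4.
move: ((2 * k).+1%:R) ((2 * k).+2%:R) ((2 * k)`!%:R) ((2 * k + m.+1)%:R) => a b c e a0 b0 c0 e0.
by field; rewrite a0 b0 c0 e0.
Qed.

Lemma bessel_ode m (y : R) : let F := psum (bessel_c m) in
  let F1 := psum (pseries_diffs (bessel_c m)) in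
  let F2 := psum (pseries_diffs (pseries_diffs (bessel_c m))) in
  4 * y * F2 y + 2 * m.+1%:R * F1 y = F y.
Proof.
move=> F F1 F2.
have b0 := fact_bounded_bessel m.
have b1 := fact_bounded_diffs b0; have b2 := fact_bounded_diffs b1.
have c0 := @is_cvg_fact_bounded _ y b0.
have c1 := @is_cvg_fact_bounded _ y b1; have c2 := @is_cvg_fact_bounded _ y b2.
pose dd := pseries_diffs (pseries_diffs (bessel_c m)).
(* The factor [y] shifts the second-order series by one, so the identity is exact between partial
   sums when the other two series are taken one term further. *)
have cv : (fun N => 4 * y * pseries dd y N + 2 * m.+1%:R * pseries (pseries_diffs (bessel_c m)) y N.+1)
    @ \oo --> 4 * y * F2 y + 2 * m.+1%:R * F1 y.
  apply: cvgD; first by apply: cvgM; [exact: cvg_cst|exact: c2].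
  apply: cvgM; first exact: cvg_cst.
  rewrite (@cvg_shiftS _ (pseries (pseries_diffs (bessel_c m)) y)); exact: c1.
have cv0 : (fun N => pseries (bessel_c m) y N.+1) @ \oo --> F y.
  by rewrite (@cvg_shiftS _ (pseries (bessel_c m) y)); exact: c0.
have E : (fun N => 4 * y * pseries dd y N + 2 * m.+1%:R * pseries (pseries_diffs (bessel_c m)) y N.+1)
   = (fun N => pseries (bessel_c m) y N.+1).
  apply/funext => N; rewrite /pseries /series/= !big_nat_recl//= mulrDr addrCA !mulr_sumr.
  rewrite -big_split/=; congr (_ + _).
    by rewrite !expr0 !mulr1 -(bessel_cS m 0) /pseries_diffs; rewrite muln1 muln0 add0n mulrA mulr1.
  apply: eq_bigr => k _; rewrite /dd /pseries_diffs -(bessel_cS m k.+1) exprS.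
  rewrite !natrM !natrD !natrM -!natr1; ring.
by move/cvg_lim : cv0 => <-//; rewrite -E; apply/esym/cvg_lim.
Qed.

(** Decay of [bessel_d] like [k^(-m/2)], stated without square roots. The step from [k] to [k + 1]
    amounts to [(2k+1) (2k+m+2) <= (2k+2) (2k+m+1)]. *)
Lemma bessel_d_sqr m k :
  bessel_d m k ^+ 2 * (2 * k + m)`!%:R <= m`!%:R * (2 * k)`!%:R.
Proof.
elim: k => [|k IH]; first by rewrite /bessel_d big_ord0 expr1n mul1r muln0 add0n mulr1.
rewrite bessel_dS exprMn.
rewrite (_ : (2 * k.+1 + m)%N = (2 * k + m).+2); last by lia.
rewrite (_ : (2 * k.+1)%N = (2 * k).+2); last by lia.
rewrite !factS !natrM.
rewrite exprMn; set D := bessel_d m k ^+ 2 in IH *; set f1 := (2 * k + m)`!%:R in IH *.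
set f2 := (2 * k)`!%:R in IH *.
have -> : D * ((2 * k + 1)%:R ^+ 2 * (2 * k + m.+1)%:R^-1 ^+ 2) *
    ((2 * k + m).+2%:R * ((2 * k + m).+1%:R * f1)) =
    (D * f1) * ((2 * k + 1)%:R ^+ 2 * (2 * k + m).+2%:R / (2 * k + m).+1%:R).
  have : (2 * k + m).+1%:R != 0 :> R by rewrite pnatr_eq0.
  rewrite (addnS (2 * k) m); move: ((2 * k + m).+1%:R) => e e0.
  by field; rewrite e0.
have -> : m`!%:R * ((2 * k).+2%:R * ((2 * k).+1%:R * f2)) =
    (m`!%:R * f2) * ((2 * k).+2%:R * (2 * k).+1%:R) by ring.
apply: ler_pM => //.
- by rewrite mulr_ge0// /D sqr_ge0.
- rewrite ler_pdivrMr// -natrX -!natrM ler_nat; nia.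
Qed.

Lemma exp_partial_sum_le (r : R) N : 0 <= r ->
  \sum_(0 <= j < N) r ^+ j / j`!%:R <= expR r.
Proof.
move=> r0; apply: (nondecreasing_cvgn_le _ (is_cvg_series_exp_coeff r) N).
by apply: nondecreasing_series => k _ _; exact: exp_coeff_ge0.
Qed.

(** The left side keeps every second term of the exponential series from index [m] on, and all terms
    are nonnegative. *)
Lemma exp_even_sum_le (r : R) m N : 0 <= r ->
  \sum_(0 <= k < N) r ^+ (2 * k + m) / (2 * k + m)`!%:R <= expR r.
Proof.
move=> r0; apply: le_trans (exp_partial_sum_le (2 * N + m) r0).
have t0 j : 0 <= r ^+ j / j`!%:R by rewrite divr_ge0// exprn_ge0.
elim: N => [|N IH]; first by rewrite big_nil sumr_ge0.
rewrite big_nat_recr//= (_ : (2 * N.+1 + m)%N = (2 * N + m).+2); last by lia.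
by rewrite !big_nat_recr//= -addrA lerD// lerDl.
Qed.

Lemma psum_le c (y b : R) : fact_bounded c ->
  (forall N, \sum_(0 <= k < N) c k * y ^+ k <= b) -> psum c y <= b.
Proof.
move=> cb H; apply: limr_le; first exact: is_cvg_fact_bounded.
by near=> N; exact: H.
Unshelve. all: by end_near. Qed.

Lemma bessel_ge1 m (y : R) : 0 <= y -> 1 <= psum (bessel_c m) y.
Proof.
move=> y0; apply: limr_ge; first exact/is_cvg_fact_bounded/fact_bounded_bessel.
exists 1%N => // -[//|N] _ /=; rewrite /pseries /series/= big_nat_recl//=.
rewrite {1}/bessel_c /bessel_d big_ord0 muln0 expr0 fact0 mulr1 divr1 lerDl.
by apply: sumr_ge0 => k _; rewrite mulr_ge0 ?exprn_ge0// divr_ge0// bessel_d_ge0.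
Qed.

Lemma bessel_le_exp m (r : R) : 0 <= r -> psum (bessel_c m) (r ^+ 2) <= expR r.
Proof.
move=> r0; apply: psum_le; first exact: fact_bounded_bessel.
move=> N; apply: le_trans (exp_even_sum_le 0 N r0).
apply: ler_sum => k _; rewrite addn0 /bessel_c exprM [leRHS]mulrC.
by rewrite ler_wpM2r ?exprn_ge0 ?sqr_ge0// ler_pdivrMr ?mulVf ?bessel_d_le1//
  ?pnatr_eq0 ?ltr0n -?lt0n ?fact_gt0.
Qed.

(* With [t = r ^ (m / 2)], AM-GM gives [2 d <= t^-1 + t d^2], and [d^2] has the
   size [(2k)! / (2k+m)!] for which the series is again exponential. *)
Lemma bessel_decay m (r t : R) : 0 < r -> 0 < t -> t ^+ 2 = r ^+ m ->
  psum (bessel_c m) (r ^+ 2) <= (1 + m`!%:R) / t * expR r.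
Proof.
move=> r0 t0 tr; have rm0 : 0 < r ^+ m by rewrite exprn_gt0.
apply: psum_le; first exact: fact_bounded_bessel.
move=> N; rewrite mulrDl mul1r mulrDl.
have t1 : t^-1 = t / r ^+ m by rewrite -tr expr2 invfM mulVKf// gt_eqF.
apply: (@le_trans _ _ (t^-1 * (\sum_(0 <= k < N) r ^+ (2 * k + 0) / (2 * k + 0)`!%:R) +
   (m`!%:R / t) * (\sum_(0 <= k < N) r ^+ (2 * k + m) / (2 * k + m)`!%:R))); last first.
  apply: lerD; apply: ler_wpM2l; rewrite ?invr_ge0 ?divr_ge0 ?(ltW t0)//;
  by apply: exp_even_sum_le; exact: ltW.
rewrite !mulr_sumr -big_split/=; apply: ler_sum => k _.
rewrite addn0 /bessel_c exprD -exprM.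
have f0 : 0 < (2 * k)`!%:R :> R by rewrite ltr0n fact_gt0.
have f1 : 0 < (2 * k + m)`!%:R :> R by rewrite ltr0n fact_gt0.
have d0 := bessel_d_ge0 m k; have d2 := bessel_d_sqr m k.
have X0 : 0 < r ^+ (2 * k) by rewrite exprn_gt0.
have E1 : bessel_d m k <= t^-1 + t * bessel_d m k ^+ 2.
  have S := sqr_ge0 (1 - t * bessel_d m k).
  have td : 0 <= t * bessel_d m k by rewrite mulr_ge0// ltW.
  rewrite -(ler_pM2l t0) mulrDr mulfV ?gt_eqF//; nra.
have E2 : bessel_d m k ^+ 2 <= m`!%:R * (2 * k)`!%:R / (2 * k + m)`!%:R.
  by rewrite ler_pdivlMr.
rewrite mulrAC ler_pdivrMr//.
apply: (@le_trans _ _ ((t^-1 + t * (m`!%:R * (2 * k)`!%:R / (2 * k + m)`!%:R)) * r ^+ (2 * k))).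
  apply: ler_wpM2r; first exact: ltW.
  by apply: (le_trans E1); rewrite lerD2l; apply: ler_wpM2l => //; exact: ltW.
rewrite le_eqVlt; apply/orP; left; apply/eqP.
rewrite [m`!%:R / t]mulrC t1.
by field; rewrite !gt_eqF.
Qed.

End bessel.

(** * Integrals over balls by unit shells *)

Section shells.
Context {R : realType}.

Lemma succ_exp_le (k : R) m : 0 <= k ->
  (k + 1) ^+ m.+1 <= k ^+ m.+1 + m.+1%:R * (k + 1) ^+ m.
Proof.
move=> k0; elim: m => [|m IH]; first by rewrite !expr1 expr0 mulr1.
rewrite exprS (le_trans (ler_wpM2l _ IH)) ?addr_ge0//.
have H : k ^+ m.+1 <= (k + 1) ^+ m.+1.
  by rewrite lerXn2r ?nnegrE ?addr_ge0// lerDl.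
move: H; rewrite (exprS (k + 1)) (exprS k m.+1) -(natr1 m.+1).
move: (k ^+ m.+1) ((k + 1) ^+ m) => a b; lra.
Qed.

Definition ball_vol n : R := fine (lebesgue_rv R n (eball 1)).

Lemma ball_volE n : (ball_vol n)%:E = lebesgue_rv R n (eball 1).
Proof. by rewrite fineK// ge0_fin_numE// lebesgue_eball_fin. Qed.

Lemma ball_vol_ge0 n : 0 <= ball_vol n.
Proof. by rewrite fine_ge0. Qed.

Lemma shell_le m (k : nat) :
  (lebesgue_rv R m.+1 (eball k.+1%:R `\` eball k%:R) <=
   (ball_vol m.+1 * (m.+1%:R * k.+1%:R ^+ m))%:E)%E.
Proof.
have vol (j : nat) : lebesgue_rv R m.+1 (eball j.+1%:R) = (j.+1%:R ^+ m.+1 * ball_vol m.+1)%:E.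
  by rewrite lebesgue_eball// EFinM ball_volE.
(* The scaling law needs a positive radius, so the innermost shell is bounded by the whole unit
   ball. *)
case: k => [|k].
  apply: (@le_trans _ _ (lebesgue_rv R m.+1 (eball 1))).
    apply: le_measure; rewrite ?inE; last by move=> x [].
      by apply: measurableD; exact: measurable_eball.
    exact: measurable_eball.
  by rewrite -ball_volE lee_fin expr1n mulr1 ler_peMr ?ball_vol_ge0// ler1n.
rewrite measureD; [|exact: measurable_eball..|exact: lebesgue_eball_fin].
rewrite setIidr; last first.
  by move=> x; rewrite /eball/= => /le_trans; apply; rewrite ler_nat.
apply: (@le_trans _ _ ((k.+2%:R ^+ m.+1 * ball_vol m.+1)%:E
    - (k.+1%:R ^+ m.+1 * ball_vol m.+1)%:E)%E); first by rewrite -!vol; exact: lexx.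
rewrite -EFinB lee_fin -mulrBl mulrC ler_wpM2l ?ball_vol_ge0//.
by rewrite lerBlDl -(natr1 k.+1); exact: succ_exp_le.
Qed.

Lemma integral_le_cst_measure n (D : set 'rV[R]_n) (g : 'rV[R]_n -> R) (M : R) :
  measurable D -> measurable_fun setT g -> (forall x, 0 <= g x) ->
  (forall x, D x -> g x <= M) ->
  (\int[lebesgue_rv R n]_(x in D) (g x)%:E <= M%:E * lebesgue_rv R n D)%E.
Proof.
move=> mD mg g0 gM.
rewrite -(integral_cst (lebesgue_rv R n) mD); apply: ge0_le_integral => //.
- by move=> x _; rewrite lee_fin.
- by apply/measurable_EFinP; apply: measurable_funS mg.
Qed.

(** A substitute for polar coordinates: for an upper bound it suffices to control [g] on each unit
    shell. *)
Lemma integral_shells m (g : 'rV[R]_m.+1 -> R) (M : nat -> R) (N : nat) :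
  measurable_fun setT g -> (forall x, 0 <= g x) ->
  (forall k x, k%:R <= enorm x -> enorm x <= k.+1%:R -> g x <= M k) ->
  (\int[lebesgue_rv R m.+1]_(x in eball N%:R) (g x)%:E <=
    (\sum_(0 <= k < N) M k * (ball_vol m.+1 * (m.+1%:R * k.+1%:R ^+ m)))%:E)%E.
Proof.
move=> mg g0 gM; elim: N => [|N IH].
  have e0 x : @eball R m.+1 0 x -> g x <= M 0%N.
    by move=> x0; apply: gM; [exact: enorm_ge0|exact: le_trans x0 _].
  apply: le_trans (integral_le_cst_measure (measurable_eball 0) mg g0 e0) _.
  have -> : lebesgue_rv R m.+1 (eball 0) = 0%E.
    apply/eqP; rewrite eq_le measure_ge0 andbT.
    by rewrite (le_trans (lebesgue_eball_le _ (lexx 0)))// mulr0 expr0n.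
  by rewrite mule0 big_nil.
have EU : @eball R m.+1 N.+1%:R = eball N%:R `|` (eball N.+1%:R `\` eball N%:R).
  by rewrite setDUK// => x; rewrite /eball/= => /le_trans; apply; rewrite ler_nat.
rewrite EU ge0_integral_setU//=.
- rewrite big_nat_recr//= EFinD; apply: leeD => //.
  have h x : (eball N.+1%:R `\` eball N%:R) x -> g x <= M N.
    by move=> [x1 /negP]; rewrite -ltNge => /ltW x2; exact: gM.
  have mD : measurable (@eball R m.+1 N.+1%:R `\` eball N%:R).
    by apply: measurableD; exact: measurable_eball.
  apply: le_trans (integral_le_cst_measure mD mg g0 h) _.
  rewrite EFinM; apply: lee_wpmul2l; last exact: shell_le.
  (* A point of norm [N], which witnesses [0 <= M N]. *)
  pose x : 'rV[R]_m.+1 := N%:R *: delta_mx ord0 ord0.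
  have xN : enorm x = N%:R.
    apply/eqP; rewrite -(@eqrXn2 _ 2) ?enorm_ge0// sqr_enorm /nrm2 (bigD1 ord0)//= big1 => [|i i0].
      by rewrite !mxE !eqxx mulr1 addr0.
    by rewrite !mxE (negPf i0) mulr0 expr0n.
  by rewrite lee_fin (le_trans (g0 x))// gM// xN// ler_nat.
- exact: measurable_eball.
- by apply: measurableD; exact: measurable_eball.
- by apply/measurable_EFinP; apply: measurable_funS mg.
- by move=> x _; rewrite lee_fin.
- by apply/disj_setPS => x [x1 [_ x2]].
Qed.

(** For negative [b] this is [N <= (N - j) (1 + j)]. The loss is polynomial in the distance [j] to
    the last index, and an exponential will pay for it. *)
Lemma norm_pow_ratio (N j : nat) (b : R) : (j < N)%N ->
  (N - j)%:R `^ b <= N%:R `^ b * (1 + j%:R) `^ `|b|.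
Proof.
move=> jN; have N0 : 0 < N%:R :> R by rewrite ltr0n; lia.
have D0 : 0 < (N - j)%:R :> R by rewrite ltr0n; lia.
have j0 : 0 <= 1 + j%:R :> R by rewrite addr_ge0.
have j1 : 1 <= 1 + j%:R :> R by rewrite lerDl.
have [b0|b0] := leP 0 b.
  rewrite -[leLHS]mulr1 ler_pM ?powR_ge0//.
    by rewrite ge0_ler_powR ?nnegrE ?ler_nat ?leq_subr.
  by rewrite -[leLHS](powRr0 (1 + j%:R)) ler_powR// normr_ge0.
have [c c0 ->] : exists2 c, 0 < c & b = - c by exists (- b); rewrite ?oppr_gt0 ?opprK.
rewrite normrN (gtr0_norm c0) !powRN [leRHS]mulrC ler_pdivlMr ?powR_gt0//.
rewrite mulrC ler_pdivrMr ?powR_gt0// -powRM ?(ltW D0)//.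
apply: ge0_ler_powR; rewrite ?nnegrE ?(ltW c0) ?(ltW N0) ?mulr_ge0 ?(ltW D0)//.
rewrite -(natrD _ 1 j) -natrM ler_nat; nia.
Qed.

(** The exponential is compared with [B + 2] powers of [z = 1 + j]: [B] of them absorb [z^b], and
    the remaining two make the bound summable. *)
Lemma pow_exp_bound (b : R) : 0 <= b -> exists2 K : R, 0 < K &
  forall j : nat, (1 + j%:R) `^ b * expR (- j%:R) <= K * (1 + j%:R) ^- 2.
Proof.
move=> b0; pose B := Num.bound b.
exists ((B.+2)`!%:R * expR 1); first by rewrite mulr_gt0 ?expR_gt0// ltr0n fact_gt0.
move=> j; set z : R := 1 + j%:R.
have z0 : 0 < z by rewrite ltr_pwDl.
have z1 : 1 <= z by rewrite lerDl.
have zB : z `^ b <= z ^+ B.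
  by rewrite -powR_mulrn ?(ltW z0)// ler_powR// ltW// archi_boundP.
have zE : z ^+ B.+2 <= (B.+2)`!%:R * expR z.
  rewrite mulrC -ler_pdivrMr ?ltr0n ?fact_gt0//.
  by apply: le_trans (expR_ge1Dxn B.+1 (ltW z0)); rewrite lerDr.
have -> : - j%:R = 1 - z :> R by rewrite /z; ring.
rewrite ler_pdivlMr ?exprn_gt0// expRD expRN.
apply: (@le_trans _ _ (z ^+ B.+2 * expR 1 / expR z)).
  rewrite [leLHS](_ : _ = z `^ b * z ^+ 2 * expR 1 / expR z); last by ring.
  rewrite -(addn2 B) exprD; apply: ler_wpM2r; first by rewrite invr_ge0 expR_ge0.
  apply: ler_wpM2r; first exact: expR_ge0.
  by apply: ler_wpM2r => //; exact: sqr_ge0.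
rewrite ler_pdivrMr ?expR_gt0// [leRHS]mulrAC.
by apply: ler_wpM2r => //; exact: expR_ge0.
Qed.

Lemma sum_inv_sqr_le N : \sum_(0 <= j < N) (1 + j%:R : R) ^- 2 <= 2.
Proof.
(* Strengthened to a telescoping bound that is stable under induction. *)
suff H : \sum_(0 <= j < N.+1) (1 + j%:R : R) ^- 2 <= 2 - N.+1%:R^-1.
  apply: (@le_trans _ _ (2 - N.+1%:R^-1)); last by rewrite lerBlDr lerDl.
  apply: le_trans H; rewrite big_nat_recr//= lerDl.
  by rewrite invr_ge0 exprn_ge0// addr_ge0.
elim: N => [|N IH]; first by rewrite big_nat1 addr0 expr1n invr1; lra.
rewrite big_nat_recr//=; apply: le_trans (lerD IH (lexx _)) _.
have a0 : 0 < N.+1%:R :> R by rewrite ltr0n.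
rewrite -(natr1 N.+1) addrC; move: (N.+1%:R : R) a0 => a a0.
rewrite -subr_ge0 (_ : _ - _ = a^-1 * (1 + a) ^- 2); last first.
  by field; rewrite !gt_eqF// addr_gt0.
by rewrite mulr_ge0// invr_ge0 ?exprn_ge0// ?addr_ge0// ltW.
Qed.

(** The last term dominates. Read backwards, the term at distance [j] from it is smaller by
    [exp (-j)], up to the factor [(1 + j)^|b|], and this is summable uniformly in [N]. *)
Lemma sum_pow_exp_le (b s : R) : 1 <= s -> exists2 K : R, 0 < K &
  forall N : nat, \sum_(0 <= k < N) k.+1%:R `^ b * expR (s * k.+1%:R) <=
    K * (N%:R `^ b * expR (s * N%:R)).
Proof.
move=> s1; have [K K0 HK] := pow_exp_bound (normr_ge0 b).
exists (K * 2) => [|N]; first by rewrite mulr_gt0.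
rewrite big_nat_rev/= add0n.
apply: (@le_trans _ _ (\sum_(0 <= j < N) (K * (1 + j%:R) ^- 2) * (N%:R `^ b * expR (s * N%:R)))).
  rewrite big_nat [leRHS]big_nat; apply: ler_sum => j /andP[_ jN].
  rewrite (_ : (N - j.+1).+1 = (N - j)%N); last by lia.
  apply: (@le_trans _ _ (N%:R `^ b * (1 + j%:R) `^ `|b| * (expR (s * N%:R) * expR (- j%:R)))).
    apply: ler_pM; rewrite ?powR_ge0 ?expR_ge0 ?norm_pow_ratio//.
    rewrite -expRD ler_expR natrB ?(ltnW jN)// mulrBr lerD2l lerN2.
    by rewrite ler_peMl.
  rewrite [leLHS](_ : _ = ((1 + j%:R) `^ `|b| * expR (- j%:R)) * (N%:R `^ b * expR (s * N%:R))); last by ring.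
  by rewrite ler_wpM2r// mulr_ge0 ?powR_ge0 ?expR_ge0.
rewrite -mulr_suml ler_wpM2r ?mulr_ge0 ?powR_ge0 ?expR_ge0//.
by rewrite -mulr_sumr ler_wpM2l ?(ltW K0)// sum_inv_sqr_le.
Qed.

End shells.

Section bessel_ball.
Context {R : realType}.
Implicit Types (m : nat) (s rho t r : R).

(** For [r > 1] this is [bessel_decay] with [t = r^(m/2)]; for smaller [r] the plain exponential
    bound is enough. The power [-m/2] is that of the asymptotics of the spherical mean. *)
Lemma bessel_bound m : exists2 K : R, 0 < K & forall r, 0 <= r ->
  psum (bessel_c m) (r ^+ 2) <= K * ((1 + r) `^ (- (m%:R / 2)) * expR r).
Proof.
pose a : R := m%:R / 2.
have a0 : 0 <= a by rewrite divr_ge0.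
exists ((1 + m`!%:R) * 2 `^ a); first by rewrite mulr_gt0 ?powR_gt0// ltr_pwDl.
move=> r r0; have r1 : 0 < 1 + r by rewrite ltr_pwDl.
rewrite powRN -/a.
have [rl|rg] := leP r 1.
  apply: le_trans (bessel_le_exp m r0) _; rewrite mulrA ler_peMl ?expR_ge0//.
  rewrite ler_pdivlMr ?powR_gt0// mul1r.
  apply: (@le_trans _ _ (1 * 2 `^ a)); last by rewrite ler_wpM2r ?powR_ge0// lerDl.
  by rewrite mul1r ge0_ler_powR ?nnegrE ?(ltW r1)//; lra.
have r0' : 0 < r by lra.
have e : (r `^ a) ^+ 2 = r ^+ m.
  by rewrite -powR_mulrn ?powR_ge0// -powRrM divfK// powR_mulrn.
apply: le_trans (bessel_decay r0' (powR_gt0 a r0') e) _.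
rewrite mulrA; apply: ler_wpM2r; first exact: expR_ge0.
rewrite -!mulrA; apply: ler_wpM2l; first by rewrite addr_ge0.
rewrite ler_pdivlMr ?powR_gt0// mulrC ler_pdivrMr ?powR_gt0// -powRM//.
by rewrite ge0_ler_powR ?nnegrE ?mulr_ge0 ?(ltW r1)//; lra.
Qed.

Lemma measurable_bessel_pow m s :
  measurable_fun setT (fun x : 'rV[R]_m.+1 => psum (bessel_c m) (nrm2 x) `^ s).
Proof.
apply: (@measurableT_comp _ _ _ _ _ _ (@powR R ^~ s)); first exact: measurable_powR.
apply: continuous_measurable_rv.
have b := Cn_psum (1%N) (@fact_bounded_bessel R m).
exact: (@smooth_radial _ m.+1 _ (fun k => Cn_psum k (@fact_bounded_bessel R m)) 0%N).
Qed.

(** The exponent collects the surface factor [r^m] and the decay [r^(-m/2)] raised to [s], at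
    [r = t]. As the last shell dominates, summing over the shells costs no further power of [t]. *)
Lemma bessel_ball m rho s : 0 < rho -> 1 <= s -> exists2 K : R, 0 < K &
  forall t, 1 <= t ->
  (\int[lebesgue_rv R m.+1]_(x in eball (rho + t)) (psum (bessel_c m) (nrm2 x) `^ s)%:E
   <= (K * (t `^ (m%:R - m%:R / 2 * s) * expR (s * t)))%:E)%E.
Proof.
move=> rho0 s1; have s0 : 0 <= s by lra.
have [K0 K00 HK0] := bessel_bound m.
pose b : R := m%:R - m%:R / 2 * s.
have [K1 K10 HK1] := sum_pow_exp_le b s1.
pose V := ball_vol (R := R) m.+1 * m.+1%:R.
have V0 : 0 <= V by rewrite mulr_ge0 ?ball_vol_ge0.
(* The last factor pays for replacing the integer radius [N <= rho + t + 1] by [t]: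
   [N / t <= rho + 2] since [t >= 1], and [N - t <= rho + 1]. *)
pose K2 := K0 `^ s * V * K1 * ((rho + 2) `^ `|b| * expR (s * (rho + 1))).
have K20 : 0 <= K2 by rewrite /K2 !mulr_ge0 ?powR_ge0 ?expR_ge0 ?(ltW K10) ?ball_vol_ge0.
exists (K2 + 1) => [|t t1]; first by rewrite ltr_wpDl.
pose N := (Num.truncn (rho + t)).+1.
have rt0 : 0 <= rho + t by lra.
have /andP[tr1 tr2] := Num.Theory.truncn_itv rt0.
have Nge : rho + t <= N%:R by exact: ltW.
have Nle : N%:R <= rho + t + 1 by rewrite /N -natr1 lerD2r.
pose g (x : 'rV[R]_m.+1) := psum (bessel_c m) (nrm2 x) `^ s.
have mg : measurable_fun setT g by exact: measurable_bessel_pow.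
have g0 x : 0 <= g x by exact: powR_ge0.
apply: (@le_trans _ _ (\int[lebesgue_rv R m.+1]_(x in eball N%:R) (g x)%:E)%E).
  apply: ge0_subset_integral; try exact: measurable_eball.
  - by apply/measurable_EFinP; apply: measurable_funS mg.
  - by move=> x _; rewrite lee_fin; exact: g0.
  - by move=> x; rewrite /eball/= => /le_trans; apply.
pose M (k : nat) : R := K0 `^ s * (k.+1%:R `^ (- (m%:R / 2) * s) * expR (s * k.+1%:R)).
have gM k x : k%:R <= enorm x -> enorm x <= k.+1%:R -> g x <= M k.
  move=> kx xk; have k0 : 0 < k.+1%:R :> R by rewrite ltr0n.
  have e0 : 0 < 1 + enorm x by rewrite ltr_pwDl// enorm_ge0.
  have -> : M k = (K0 * (k.+1%:R `^ (- (m%:R / 2)) * expR k.+1%:R)) `^ s.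
    rewrite !powRM ?mulr_ge0 ?powR_ge0 ?expR_ge0 ?(ltW K00)// -powRrM /M -expRM.
    by rewrite (mulrC s).
  rewrite /g -sqr_enorm; apply: ge0_ler_powR => //.
  - by rewrite nnegrE (le_trans ler01)// bessel_ge1// sqr_ge0.
  - by rewrite nnegrE !mulr_ge0 ?powR_ge0 ?expR_ge0 ?(ltW K00).
  apply: le_trans (HK0 _ (enorm_ge0 x)) _; rewrite ler_wpM2l ?(ltW K00)//.
  apply: ler_pM; rewrite ?powR_ge0 ?expR_ge0 ?ler_expR// !powRN lef_pV2 ?posrE ?powR_gt0//.
  by rewrite ge0_ler_powR ?nnegrE ?divr_ge0 ?(ltW e0) ?(ltW k0)// -natr1 addrC lerD2l.
apply: le_trans (integral_shells N mg g0 gM) _; rewrite lee_fin.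
apply: (@le_trans _ _ (K0 `^ s * V * \sum_(0 <= k < N) k.+1%:R `^ b * expR (s * k.+1%:R))).
  rewrite mulr_sumr; apply: ler_sum => k _; rewrite /M /V.
  rewrite /b -(powR_mulrn m (_ : 0 <= k.+1%:R))// powRD; last by rewrite pnatr_eq0 implybT.
  rewrite -(mulNr (m%:R / 2) s) le_eqVlt; apply/orP; left; apply/eqP; ring.
apply: (@le_trans _ _ (K0 `^ s * V * (K1 * (N%:R `^ b * expR (s * N%:R))))).
  by rewrite ler_wpM2l ?HK1// mulr_ge0 ?powR_ge0.
apply: (@le_trans _ _ (K2 * (t `^ b * expR (s * t)))); last first.
  by rewrite ler_wpM2r ?mulr_ge0 ?powR_ge0 ?expR_ge0// lerDl.
rewrite /K2 mulrA -(mulrA (K0 `^ s * V * K1)); apply: ler_wpM2l.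
  by apply: mulr_ge0 (ltW K10); apply: mulr_ge0 V0; exact: powR_ge0.
rewrite mulrACA; apply: ler_pM; rewrite ?powR_ge0 ?expR_ge0//; last first.
  by rewrite -expRD ler_expR -mulrDr ler_wpM2l//; lra.
have t0 : 0 < t by lra.
have -> : N%:R = (N%:R / t) * t by rewrite divfK// gt_eqF.
have Nt : 1 <= N%:R / t by rewrite ler_pdivlMr// mul1r; lra.
rewrite powRM ?divr_ge0 ?(ltW t0)// ler_wpM2r ?powR_ge0//.
apply: (@le_trans _ _ ((N%:R / t) `^ `|b|)); first by rewrite ler_powR// ler_norm.
apply: ge0_ler_powR; rewrite ?nnegrE ?divr_ge0 ?(ltW t0)//; first by lra.
rewrite ler_pdivrMr//; nra.
Qed.

End bessel_ball.

(** * Pairings with test functions *)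

Section pairing.
Context {R : realType} {n : nat}.
Local Notation rV := 'rV[R]_n.
Local Notation leb := (lebesgue_rv R n).
Implicit Types (f g Y : rV -> R).

Definition pair f Y : R := \int[leb]_x (f x * Y x).

Lemma coord_le_enorm (x : rV) i : `|x ord0 i| <= enorm x.
Proof.
rewrite -ler_sqr ?nnegrE ?enorm_ge0// sqr_enorm real_normK ?num_real//.
by rewrite /nrm2 (bigD1 i)//= lerDl sumr_ge0// => j _; rewrite sqr_ge0.
Qed.

Lemma compact_eball (r : R) : compact (@eball R n r).
Proof.
apply: bounded_closed_compact.
  exists `|r|; split; first exact: num_real.
  move=> M rM x; rewrite /eball/= => xr.
  have M0 : 0 <= M by rewrite (le_trans (normr_ge0 r))// ltW.
  rewrite /Num.norm/= mx_normrE; apply: bigmax_le => // -[i j] _ /=.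
  rewrite (ord1 i) (le_trans (coord_le_enorm x j))// (le_trans xr)//.
  by rewrite (le_trans (ler_norm r))// ltW.
have -> : eball r = (@enorm R n) @^-1` [set y | y <= r] by [].
by move/continuous_closedP : (@enorm_continuous R n); apply; exact: closed_le.
Qed.

Lemma test_continuous Y : test_rv Y -> continuous Y.
Proof. by move=> [sY _]; exact: (sY 0%N). Qed.

Lemma test_bounded Y : test_rv Y -> exists M r : R,
  [/\ 0 <= M, 0 <= r, forall x, `|Y x| <= M & forall x, ~ eball r x -> Y x = 0].
Proof.
move=> tY; have cY := test_continuous tY; have [_ [r Yr]] := tY.
have Yr0 x : ~ eball (Num.max r 0) x -> Y x = 0.
  by move=> xr; apply: Yr => xr'; apply: xr; rewrite /eball/= le_max xr'.
have r0 : 0 <= Num.max r 0 by rewrite le_max lexx orbT.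
have A0 : @eball R n (Num.max r 0) !=set0.
  exists 0; rewrite /eball/= (_ : enorm 0 = 0)//.
  by rewrite enormE /nrm2 big1 ?sqrtr0// => i _; rewrite mxE expr0n.
have cN : {within @eball R n (Num.max r 0), continuous (fun x => `|Y x|)}.
  apply: continuous_subspaceT => x; apply: (@continuous_comp _ _ _ Y Num.norm); first exact: cY.
  exact: norm_continuous.
have [c _ cP] := EVT_max_rV A0 (@compact_eball _) cN.
exists `|Y c|, (Num.max r 0); split => // x.
have [xr|xr] := pselect (eball (Num.max r 0) x); last by rewrite Yr0// normr0.
by apply: cP; rewrite inE.
Qed.

Lemma L1loc_lin (a b : R) f g : L1loc f -> L1loc g ->
  L1loc (fun x => a * f x + b * g x).
Proof.
move=> [mf If] [mg Ig]; split.
  by apply: measurable_funD; apply: measurable_funM.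
move=> r; have mr := @measurable_eball R n r.
rewrite (_ : EFin \o _ = (fun x => a%:E * (EFin \o f) x) \+ (fun x => b%:E * (EFin \o g) x))%E.
  by apply: integrableD => //; apply: integrableZl.
by apply/funext => x /=; rewrite EFinD !EFinM.
Qed.

Section fixed_test.
Variables (Y : rV -> R).
Hypothesis tY : test_rv Y.

Lemma measurable_pair f : measurable_fun setT f ->
  measurable_fun setT (fun x => f x * Y x).
Proof.
move=> mf; apply: measurable_funM => //.
by apply: continuous_measurable_rv; exact: test_continuous.
Qed.

Lemma integrable_pair f : L1loc f -> leb.-integrable setT (EFin \o (fun x => f x * Y x)).
Proof.
move=> [mf If]; have [M [r [M0 r0 YM Yr]]] := test_bounded tY.
have mr := @measurable_eball R n r.
rewrite (_ : EFin \o _ = (EFin \o (fun x => f x * Y x)) \_ (eball r)); last first.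
  apply/funext => x; rewrite /patch; case: ifPn => // /negP.
  by rewrite inE => /Yr /= ->; rewrite mulr0.
apply: (integrable_mkcond _ mr).1.
rewrite (_ : EFin \o _ = (EFin \o f) \* (EFin \o Y))%E; last first.
  by apply/funext => x /=; rewrite EFinM.
apply: (integrableMl mr (If r)).
  apply: (@measurable_funS _ _ _ _ setT) => //.
  by apply: continuous_measurable_rv; exact: test_continuous.
exists M; split; first exact: num_real.
by move=> K MK x _ /=; rewrite (le_trans (YM x))// ltW.
Qed.

Lemma pairD f g : L1loc f -> L1loc g ->
  pair (fun x => f x + g x) Y = pair f Y + pair g Y.
Proof.
move=> lf lg; rewrite /pair -RintegralD//; try exact: integrable_pair.
by apply: eq_Rintegral => x _; rewrite mulrDl.
Qed.

Lemma pairZ a f : L1loc f -> pair (fun x => a * f x) Y = a * pair f Y.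
Proof.
move=> lf; rewrite /pair -RintegralZl//; last exact: integrable_pair.
by apply: eq_Rintegral => x _; rewrite mulrA.
Qed.

Lemma pair_lin a b f g : L1loc f -> L1loc g ->
  pair (fun x => a * f x + b * g x) Y = a * pair f Y + b * pair g Y.
Proof.
move=> lf lg.
have la : L1loc (fun x => a * f x).
  by have := L1loc_lin a 0 lf lf; under eq_fun do rewrite mul0r addr0.
have lb : L1loc (fun x => b * g x).
  by have := L1loc_lin b 0 lg lg; under eq_fun do rewrite mul0r addr0.
by rewrite pairD// !pairZ.
Qed.

(** Transfers to scalar pairings the seminorms over balls in which continuity and differentiability
    in time are stated. *)
Lemma pair_le f (M r : R) : L1loc f -> 0 <= M -> (forall x, `|Y x| <= M) ->
  (forall x, ~ eball r x -> Y x = 0) ->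
  (`|pair f Y|%:E <= M%:E * \int[leb]_(x in eball r) `|f x|%:E)%E.
Proof.
move=> lf M0 YM Yr; have [mf If] := lf.
have mr := @measurable_eball R n r.
rewrite /pair EFin_normr_Rintegral//; last exact: integrable_pair.
apply: le_trans (le_abse_integral _ _ _) _ => //.
  by apply/measurable_EFinP; exact: measurable_pair.
rewrite -ge0_integralZl//; last first.
  by apply/measurable_EFinP; apply: measurableT_comp => //; exact: measurable_funS mf.
rewrite [leRHS]integral_mkcond; apply: ge0_le_integral => //.
- by apply: measurableT_comp => //; apply/measurable_EFinP; exact: measurable_pair.
- apply/(measurable_restrictT _ _).1 => //; apply: emeasurable_funM => //.
  by apply/measurable_EFinP; apply: measurableT_comp => //; exact: measurable_funS mf.
- move=> x _; rewrite patchE; case: ifPn => [_|/negP].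
    by rewrite -EFinM lee_fin normrM mulrC ler_wpM2r.
  by rewrite inE => /Yr ->; rewrite mulr0 /= normr0.
Qed.

End fixed_test.

Lemma pair_sumr (m : nat) (f : 'I_m -> rV -> R) (Z : 'I_m -> rV -> R) :
  (forall i, L1loc (f i)) -> (forall i, test_rv (Z i)) ->
  \int[leb]_x (\sum_(i < m) f i x * Z i x) = \sum_(i < m) pair (f i) (Z i) /\
  leb.-integrable setT (EFin \o (fun x => \sum_(i < m) f i x * Z i x)).
Proof.
elim: m f Z => [|m IH] f Z lf tZ.
  under eq_Rintegral do rewrite big_ord0.
  rewrite big_ord0 (_ : EFin \o _ = cst 0%E); last first.
    by apply/funext => x /=; rewrite big_ord0.
  split; last exact: integrable0.
  by rewrite /Rintegral integral0.
have [IH1 IH2] := IH (fun i => f (lift ord0 i)) (fun i => Z (lift ord0 i)) (fun i => lf _) (fun i => tZ _).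
have i0 := integrable_pair (tZ ord0) (lf ord0).
under eq_Rintegral do rewrite big_ord_recl.
split; first by rewrite RintegralD// big_ord_recl IH1.
pose F1 x := f ord0 x * Z ord0 x.
pose F2 x := \sum_(i < m) f (lift ord0 i) x * Z (lift ord0 i) x.
rewrite (_ : EFin \o _ = ((EFin \o F1) \+ (EFin \o F2))%E).
  exact: integrableD.
by apply/funext => x /=; rewrite big_ord_recl EFinD.
Qed.

(** The weak gradient is tested against the first derivatives of [Y], which are test functions
    themselves. *)
Lemma pair_lap f (gf : 'I_n -> rV -> R) Y : L1loc f -> (forall i, L1loc (gf i)) ->
  weak_gradient f gf -> test_rv Y ->
  \int[leb]_x (\sum_(i < n) gf i x * 'D_(basis_rv i) Y x) = - pair f (lap Y).
Proof.
move=> lf lg wg tY.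
have tD i : test_rv ('D_(basis_rv i) Y) by exact: test_rv_derive.
have tDD i : test_rv ('D_(basis_rv i) ('D_(basis_rv i) Y)) by exact: test_rv_derive.
rewrite (pair_sumr lg tD).1.
have [E _] := pair_sumr (fun _ : 'I_n => lf) tDD.
rewrite (_ : pair f (lap Y) = \sum_(i < n) pair f ('D_(basis_rv i) ('D_(basis_rv i) Y))).
  rewrite -sumrN; apply: eq_bigr => i _.
  by rewrite /pair (wg i _ (tD i)) opprK.
by rewrite -E /pair; apply: eq_Rintegral => x _; rewrite /lap mulr_sumr.
Qed.

Lemma pair_ae_eq f g Y : measurable_fun setT f -> measurable_fun setT g -> test_rv Y ->
  {ae leb, forall x, f x = g x} -> pair f Y = pair g Y.
Proof.
move=> mf mg tY fg; rewrite /pair /Rintegral; congr fine.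
apply: ae_eq_integral => //; try by apply/measurable_EFinP; exact: measurable_pair.
by apply: filterS fg => x /= -> _.
Qed.

Lemma pair_eq_test f Y Z (L : R) : measurable_fun setT f -> measurable_fun setT Y ->
  measurable_fun setT Z -> supported_in L f ->
  (forall x, eball L x -> Y x = Z x) -> pair f Y = pair f Z.
Proof.
move=> mf mY mZ fL YZ; rewrite /pair /Rintegral; congr fine.
apply: ae_eq_integral => //; try by apply/measurable_EFinP; exact: measurable_funM.
apply: filterS fL => x /= fx _.
have [xL|xL] := pselect (eball L x); first by rewrite YZ.
by rewrite fx// !mul0r.
Qed.

End pairing.

(** * Integration by parts on a time segment *)

Section C1_segment.
Context {R : realType}.
Implicit Types (a b : R) (f g : R -> R).

(** The derivative is two-sided in the open interval, and only continuity reaches the endpoints: at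
    time 0 a solution has one-sided difference quotients only. *)
Record C1seg a b (f f' : R -> R) : Prop := C1Seg {
  C1seg_cont : {within `[a, b], continuous f} ;
  C1seg_cont' : {within `[a, b], continuous f'} ;
  C1seg_der : forall t, a < t < b -> is_derive t (1 : R) f (f' t) }.

Lemma C1seg_LR a b f f' : a < b -> C1seg a b f f' -> derivable_oo_LRcontinuous f a b.
Proof.
move=> ab [cf _ df]; have [_ ca cb] := (continuous_within_itvP f ab).1 cf.
split=> // t; rewrite in_itv/= => tab.
by case: (df t tab).
Qed.

Lemma C1seg_derive1 a b f f' : C1seg a b f f' -> {in `]a, b[, (f^`())%classic =1 f'}.
Proof.
by move=> [_ _ df] t; rewrite in_itv/= => /df [_ <-]; rewrite derive1E.
Qed.

Lemma C1segS a b c f f' : c <= b -> C1seg a b f f' -> C1seg a c f f'.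
Proof.
move=> cb [cf cf' df].
have sub : [set` `[a, c]] `<=` [set` `[a, b]].
  by move=> x; rewrite /= !in_itv/= => /andP[-> /le_trans]; apply.
split; [exact: continuous_subspaceW cf|exact: continuous_subspaceW cf'|].
by move=> t /andP[at_ tc]; apply: df; rewrite at_ (lt_le_trans tc).
Qed.

Lemma C1seg_FTC2 a b f f' : a <= b -> C1seg a b f f' ->
  \int[lebesgue_measure]_(s in `[a, b]) f' s = f b - f a.
Proof.
rewrite le_eqVlt => /predU1P[<- _|ab C].
  by rewrite subrr set_itv1 Rintegral_set1.
rewrite /Rintegral (continuous_FTC2 ab (C1seg_cont' C) (C1seg_LR ab C))//.
exact: C1seg_derive1.
Qed.

Lemma C1seg_parts a b f f' g g' : a <= b -> C1seg a b f f' -> C1seg a b g g' ->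
  \int[lebesgue_measure]_(s in `[a, b]) (f s * g' s) =
  f b * g b - f a * g a - \int[lebesgue_measure]_(s in `[a, b]) (f' s * g s).
Proof.
rewrite le_eqVlt => /predU1P[<- _ _|ab Cf Cg].
  by rewrite subrr set_itv1 !Rintegral_set1 subrr.
apply: Rintegration_by_parts => //.
- exact: C1seg_cont' Cf.
- exact: C1seg_LR Cf.
- exact: C1seg_derive1.
- exact: C1seg_cont' Cg.
- exact: C1seg_LR Cg.
- exact: C1seg_derive1.
Qed.

Lemma within_continuousM (A : set R) f g : {within A, continuous f} ->
  {within A, continuous g} -> {within A, continuous (fun x => f x * g x)}.
Proof. by move=> cf cg x; apply: cvgM; [exact: cf|exact: cg]. Qed.

Lemma within_continuousD (A : set R) f g : {within A, continuous f} ->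
  {within A, continuous g} -> {within A, continuous (fun x => f x + g x)}.
Proof. by move=> cf cg x; apply: cvgD; [exact: cf|exact: cg]. Qed.

Lemma within_continuousN (A : set R) f : {within A, continuous f} ->
  {within A, continuous (fun x => - f x)}.
Proof. by move=> cf x; apply: cvgN; exact: cf. Qed.

Lemma within_integrable a b f : {within `[a, b], continuous f} ->
  lebesgue_measure.-integrable `[a, b] (EFin \o f).
Proof. by move=> cf; apply: continuous_compact_integrable => //; exact: segment_compact. Qed.

Lemma C1seg_global a b f f' : (forall t, is_derive t (1 : R) f (f' t)) ->
  continuous f' -> C1seg a b f f'.
Proof.
move=> df cf'; split=> //; try by apply: continuous_subspaceT.
apply: continuous_subspaceT => x; apply: differentiable_continuous.
by apply/derivable1_diffP; case: (df x).
Qed.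

End C1_segment.

Section time_regularity.
Context {R : realType} {n : nat}.
Local Notation rV := 'rV[R]_n.
Local Notation leb := (lebesgue_rv R n).
Implicit Types (T : \bar R) (w wt : R -> rV -> R) (Y : rV -> R).

Lemma cvg_dominated_ereal (I : Type) (F : set_system I) {FF : Filter F}
    (h : I -> R) (e : I -> \bar R) (l M : R) : 0 <= M -> e @ F --> 0%E ->
  (\forall t \near F, (`|h t - l|%:E <= M%:E * e t)%E) -> h @ F --> l.
Proof.
move=> M0 e0 he; apply/cvgrPdist_lt => d d0.
have d1 : 0 < d / (M + 1) by rewrite divr_gt0// ltr_wpDl.
have := e0 _ (@open_ereal_lt' _ 0%E (d / (M + 1))%:E _); rewrite lte_fin => /(_ d1) ed.
apply: filterS2 he ed => t he ed; rewrite distrC -lte_fin (le_lt_trans he)//.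
have [M00|Mn0] := eqVneq M 0; first by rewrite M00 mul0e lte_fin.
have Mp : 0 < M by rewrite lt_def Mn0.
have : (M%:E * e t < M%:E * (d / (M + 1))%:E)%E by rewrite lte_pmul2l// lte_fin.
move=> /lt_le_trans; apply.
rewrite -EFinM lee_fin mulrCA ger_pMr// ler_pdivrMr ?ltr_wpDl// mul1r lerDl.
exact: ler01.
Qed.

Lemma pair_cvg T w Y t0 : C_L1loc T w -> test_rv Y -> time_itv T t0 ->
  pair (w t) Y @[t --> within (time_itv T) (nbhs t0)] --> pair (w t0) Y.
Proof.
move=> [lw cw] tY Tt0; have [M [r [M0 r0 YM Yr]]] := test_bounded tY.
apply: (cvg_dominated_ereal M0 (cw t0 r Tt0)).
apply: filterS (withinT _ _) => t Tt.
have -> : pair (w t) Y - pair (w t0) Y = pair (fun x => 1 * w t x + (- 1) * w t0 x) Y.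
  rewrite pair_lin//; [by rewrite mul1r mulN1r|exact: lw|exact: lw].
apply: le_trans (pair_le tY (L1loc_lin _ _ (lw _ Tt) (lw _ Tt0)) M0 YM Yr) _.
by under eq_integral do rewrite mul1r mulN1r.
Qed.

Lemma pair_diffquot_cvg T w wt Y t0 : C1_L1loc T w wt -> test_rv Y -> time_itv T t0 ->
  (pair (w t) Y - pair (w t0) Y) / (t - t0) @[t --> within (time_itv T) t0^'] -->
  pair (wt t0) Y.
Proof.
move=> [[lw cw] [lwt _] dw] tY Tt0; have [M [r [M0 r0 YM Yr]]] := test_bounded tY.
apply: (cvg_dominated_ereal M0 (dw t0 r Tt0)).
apply: filterS (withinT _ _) => t Tt.
pose f1 x := 1 * w t x + (- 1) * w t0 x.
have lf1 : L1loc f1 by exact: (L1loc_lin _ _ (lw _ Tt) (lw _ Tt0)).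
have -> : (pair (w t) Y - pair (w t0) Y) / (t - t0) - pair (wt t0) Y =
    pair (fun x => (t - t0)^-1 * f1 x + (- 1) * wt t0 x) Y.
  rewrite pair_lin//; last exact: lwt.
  rewrite /f1 pair_lin//; [|exact: lw|exact: lw].
  by rewrite mul1r !mulN1r mulrC.
apply: le_trans (pair_le tY (L1loc_lin _ _ lf1 (lwt _ Tt0)) M0 YM Yr) _.
by under eq_integral do rewrite /f1 mul1r !mulN1r mulrC.
Qed.

Lemma time_itv_sub T S t : time_itv T S -> 0 <= t -> t <= S -> time_itv T t.
Proof.
move=> [S0 ST] t0 tS; split=> //; apply: le_lt_trans ST; by rewrite lee_fin.
Qed.

Lemma within_pair_continuous T S w Y : C_L1loc T w -> test_rv Y -> time_itv T S ->
  {within `[0, S], continuous (fun t => pair (w t) Y)}.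
Proof.
move=> cw tY TS; apply/subspace_continuousP => t0 /=; rewrite in_itv/= => /andP[t00 t0S].
have Tt0 := time_itv_sub TS t00 t0S.
apply: cvg_trans (pair_cvg cw tY Tt0); apply: cvg_app.
apply: within_subset => t /=; rewrite in_itv/= => /andP[]; exact: time_itv_sub.
Qed.

Lemma C1seg_pair T S w wt Y : C1_L1loc T w wt -> test_rv Y -> time_itv T S ->
  C1seg 0 S (fun t => pair (w t) Y) (fun t => pair (wt t) Y).
Proof.
move=> Cw tY TS; have [cw cwt _] := Cw.
split; [exact: within_pair_continuous TS|exact: within_pair_continuous TS|].
move=> t0 /andP[t00 t0S].
have Tt0 := time_itv_sub TS (ltW t00) (ltW t0S).
have nT : \forall t \near t0, time_itv T t.
  near=> t; apply: (time_itv_sub TS).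
    by apply: ltW; near: t; exact: lt_nbhsr.
  by apply: ltW; near: t; exact: lt_nbhsl.
apply/is_derive1_caratheodory.
pose f t := pair (w t) Y.
(* Caratheodory's slope: the difference quotient completed by its limit. Near the interior point
   [t0] the limit within [time_itv T] is a full limit. *)
exists (fun t => if t == t0 then pair (wt t0) Y else (f t - f t0) / (t - t0)); split.
- move=> t; case: eqP => [->|/eqP tt0]; first by rewrite !subrr mulr0.
  by rewrite divfK// subr_eq0.
- apply/continuous_withinNx; rewrite eqxx.
  have := pair_diffquot_cvg Cw tY Tt0; rewrite -/f => H.
  move=> A /H /= HA.
  have nn : \forall t \near t0^', t != t0 by exact: nbhs_dnbhs_neq.
  have nT' : \forall t \near t0^', time_itv T t by exact: (@nbhs_dnbhs _ _ _ nT).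
  rewrite /nbhs/= in HA *.
  near=> t.
  have tt0 : t != t0 by near: t.
  rewrite /= (negPf tt0).
  have : time_itv T t by near: t.
  by near: t.
- by rewrite eqxx.
Unshelve. all: by end_near. Qed.

End time_regularity.

(** * The weak equation on product test functions *)

Section tested_equation.
Context {R : realType} {n : nat}.
Local Notation rV := 'rV[R]_n.
Local Notation leb := (lebesgue_rv R n).
Local Notation mu := (@lebesgue_measure R).

(** Covers infinite integrals as well: both sides are then 0 by the convention of [fine]. The
    nonlinear term calls for this, since its slice at a given time may have an infinite integral. *)
Lemma Rintegral_ge0Zl d (X : measurableType d) (m : {measure set X -> \bar R})
    (D : set X) (f : X -> R) (c : R) : measurable D -> measurable_fun D f ->
  (forall x, D x -> 0 <= f x) -> 0 <= c ->
  \int[m]_(x in D) (c * f x) = c * \int[m]_(x in D) f x.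
Proof.
move=> mD mf f0 c0; rewrite /Rintegral.
under eq_integral do rewrite EFinM.
rewrite ge0_integralZl//; last exact/measurable_EFinP.
have : (0 <= \int[m]_(x in D) (f x)%:E)%E by apply: integral_ge0 => x /f0; rewrite lee_fin.
case: (\int[m]_(x in D) (f x)%:E)%E => //= _.
move: c0; rewrite le_eqVlt => /predU1P[<-|c0]; first by rewrite mul0e mul0r.
by rewrite mulry gtr0_sg// mul1e mulr0.
Qed.

Variables (T : \bar R) (b : R -> R) (p eps : R) (w1 : rV -> R)
  (w wt z : R -> rV -> R) (gw : 'I_n -> R -> rV -> R).
Hypotheses (Cw : C_W11loc T w gw) (C1w : C1_L1loc T w wt).
Hypothesis zm : forall s, time_itv T s -> measurable_fun setT (z s).
Hypothesis lw1 : L1loc w1.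
Hypothesis weq : weak_equation T b p eps w1 wt gw z.

Definition nonlin Y (s : R) : R := \int[leb]_x (`|z s x| `^ p * Y x).

(** The eigenvalue identity enters only where [w s] lives, so [Y] may be cut off outside [eball L].
    Time derivatives stay on [w]: the plateau estimates then integrate by parts, whereas the Bessel
    mode makes the coefficient of [wt] vanish. *)
Lemma tested_equation (a a' : R -> R) (Y : rV -> R) (lam L S t : R) :
  smooth a -> (forall s, is_derive s (1 : R) a (a' s)) -> (forall s, 0 <= a s) ->
  time_itv T S -> (forall s, S < s -> a s = 0) ->
  test_rv Y -> (forall x, 0 <= Y x) -> (forall x, eball L x -> lap Y x = lam * Y x) ->
  0 < t -> (t%:E < T)%E -> (forall s, 0 <= s <= t -> supported_in L (w s)) ->
  \int[mu]_(s in `[0, t]) ((- a' s + b s * a s) * pair (wt s) Y - lam * (a s * pair (w s) Y))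
    + a t * pair (wt t) Y =
  eps * (a 0 * pair w1 Y) + \int[mu]_(s in `[0, t]) (a s * nonlin Y s).
Proof.
move=> sa da a0 TS aS tY Y0 lapY t0 tT suppw.
have [_ Cg wg] := Cw; have [Cw1 Cwt _] := C1w.
have [sY _] := tY.
have Tt : time_itv T t by split; [exact: ltW|].
have tphi := test_spacetime_tensor TS sa aS tY.
have D1 s x : 'D_(1, 0) (tensor a Y) (s, x) = a' s * Y x.
  rewrite derive_tensor//= derive0 mulr0 addr0.
  by have [_ ->] := da s.
have D2 i s x : 'D_(0, basis_rv i) (tensor a Y) (s, x) = a s * 'D_(basis_rv i) Y x.
  by rewrite derive_tensor//= derive0 mul0r add0r.
have := weq tphi t0 tT.
have -> : \int[leb]_x (wt t x * tensor a Y (t, x)) = a t * pair (wt t) Y.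
  rewrite -(pairZ tY)//; last exact: (Cwt.1 _ Tt).
  by apply: eq_Rintegral => x _; rewrite /tensor/=; ring.
have -> : \int[mu]_(s in `[0, t]) \int[leb]_x (`|z s x| `^ p * tensor a Y (s, x)) =
    \int[mu]_(s in `[0, t]) (a s * nonlin Y s).
  apply: eq_Rintegral => s; rewrite inE/= in_itv/= => /andP[s0 st].
  have Ts := time_itv_sub Tt s0 st.
  rewrite /nonlin -Rintegral_ge0Zl//.
  - by apply: eq_Rintegral => x _; rewrite /tensor/=; ring.
  - apply: measurable_pair => //.
    apply: (@measurableT_comp _ _ _ _ _ _ (@powR R ^~ p)); first exact: measurable_powR.
    by apply: measurableT_comp => //; exact: zm.
  - by move=> x _; rewrite mulr_ge0 ?powR_ge0.
have -> : \int[leb]_x (w1 x * tensor a Y (0, x)) = \int[leb]_x (a 0 * (w1 x * Y x)).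
  by apply: eq_Rintegral => x _; rewrite /tensor/=; ring.
have E s : 0 <= s <= t -> \int[leb]_x (- wt s x * 'D_(1, 0) (tensor a Y) (s, x)
    + b s * wt s x * tensor a Y (s, x)
    + \sum_(i < n) gw i s x * 'D_(0, basis_rv i) (tensor a Y) (s, x)) =
  (- a' s + b s * a s) * pair (wt s) Y - lam * (a s * pair (w s) Y).
  move=> st; have /andP[s0 st'] := st.
  have Ts := time_itv_sub Tt s0 st'.
  have lw := Cw1.1 _ Ts; have lwt := Cwt.1 _ Ts.
  have lg i := (Cg i).1 _ Ts.
  have tD i : test_rv ('D_(basis_rv i) Y) by exact: test_rv_derive.
  have [_ isum] := pair_sumr lg tD.
  have iY := integrable_pair tY lwt.
  transitivity (\int[leb]_x ((- a' s + b s * a s) * (wt s x * Y x) +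
     a s * (\sum_(i < n) gw i s x * 'D_(basis_rv i) Y x))).
    apply: eq_Rintegral => x _; rewrite D1 mulr_sumr; congr (_ + _).
      by rewrite /tensor/=; ring.
    by apply: eq_bigr => i _; rewrite D2; ring.
  have i1 : leb.-integrable setT (EFin \o (fun x => (- a' s + b s * a s) * (wt s x * Y x))).
    by rewrite (_ : EFin \o _ = fun x => ((- a' s + b s * a s)%:E * (wt s x * Y x)%:E)%E)//;
      exact: integrableZl.
  have i2 : leb.-integrable setT (EFin \o (fun x => a s * (\sum_(i < n) gw i s x * 'D_(basis_rv i) Y x))).
    by rewrite (_ : EFin \o _ = fun x => ((a s)%:E * (\sum_(i < n) gw i s x * 'D_(basis_rv i) Y x)%:E)%E)//;
      exact: integrableZl.
  rewrite RintegralD// !RintegralZl//.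
  rewrite (pair_lap lw lg (wg _ Ts) tY) -/(pair _ _).
  have -> : pair (w s) (lap Y) = lam * pair (w s) Y.
    rewrite (@pair_eq_test _ _ _ _ (fun x => lam * Y x) L) //.
    - rewrite /pair -RintegralZl//; last exact: integrable_pair.
      by apply: eq_Rintegral => x _; ring.
    - exact: lw.1.
    - apply: continuous_measurable_rv; apply: (@Ck_sum _ _ _ 0%N) => i.
      by have [s1 _] := test_rv_derive (basis_rv i) (tD i); exact: (s1 0%N).
    - by apply: measurable_funM => //; apply: continuous_measurable_rv; exact: test_continuous.
    - exact: suppw.
  ring.
have -> : \int[mu]_(s in `[0, t]) \int[leb]_x (- wt s x * 'D_(1, 0) (tensor a Y) (s, x)
    + b s * wt s x * tensor a Y (s, x)
    + \sum_(i < n) gw i s x * 'D_(0, basis_rv i) (tensor a Y) (s, x)) =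
  \int[mu]_(s in `[0, t]) ((- a' s + b s * a s) * pair (wt s) Y - lam * (a s * pair (w s) Y)).
  by apply: eq_Rintegral => s; rewrite inE/= in_itv/=; exact: E.
by rewrite RintegralZl//; exact: integrable_pair.
Qed.

End tested_equation.

(** * Space-time norms *)

Section space_time_norm.
Context {R : realType} {n : nat}.
Local Notation rV := 'rV[R]_n.
Local Notation leb := (lebesgue_rv R n).
Local Notation mu := (@lebesgue_measure R).
Implicit Types (z : R -> rV -> R) (f Y : rV -> R).

(** A dichotomy in place of the sharp inequality: if [y <= lam x^(q-1)] the first term alone
    dominates, otherwise [x <= (y / lam)^(1/(q-1))] and the second one does. *)
Lemma young_split (x y q lam : R) : 0 <= x -> 0 <= y -> 1 < q -> 0 < lam ->
  x * y <= lam * x `^ q + lam `^ (- (q - 1)^-1) * y `^ (q / (q - 1)).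
Proof.
move=> x0 y0 q1 l0.
have q10 : 0 < q - 1 by rewrite subr_gt0.
have A0 : 0 <= lam * x `^ q by rewrite mulr_ge0 ?powR_ge0// ltW.
have B0 : 0 <= lam `^ (- (q - 1)^-1) * y `^ (q / (q - 1)) by rewrite mulr_ge0 ?powR_ge0.
have [xy|xy] := leP y (lam * x `^ (q - 1)).
  apply: (@le_trans _ _ (lam * x `^ q)); last by rewrite lerDl.
  rewrite -(mulr_powRB1 x0 (lt_trans ltr01 q1)) mulrCA.
  by rewrite ler_wpM2l.
apply: (@le_trans _ _ (lam `^ (- (q - 1)^-1) * y `^ (q / (q - 1)))); last by rewrite lerDr.
have yp : 0 < y by apply: le_lt_trans xy; rewrite mulr_ge0 ?powR_ge0// ltW.
have -> : q / (q - 1) = (q - 1)^-1 + 1 by field; rewrite gt_eqF.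
rewrite powRD ?(gt_eqF yp) ?implybT// powRr1// mulrA ler_wpM2r//.
rewrite powRN mulrC ler_pdivlMr ?powR_gt0//.
have -> : x = (x `^ (q - 1)) `^ (q - 1)^-1.
  by rewrite -powRrM mulfV ?gt_eqF// powRr1.
rewrite -powRM ?powR_ge0 ?(ltW l0)// ge0_ler_powR ?nnegrE ?mulr_ge0 ?powR_ge0 ?invr_ge0 ?(ltW l0) ?(ltW q10)//.
by rewrite mulrC ltW.
Qed.

(** Kept in the extended reals because local integrability in space-time makes a slice finite only
    for almost every [s]; [norm_pow] takes the default value 0 on infinite slices. *)
Definition normE (q L : R) z (s : R) : \bar R :=
  (\int[leb]_(x in eball L) (`|z s x| `^ q)%:E)%E.

Definition norm_pow q L z (s : R) : R := fine (normE q L z s).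

Lemma normE_ge0 q L z s : (0 <= normE q L z s)%E.
Proof. by apply: integral_ge0 => x _; rewrite lee_fin powR_ge0. Qed.

Lemma norm_pow_ge0 q L z s : 0 <= norm_pow q L z s.
Proof. by rewrite fine_ge0// normE_ge0. Qed.

Lemma measurable_pow_norm d (X : measurableType d) (D : set X) (f : X -> R) (q : R) :
  measurable_fun D f -> measurable_fun D (fun x => `|f x| `^ q).
Proof.
move=> mf; apply: (@measurableT_comp _ _ _ _ _ _ (@powR R ^~ q)); first exact: measurable_powR.
by apply: measurableT_comp.
Qed.

(** Two radii: the pointwise inequality and [j] live on the support ball [L'], which moves with time
    in the Bessel estimate, while the power of [f] is taken over the fixed ball [L] so that it can
    be integrated in time. The factor [kap] leaves room for an exponential in time. *)
Lemma young_pair f Y (q L L' kap A B J : R) (j : rV -> R) :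
  L1loc f -> test_rv Y -> supported_in L' f -> L' <= L ->
  (\int[leb]_(x in eball L) (`|f x| `^ q)%:E < +oo)%E ->
  0 <= kap -> 0 <= A -> 0 <= B -> measurable_fun setT j -> (forall x, 0 <= j x) ->
  (forall x, eball L' x -> kap * (`|f x| * `|Y x|) <= A * `|f x| `^ q + B * j x) ->
  (\int[leb]_(x in eball L') (j x)%:E <= J%:E)%E ->
  kap * `|pair f Y| <= A * fine (\int[leb]_(x in eball L) (`|f x| `^ q)%:E)%E + B * J.
Proof.
move=> lf tY fL' LL' fin kap0 A0 B0 mj j0 H jJ.
have [mf If] := lf.
have mL := @measurable_eball R n L; have mL' := @measurable_eball R n L'.
have mY := continuous_measurable_rv (test_continuous tY).
have mfY := measurable_pair tY mf.
have int0 : (0 <= \int[leb]_(x in eball L) (`|f x| `^ q)%:E)%E.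
  by apply: integral_ge0 => x _; rewrite lee_fin powR_ge0.
rewrite -lee_fin EFinD !EFinM fineK ?ge0_fin_numE//.
have mpow : measurable_fun setT (fun x => `|f x| `^ q) by exact: measurable_pow_norm.
apply: (@le_trans _ _ (\int[leb]_(x in eball L') (kap * (`|f x| * `|Y x|))%:E)%E).
  rewrite /pair EFin_normr_Rintegral//; last exact: integrable_pair.
  apply: (@le_trans _ _ (kap%:E * \int[leb]_x (`|f x| * `|Y x|)%:E)%E).
    apply: lee_wpmul2l; first by rewrite lee_fin.
    apply: le_trans (le_abse_integral _ _ _) _ => //; first exact/measurable_EFinP.
    by under eq_integral do rewrite /= normrM.
  rewrite [X in (_ * X)%E](_ : _ = \int[leb]_(x in eball L') (`|f x| * `|Y x|)%:E)%E; last first.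
    rewrite [RHS]integral_mkcond; apply: ae_eq_integral => //.
    - by apply/measurable_EFinP; apply: measurable_funM; exact: measurableT_comp.
    - apply/(measurable_restrictT _ _).1 => //; apply/measurable_EFinP.
      by apply: measurable_funM; apply: measurableT_comp => //; exact: measurable_funS mf || exact: measurable_funS mY.
    - apply: filterS fL' => x fx _; rewrite patchE; case: ifPn => // /negP.
      by rewrite inE => /fx ->; rewrite normr0 mul0r.
  rewrite -ge0_integralZl//.
  by apply/measurable_EFinP; apply: measurable_funM; apply: measurableT_comp => //;
    exact: measurable_funS mf || exact: measurable_funS mY.
apply: (@le_trans _ _ (\int[leb]_(x in eball L') (A%:E * (`|f x| `^ q)%:E + B%:E * (j x)%:E))%E).
  apply: ge0_le_integral => //.
  - by move=> x _; rewrite lee_fin !mulr_ge0.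
  - apply/measurable_EFinP; apply: measurable_funM => //; apply: measurable_funM;
      apply: measurableT_comp => //; exact: measurable_funS mf || exact: measurable_funS mY.
  - apply: emeasurable_funD; apply: emeasurable_funM => //; apply/measurable_EFinP.
      exact: measurable_funS mpow.
    exact: measurable_funS mj.
have m1 : measurable_fun (eball L') (fun x => (`|f x| `^ q)%:E).
  by apply/measurable_EFinP; exact: measurable_funS mpow.
have m2 : measurable_fun (eball L') (fun x => (j x)%:E).
  by apply/measurable_EFinP; exact: measurable_funS mj.
have p1 x : eball L' x -> (0 <= (`|f x| `^ q)%:E)%E by rewrite lee_fin powR_ge0.
have p2 x : eball L' x -> (0 <= (j x)%:E)%E by rewrite lee_fin.
rewrite (ge0_integralD leb mL' (f1 := fun x => (A%:E * (`|f x| `^ q)%:E)%E)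
   (f2 := fun x => (B%:E * (j x)%:E)%E)); last first.
- exact: emeasurable_funM.
- by move=> x /p2 ?; rewrite mule_ge0.
- exact: emeasurable_funM.
- by move=> x /p1 ?; rewrite mule_ge0.
rewrite (ge0_integralZl leb mL' m1)// (ge0_integralZl leb mL' m2)//.
apply: leeD; apply: lee_wpmul2l; rewrite ?lee_fin//.
apply: ge0_subset_integral => //.
- by apply/measurable_EFinP; exact: measurable_funS mpow.
- by move=> x; rewrite /eball/= => /le_trans; apply.
Qed.

Lemma nonlin_norm_pow z Y (p L s : R) : p != 0 -> measurable_fun setT (z s) -> test_rv Y ->
  supported_in L (z s) -> (forall x, eball L x -> Y x = 1) ->
  nonlin p z Y s = norm_pow p L z s.
Proof.
move=> p0 mz tY zL Y1; rewrite /nonlin /norm_pow /normE /Rintegral; congr fine.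
have mL := @measurable_eball R n L.
rewrite [RHS]integral_mkcond; apply: ae_eq_integral => //.
- apply/measurable_EFinP; apply: measurable_pair => //; exact: measurable_pow_norm.
- apply/(measurable_restrictT _ _).1 => //; apply/measurable_EFinP.
  by apply: measurable_pow_norm; exact: measurable_funS mz.
- apply: filterS zL => x zx _; rewrite patchE; case: ifPn => [|/negP].
    by rewrite inE => /Y1 ->; rewrite mulr1.
  by rewrite inE => /zx ->; rewrite normr0 powR0// mul0r.
Qed.

Section joint.
Variables (T : \bar R) (q : R) (z : R -> rV -> R).
Hypothesis Lz : Lloc_spacetime T q z.

Lemma Lloc_section_measurable s : time_itv T s -> measurable_fun setT (z s).
Proof.
move=> Ts; have [mz _] := Lz; move=> _ B mB; rewrite setTI.
have mD : measurable (time_itv T `*` [set: rV] : set (measurableTypeR R * rV)).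
  apply: measurableX => //.
  rewrite (_ : time_itv T = `[0, +oo[ `&` [set t | (t%:E < T)%E]).
    by apply: measurableI => //; apply: open_measurable; exact: open_ereal_lt.
  by apply/seteqP; split => t /=; rewrite /time_itv/= in_itv/= andbT.
have := @measurable_xsection _ _ (measurableTypeR R) rV _ s (mz mD B mB).
congr (measurable _); apply/seteqP; split => x; rewrite /xsection/= ?inE/=.
  by move=> [].
by move=> zB; split.
Qed.

Variables (S L : R).
Hypothesis TS : time_itv T S.

Let F (s : measurableTypeR R) : \bar R := if s \in `[0, S] then normE q L z s else 0%E.

(** Extended by zero, the slices are the inner integrals in Tonelli's theorem, which gives both
    their measurability in time and the iterated integral. *)
Let FE : measurable_fun setT F /\
  (\int[mu]_s F s = \int[(mu \x leb)%E]_(w in `[0%R, S] `*` eball L) (`|z w.1 w.2| `^ q)%:E)%E.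
Proof.
have [mz _] := Lz.
pose D : set (measurableTypeR R * rV) := `[0%R, S] `*` eball L.
have mD : measurable D by apply: measurableX => //; exact: measurable_eball.
have DT : D `<=` time_itv T `*` [set: rV].
  by move=> [s x] [] /=; rewrite in_itv/= => /andP[s0 sS] _; split=> //; exact: time_itv_sub sS.
have mzD : measurable_fun D (fun w => z w.1 w.2).
  apply: measurable_funS mz => //.
  apply: measurableX => //.
  rewrite (_ : time_itv T = `[0, +oo[ `&` [set t | (t%:E < T)%E]).
    by apply: measurableI => //; apply: open_measurable; exact: open_ereal_lt.
  by apply/seteqP; split => t /=; rewrite /time_itv/= in_itv/= andbT.
pose f := (fun w : measurableTypeR R * rV => (`|z w.1 w.2| `^ q)%:E) \_ D.
have mf : measurable_fun setT f.
  apply/(measurable_restrictT _ _).1 => //; apply/measurable_EFinP.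
  exact: measurable_pow_norm.
have f0 w : (0 <= f w)%E.
  by rewrite /f patchE; case: ifPn => // _; rewrite lee_fin powR_ge0.
have EF : F = fubini_F leb f.
  apply/funext => s; rewrite /F /fubini_F /f; case: ifPn => sS.
    rewrite /normE [LHS]integral_mkcond; apply: eq_integral => x _.
    rewrite !patchE; case: ifPn => xL; case: ifPn => //.
      by move=> /negP; rewrite inE => -[]; split=> //=; rewrite inE in xL.
    by rewrite inE => -[_ /= xL']; move: xL; rewrite notin_setE.
  rewrite integral0_eq// => x _; rewrite patchE; case: ifPn => //.
  by rewrite inE => -[/= sS']; rewrite sS' in sS.
split; first by rewrite EF; exact: measurable_fun_fubini_tonelli_F.
by rewrite EF -fubini_tonelli1// /f -integral_mkcond.
Qed.

Lemma measurable_normE : measurable_fun `[0, S] (normE q L z).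
Proof.
have [mF _] := FE.
have : measurable_fun `[0, S] F by exact: measurable_funS mF.
apply: eq_measurable_fun => s; rewrite inE/= /F => sS.
by rewrite sS.
Qed.

Lemma integral_normE_lty : (\int[mu]_(s in `[0%R, S]) normE q L z s < +oo)%E.
Proof.
have [mF EF] := FE; have [_ fz] := Lz.
rewrite (_ : \int[mu]_(s in _) _ = \int[mu]_s F s)%E; last first.
  rewrite [LHS]integral_mkcond; apply: eq_integral => s _.
  by rewrite patchE /F mem_setE.
by rewrite EF; exact: fz.
Qed.

Lemma integrable_normE : mu.-integrable `[0, S] (normE q L z).
Proof.
apply/integrableP; split; first exact: measurable_normE.
under eq_integral => s _ do rewrite gee0_abs ?normE_ge0//.
exact: integral_normE_lty.
Qed.

Lemma ae_normE_lty : {ae mu, forall s, 0 <= s <= S -> (normE q L z s < +oo)%E}.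
Proof.
have := integrable_ae (_ : measurable (`[0%R, S] : set (measurableTypeR R))) integrable_normE.
move=> /(_ (measurable_itv _)); apply: filterS => s sS s0S.
have := sS _; rewrite /= in_itv/= => /(_ s0S).
by rewrite ge0_fin_numE// normE_ge0.
Qed.

Lemma integrable_norm_pow : mu.-integrable `[0, S] (EFin \o norm_pow q L z).
Proof.
have iE := integrable_normE; apply/integrableP; split.
  apply/measurable_EFinP.
  by apply: measurableT_comp; [exact: fine_measurable|exact: measurable_normE].
apply: le_lt_trans integral_normE_lty.
apply: ge0_le_integral => //.
- apply: measurableT_comp => //; apply/measurable_EFinP.
  by apply: measurableT_comp; [exact: fine_measurable|exact: measurable_normE].
- exact: measurable_normE.
- move=> s _ /=; rewrite ger0_norm ?norm_pow_ge0// /norm_pow.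
  by have := normE_ge0 q L z s; case: (normE q L z s) => //=; rewrite leey.
Qed.

End joint.
End space_time_norm.

(** * Cutoffs and test functions *)

Section time_cutoff.
Context {R : realType}.
Variables (chi chi1 chi2 : R -> R) (C0 : R).
Hypothesis st : is_step chi chi1 chi2 C0.
Implicit Types (s S nu : R) (m : nat).

Lemma Ck_scale k (f : R -> R) (c : R) : Cn setT k f -> Ck k (fun s => f (c * s)).
Proof.
move=> Cf; apply: (@Ck_comp _ _ setT k f (fun s => c * s)) => //.
by apply: (@CkM _ _ k (cst c) id); [exact: Ck_cst|exact: Ck_id].
Qed.

(* A smooth positive function on the whole line equal to [1 + s] for [s >= 0]. *)
Definition shifted s : R := chi (- 2 * s) * (1 + s) + (1 - chi (- 2 * s)).

Lemma shiftedE s : - 4^-1 <= s -> shifted s = 1 + s.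
Proof. by move=> s0; rewrite /shifted (step1 st) ?subrr ?addr0 ?mul1r//; lra. Qed.

Lemma shifted_gt0 s : 0 < shifted s.
Proof.
rewrite /shifted; have [s0|s0] := leP s (- 2^-1).
  by rewrite (step0 st) ?mul0r ?add0r ?subr0//; lra.
have c0 := step_ge0 st (- 2 * s); have c1 := step_le1 st (- 2 * s); nra.
Qed.

Lemma Ck_shifted k : Ck k shifted.
Proof.
have C1 : Ck k (fun s => chi (- 2 * s)) by apply: Ck_scale; exact: (step_smooth st).
apply: CkD.
  by apply: CkM => //; apply: (@CkD _ _ k (cst 1) id); [exact: Ck_cst|exact: Ck_id].
apply: (@CkD _ _ k (cst 1)); first exact: Ck_cst.
rewrite (_ : (fun _ => _) = (fun s => (-1) * chi (- 2 * s))).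
  by apply: (@CkM _ _ k (cst (-1))) => //; exact: Ck_cst.
by apply/funext => s; rewrite mulN1r.
Qed.

Definition weight nu s : R := shifted s `^ nu.

Lemma weight_ge0 nu s : 0 <= weight nu s. Proof. exact: powR_ge0. Qed.

Lemma weightE nu s : 0 <= s -> weight nu s = (1 + s) `^ nu.
Proof. by move=> s0; rewrite /weight shiftedE//; lra. Qed.

Lemma Ck_weight k nu : Ck k (weight nu).
Proof.
apply: (@Ck_comp _ _ [set x | 0 < x] k (@powR R ^~ nu) shifted).
- exact: shifted_gt0.
- exact: Cn_powR.
- exact: Ck_shifted.
Qed.

Lemma is_derive_pow1D nu s : 0 <= s ->
  is_derive s (1 : R) (fun s => (1 + s) `^ nu) (nu * (1 + s) `^ (nu - 1)).
Proof.
move=> s0; have s1 : 0 < 1 + s by lra.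
have d1 : is_derive s (1 : R) (fun s => 1 + s) 1.
  by have := is_deriveD (is_derive_cst (1 : R) s 1) (is_derive_id s (1 : R)); rewrite add0r.
have := @is_derive1_comp R (@powR R ^~ nu) (fun s => 1 + s) s _ _ (is_derive1_powR nu s1) d1.
by rewrite mulr1.
Qed.

Lemma is_derive_weight nu s : 0 <= s ->
  is_derive s (1 : R) (weight nu) (nu * (1 + s) `^ (nu - 1)).
Proof.
move=> s0; apply: (@near_eq_is_derive _ _ _ (fun s : R => (1 + s) `^ nu)); last exact: is_derive_pow1D.
have s4 : - 4^-1 < s by lra.
by near=> r; rewrite /weight shiftedE// ltW//; near: r; exact: lt_nbhsr.
Unshelve. all: by end_near. Qed.

(** Two derivatives cost two factors [chi], so they are controlled by [chi^(m-2)], whose [q]-th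
    power is again at most [chi^m] once [m <= (m - 2) q]. This is what lets Young's inequality
    return to the same cutoff. *)
Definition eta S m s : R := chi (S^-1 * s) ^+ m.
Definition eta1 S m s : R := m%:R * chi (S^-1 * s) ^+ m.-1 * (chi1 (S^-1 * s) * S^-1).
Definition eta2 S m s : R :=
  m%:R * (m.-1)%:R * chi (S^-1 * s) ^+ m.-2 * (chi1 (S^-1 * s) * S^-1) ^+ 2
  + m%:R * chi (S^-1 * s) ^+ m.-1 * (chi2 (S^-1 * s) * S^-1 ^+ 2).

Lemma eta_ge0 S m s : 0 <= eta S m s.
Proof. by rewrite exprn_ge0// (step_ge0 st). Qed.

Lemma eta_eq1 S m s : 0 < S -> s <= S / 2 -> eta S m s = 1.
Proof.
move=> S0 sS; rewrite /eta (step1 st) ?expr1n//.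
by rewrite ler_pdivrMl// mulrC.
Qed.

Lemma eta_eq0 S m s : 0 < S -> S <= s -> (0 < m)%N -> eta S m s = 0.
Proof.
move=> S0 sS m0; rewrite /eta (step0 st) ?expr0n; last by rewrite ler_pdivlMl// mulr1.
by case: m m0.
Qed.

Lemma Ck_eta k S m : Ck k (eta S m).
Proof.
elim: m => [|m IH].
  by rewrite (_ : eta S 0 = cst 1); [exact: Ck_cst|apply/funext => s; rewrite /eta expr0].
rewrite (_ : eta S m.+1 = (fun s => chi (S^-1 * s)) \* eta S m).
  by apply: CkM => //; apply: Ck_scale; exact: (step_smooth st).
by apply/funext => s; rewrite /eta exprS.
Qed.

Let is_derive_scaled (f f' : R -> R) c s : is_derive (c * s) (1 : R) f (f' (c * s)) ->
  is_derive s (1 : R) (fun s => f (c * s)) (f' (c * s) * c).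
Proof.
move=> df.
have d1 : is_derive s (1 : R) (fun s => c * s) c.
  by have := is_deriveZ c (is_derive_id s (1 : R)); rewrite [X in is_derive _ _ _ X]mulr1.
exact: (@is_derive1_comp R f (fun s => c * s) s _ _ df d1).
Qed.

Let is_derive_pow m S s : is_derive s (1 : R) (fun s => chi (S^-1 * s) ^+ m)
   (m%:R * chi (S^-1 * s) ^+ m.-1 * (chi1 (S^-1 * s) * S^-1)).
Proof.
have d := is_derive_scaled (step_der1 st (S^-1 * s)).
by have := is_deriveX m d; rewrite exprfctE.
Qed.

Lemma is_derive_eta S m s : is_derive s (1 : R) (eta S m) (eta1 S m s).
Proof. exact: is_derive_pow. Qed.

Lemma is_derive_eta1 S m s : is_derive s (1 : R) (eta1 S m) (eta2 S m s).
Proof.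
have d1 := is_derive_pow m.-1 S s.
have d2 := is_derive_scaled (step_der2 st (S^-1 * s)).
have d3 := is_deriveM (is_deriveZ m%:R d1) (is_deriveZ S^-1 d2).
rewrite (_ : eta1 S m = ((m%:R *: (fun s => chi (S^-1 * s) ^+ m.-1))
   * (S^-1 *: (fun s => chi1 (S^-1 * s))))); last first.
  apply/funext => x; rewrite -[RHS]/(m%:R * chi (S^-1 * x) ^+ m.-1 *
    (S^-1 * chi1 (S^-1 * x))).
  by rewrite /eta1; ring.
apply: (is_derive_eq d3).
rewrite -[LHS]/(m%:R * chi (S^-1 * s) ^+ m.-1 * (S^-1 * (chi2 (S^-1 * s) * S^-1)) +
  S^-1 * chi1 (S^-1 * s) * (m%:R * ((m.-1)%:R * chi (S^-1 * s) ^+ m.-2 * (chi1 (S^-1 * s) * S^-1)))).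
rewrite /eta2; ring.
Qed.

Lemma eta1_eq0 S m s : 0 < S -> s < S / 2 -> eta1 S m s = 0.
Proof.
move=> S0 sS; rewrite /eta1 (step_loc1 st) ?mul0r ?mulr0//.
by rewrite ltr_pdivrMl.
Qed.

Lemma eta2_eq0 S m s : 0 < S -> s < S / 2 -> eta2 S m s = 0.
Proof.
move=> S0 sS; rewrite /eta2 (step_loc1 st) ?(step_loc2 st) ?ltr_pdivrMl//.
by rewrite !mul0r expr0n !mulr0 addr0.
Qed.

(** Sized for the second derivative, with [m (m - 1)] rounded up to [m^2]; the summand [m C0] alone
    takes care of the first derivative. *)
Definition eta_cst m : R := m%:R * m%:R * C0 ^+ 2 + m%:R * C0.

Lemma step_cst_ge0 : 0 <= C0.
Proof. exact: le_trans (normr_ge0 _) (step_bnd1 st 0). Qed.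

Lemma eta_cst_ge0 m : 0 <= eta_cst m.
Proof. by rewrite addr_ge0 ?mulr_ge0 ?sqr_ge0 ?step_cst_ge0. Qed.

Lemma eta1_le S m s : 1 <= S -> (1 < m)%N ->
  `|eta1 S m s| <= eta_cst m / S * chi (S^-1 * s) ^+ m.-2.
Proof.
move=> S1 m1; have S0 : 0 < S by lra.
have c0 := step_ge0 st (S^-1 * s); have c1 := step_le1 st (S^-1 * s).
rewrite /eta1 !normrM normrX normr_nat (ger0_norm c0) normfV (gtr0_norm S0).
rewrite (_ : m.-1 = m.-2.+1) 1?exprS; last by lia.
apply: (@le_trans _ _ (m%:R * (1 * chi (S^-1 * s) ^+ m.-2) * (C0 / S))).
  apply: ler_pM; rewrite ?mulr_ge0 ?exprn_ge0 ?invr_ge0 ?(ltW S0)//.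
    by rewrite ler_wpM2l// ler_wpM2r// exprn_ge0.
  by rewrite ler_wpM2r ?invr_ge0 ?(ltW S0)// (step_bnd1 st).
rewrite mul1r [leLHS](_ : _ = (m%:R * C0) / S * chi (S^-1 * s) ^+ m.-2); last by ring.
rewrite ler_wpM2r ?exprn_ge0// ler_wpM2r ?invr_ge0 ?(ltW S0)// /eta_cst lerDr.
by rewrite !mulr_ge0 ?sqr_ge0 ?step_cst_ge0.
Qed.

Lemma eta2_le S m s : 1 <= S -> (1 < m)%N ->
  `|eta2 S m s| <= eta_cst m / S ^+ 2 * chi (S^-1 * s) ^+ m.-2.
Proof.
move=> S1 m1; have S0 : 0 < S by lra.
have c0 := step_ge0 st (S^-1 * s); have c1 := step_le1 st (S^-1 * s).
have b1 := step_bnd1 st (S^-1 * s); have b2 := step_bnd2 st (S^-1 * s).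
have C00 := step_cst_ge0.
rewrite /eta2; apply: le_trans (ler_normD _ _) _.
rewrite !(normrM, normrX) !normr_nat (ger0_norm c0) normfV (gtr0_norm S0).
have E : chi (S^-1 * s) ^+ m.-1 <= chi (S^-1 * s) ^+ m.-2.
  by rewrite (_ : m.-1 = m.-2.+1) 1?exprS; [rewrite ler_piMl// exprn_ge0|lia].
have X0 : 0 <= chi (S^-1 * s) ^+ m.-2 by rewrite exprn_ge0.
have Si : 0 <= S^-1 by rewrite invr_ge0 ltW.
rewrite [leRHS](_ : _ = m%:R * m%:R * chi (S^-1 * s) ^+ m.-2 * (C0 * S^-1) ^+ 2 +
   m%:R * chi (S^-1 * s) ^+ m.-2 * (C0 * S^-1 ^+ 2)); last first.
  by rewrite /eta_cst -exprVn; ring.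
apply: lerD.
  apply: ler_pM; rewrite ?mulr_ge0 ?sqr_ge0 ?exprn_ge0//.
    by rewrite ler_wpM2r// ler_wpM2l// ler_nat leq_pred.
  have h : `|chi1 (S^-1 * s)| / S <= C0 * S^-1 by rewrite ler_wpM2r.
  by rewrite expr2 ler_pM// mulr_ge0.
rewrite -(expr2 S^-1); apply: ler_pM; rewrite ?mulr_ge0 ?exprn_ge0//.
  by rewrite ler_wpM2l.
by rewrite ler_wpM2r// exprn_ge0.
Qed.

End time_cutoff.

Section space_test.
Context {R : realType} {n : nat}.

Lemma exists_radial_test (F F1 F2 : R -> R) (lam L : R) : 0 <= L ->
  (forall k, Cn setT k F) -> (forall y, 0 <= y -> 0 <= F y) ->
  (forall y, is_derive y (1 : R) F (F1 y)) -> (forall y, is_derive y (1 : R) F1 (F2 y)) ->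
  (forall y, 0 <= y -> 4 * y * F2 y + 2 * n%:R * F1 y = lam * F y) ->
  exists Y : 'rV[R]_n -> R, [/\ test_rv Y, forall x, 0 <= Y x,
    forall x, eball L x -> Y x = F (nrm2 x) &
    forall x, eball L x -> lap Y x = lam * Y x].
Proof.
move=> L0 CF F0 dF dF1 ode.
have [chi [chi1 [chi2 [C0 st]]]] := @exists_smooth_step R.
(* The rescaled cutoff equals 1 up to [K / 2 = (L + 1)^2]. The margin beyond [L^2] makes [H] and [F]
   agree near every point of the ball, so their derivatives agree as well. *)
pose K := 2 * (L + 1) ^+ 2.
have L1 : 0 < (L + 1) ^+ 2 by rewrite exprn_gt0//; lra.
have K0 : 0 < K by rewrite mulr_gt0.
pose H y := F y * chi (K^-1 * y).
have CH k : Cn setT k H.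
  apply: Ck_Cn; apply: CkM; last by apply: Ck_scale; exact: (step_smooth st).
  by apply: (@Ck_comp _ _ setT k F id) => //; exact: Ck_id.
have HF y : y <= (L + 1) ^+ 2 -> H y = F y.
  move=> yL; rewrite /H (step1 st) ?mulr1//.
  by rewrite ler_pdivrMl// /K; lra.
have H0 y : K < y -> H y = 0.
  move=> Ky; rewrite /H (step0 st) ?mulr0//.
  by rewrite ler_pdivlMl// mulr1 ltW.
have [H1 dH [H2 dH1 _]] := CH 2%N.
have H1F y : y < (L + 1) ^+ 2 -> H1 y = F1 y.
  move=> yL; apply: (is_derive_unique (dH y I)).
  apply: (near_eq_is_derive _ (dF y)).
  by near=> z; apply/esym/HF/ltW; near: z; exact: lt_nbhsl.
have H2F y : y < (L + 1) ^+ 2 -> H2 y = F2 y.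
  move=> yL; apply: (is_derive_unique (dH1 y I)).
  apply: (near_eq_is_derive _ (dF1 y)).
  by near=> z; apply/esym/H1F; near: z; exact: lt_nbhsl.
have ball x : eball L x -> @nrm2 R n x < (L + 1) ^+ 2.
  rewrite /eball/= eballP// => xL; apply: le_lt_trans xL _.
  by rewrite ltrXn2r ?nnegrE//; lra.
exists (radial H); split.
- apply: (@test_rv_radial _ _ _ (Num.sqrt K)) => // y; rewrite sqr_sqrtr ?(ltW K0)//.
  exact: H0.
- by move=> x; rewrite /radial/= mulr_ge0 ?(step_ge0 st)// F0// nrm2_ge0.
- by move=> x /ball xL; rewrite /radial/= HF// ltW.
- move=> x /ball xL; rewrite (lap_radial _ (fun y => dH y I) (fun y => dH1 y I)).
  by rewrite H1F// H2F// ode ?nrm2_ge0// /radial/= HF// ltW.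
Unshelve. all: by end_near. Qed.

Lemma exists_plateau_test (L : R) : 0 <= L ->
  exists Y : 'rV[R]_n -> R, [/\ test_rv Y, forall x, 0 <= Y x,
    forall x, eball L x -> Y x = 1 & forall x, eball L x -> lap Y x = 0 * Y x].
Proof.
move=> L0; apply: (@exists_radial_test (cst 1) (cst 0) (cst 0)) => //.
- by move=> k; exact: Cn_cst.
- by move=> y _; rewrite !mulr0 mul0r addr0.
Qed.

End space_test.

Section bessel_test.
Context {R : realType} {m : nat}.

Lemma exists_bessel_test (L : R) : 0 <= L ->
  exists Y : 'rV[R]_m.+1 -> R, [/\ test_rv Y, forall x, 0 <= Y x,
    forall x, eball L x -> Y x = psum (bessel_c m) (nrm2 x) &
    forall x, eball L x -> lap Y x = 1 * Y x].
Proof.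
move=> L0; have b := @fact_bounded_bessel R m.
have C k := Cn_psum k b.
have P (y : R) (y0 : 0 <= y) : 0 <= psum (bessel_c m) y := le_trans ler01 (bessel_ge1 m y0).
have d1 (y : R) := is_derive_psum y b.
have d2 (y : R) := is_derive_psum y (fact_bounded_diffs b).
have o (y : R) (_ : 0 <= y) : 4 * y * psum (pseries_diffs (pseries_diffs (bessel_c m))) y +
    2 * m.+1%:R * psum (pseries_diffs (bessel_c m)) y = 1 * psum (bessel_c m) y.
  by rewrite (bessel_ode m y) mul1r.
exact: (@exists_radial_test R m.+1 _ _ _ 1 L L0 C P d1 d2 o).
Qed.

End bessel_test.

(** * Energy estimates *)

Section energy.
Context {R : realType} {n : nat}.
Local Notation rV := 'rV[R]_n.
Local Notation leb := (lebesgue_rv R n).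
Local Notation mu := (@lebesgue_measure R).

Lemma integrable_EFinD (D : set R) (f g : R -> R) : measurable (D : set (measurableTypeR R)) ->
  mu.-integrable D (EFin \o f) -> mu.-integrable D (EFin \o g) ->
  mu.-integrable D (EFin \o (fun s => f s + g s)).
Proof. by move=> mD fi gi; exact: (integrableD mD fi gi). Qed.

Lemma integrable_EFinZ (D : set R) (c : R) (f : R -> R) :
  measurable (D : set (measurableTypeR R)) ->
  mu.-integrable D (EFin \o f) -> mu.-integrable D (EFin \o (fun s => c * f s)).
Proof. by move=> mD fi; exact: (integrableZl mD c fi). Qed.

Lemma integrable_continuousM (a b : R) (h f : R -> R) :
  {within `[a, b], continuous h} -> mu.-integrable `[a, b] (EFin \o f) ->
  mu.-integrable `[a, b] (EFin \o (fun s => h s * f s)).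
Proof.
move=> ch fi; have mI : measurable (`[a, b] : set (measurableTypeR R)) by exact: measurable_itv.
rewrite (_ : EFin \o _ = ((EFin \o h) \* (EFin \o f))%E); last first.
  by apply/funext => s /=; rewrite EFinM.
apply: (integrableMr mI) => //.
  by apply: subspace_continuous_measurable_fun.
have [ab|ba] := leP a b; last first.
  exists 0; split; first exact: num_real.
  by move=> M _ x /=; rewrite in_itv/= => /andP[ax xb]; have := le_lt_trans (le_trans ax xb) ba; rewrite ltxx.
have cN : {within `[a, b], continuous (fun s => `|h s|)}.
  by move=> x; apply: cvg_norm; exact: ch.
have [c _ cP] := EVT_max ab cN.
exists `|h c|; split; first exact: num_real.
by move=> M hM x xab; apply: le_trans (cP x xab) (ltW hM).
Qed.

Lemma ae_ge0_le_Rintegral (D : set R) (f g : R -> R) : measurable (D : set (measurableTypeR R)) ->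
  mu.-integrable D (EFin \o f) -> mu.-integrable D (EFin \o g) ->
  (forall x, D x -> 0 <= f x) -> (forall x, D x -> 0 <= g x) ->
  {ae mu, forall x, D x -> f x <= g x} ->
  \int[mu]_(x in D) f x <= \int[mu]_(x in D) g x.
Proof.
move=> mD fi gi f0 g0 fg; apply: fine_le.
- exact: integrable_fin_num.
- exact: integrable_fin_num.
apply: ae_ge0_le_integral => //.
- exact: measurable_int fi.
- exact: measurable_int gi.
Qed.

Variables (T : \bar R) (b : R -> R) (p q eps : R) (w1 : rV -> R)
  (w wt z : R -> rV -> R) (gw : 'I_n -> R -> rV -> R).
Hypotheses (p1 : 1 < p) (q1 : 1 < q) (Cw : C_W11loc T w gw) (C1w : C1_L1loc T w wt).
Hypotheses (Lw : Lloc_spacetime T q w) (Lz : Lloc_spacetime T p z).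
Hypothesis lw1 : L1loc w1.
Hypothesis weq : weak_equation T b p eps w1 wt gw z.
Variables (S L : R) (Y : rV -> R).
Hypotheses (S0 : 0 < S) (ST : (S%:E < T)%E).
Hypothesis suppw : forall s, 0 <= s <= S -> supported_in L (w s).
Hypothesis suppz : forall s, 0 <= s <= S -> supported_in L (z s).
Hypotheses (tY : test_rv Y) (Y0 : forall x, 0 <= Y x).
Hypotheses (Y1 : forall x, eball L x -> Y x = 1).
Hypotheses (lapY : forall x, eball L x -> lap Y x = 0 * Y x).

Let TS : time_itv T S. Proof. by split => //; exact: ltW. Qed.

(** Both boundary terms at [S] vanish, the one with [wt] by [a S = 0] and the one with [w] by
    [c S = 0]. Young's inequality is applied to [k |w|] against 1: [k^q <= beta] places the power of
    [w] under the weight of the other integral, and the factor 1 leaves the volume of the space-time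
    cylinder. *)
Lemma energy_bound (a a' c c' k beta : R -> R) (Q : R) :
  smooth a -> (forall s, is_derive s (1 : R) a (a' s)) -> (forall s, 0 <= a s) ->
  (forall s, S <= s -> a s = 0) ->
  C1seg 0 S c c' -> c S = 0 ->
  (forall s, 0 <= s <= S -> c s = - a' s + b s * a s) ->
  0 <= Q -> (forall s, 0 <= k s) -> (forall s, 0 <= beta s) ->
  {within `[0, S], continuous beta} ->
  (forall s, 0 <= s <= S -> `|c' s| <= Q * k s) ->
  (forall s, 0 <= s <= S -> k s `^ q <= beta s) ->
  forall lam, 0 < lam ->
  eps * (a 0 * pair w1 Y) + c 0 * pair (w 0) Y +
    \int[mu]_(s in `[0, S]) (a s * norm_pow p L z s) <=
  Q * (lam * (\int[mu]_(s in `[0, S]) (beta s * norm_pow q L w s))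
       + lam `^ (- (q - 1)^-1) * (S * fine (leb (eball L)))).
Proof.
move=> sa da a0 aS Cc cS cE Q0 k0 b0 cb cQ kb lam lam0.
have mI : measurable (`[0, S] : set (measurableTypeR R)) by exact: measurable_itv.
have aS' s : S < s -> a s = 0 by move=> /ltW; exact: aS.
have zm s : time_itv T s -> measurable_fun setT (z s) by exact: (Lloc_section_measurable Lz).
have := tested_equation Cw C1w zm lw1 weq sa da a0 TS aS' tY Y0 lapY S0 ST suppw.
rewrite (aS S (lexx _)) mul0r addr0.
have -> : \int[mu]_(s in `[0, S]) ((- a' s + b s * a s) * pair (wt s) Y
    - 0 * (a s * pair (w s) Y)) = \int[mu]_(s in `[0, S]) (c s * pair (wt s) Y).
  apply: eq_Rintegral => s; rewrite inE/= in_itv/= => sS.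
  by rewrite mul0r subr0 cE.
have CU := C1seg_pair C1w tY TS.
rewrite (C1seg_parts (ltW S0) Cc CU) cS mul0r sub0r.
have -> : \int[mu]_(s in `[0, S]) (a s * nonlin p z Y s) =
    \int[mu]_(s in `[0, S]) (a s * norm_pow p L z s).
  apply: eq_Rintegral => s; rewrite inE/= in_itv/= => sS; congr (_ * _).
  have /andP[s0 sS'] := sS.
  apply: nonlin_norm_pow => //; last exact: suppz.
    by rewrite gt_eqF// (lt_trans ltr01).
  by apply: zm; exact: time_itv_sub s0 sS'.
move=> E.
have -> : eps * (a 0 * pair w1 Y) + c 0 * pair (w 0) Y +
    \int[mu]_(s in `[0, S]) (a s * norm_pow p L z s) =
    - \int[mu]_(s in `[0, S]) (c' s * pair (w s) Y).
  by rewrite addrAC -E; ring.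
have cU : {within `[0, S], continuous (fun s => c' s * pair (w s) Y)}.
  by apply: within_continuousM; [exact: C1seg_cont' Cc|exact: C1seg_cont CU].
have iU := within_integrable cU.
apply: le_trans (ler_norm _) _; rewrite normrN.
apply: le_trans (le_normr_Rintegral mI iU) _.
set V := fine (leb (eball L)); set l := lam `^ _.
have V0 : 0 <= V by rewrite fine_ge0.
have l0 : 0 <= l by exact: powR_ge0.
have ib := integrable_continuousM cb (integrable_norm_pow Lw L TS).
have ik : mu.-integrable `[0, S] (EFin \o (fun _ : R => l * V)).
  by apply: within_integrable; apply: continuous_subspaceT => x; exact: cvg_cst.
have ilb : mu.-integrable `[0, S] (EFin \o (fun s => lam * (beta s * norm_pow q L w s))).
  exact: integrable_EFinZ.
have isum : mu.-integrable `[0, S]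
    (EFin \o (fun s => lam * (beta s * norm_pow q L w s) + l * V)).
  exact: integrable_EFinD.
have -> : Q * (lam * \int[mu]_(s in `[0, S]) (beta s * norm_pow q L w s) + l * (S * V)) =
   \int[mu]_(s in `[0, S]) (Q * (lam * (beta s * norm_pow q L w s) + l * V)).
  rewrite [RHS]RintegralZl// RintegralD// Rintegral_cst// RintegralZl//.
  have mE : fine (mu `[0, S]) = S by rewrite lebesgue_measure_itv/= lte_fin S0 sube0.
  rewrite (_ : fine _ = S); last exact: mE.
  ring.
apply: ae_ge0_le_Rintegral => //.
- rewrite (_ : EFin \o _ = abse \o (EFin \o (fun s => c' s * pair (w s) Y)))//.
  exact: integrable_abse.
- exact: integrable_EFinZ.
- move=> s _; rewrite mulr_ge0// addr_ge0 ?mulr_ge0 ?norm_pow_ge0//; exact: ltW.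
(* [young_pair] needs a finite slice, so the integrands are compared for almost every [s] only. *)
apply: (@filterS _ _ (ae_filter_ringOfSetsType mu) _ _ _ (ae_normE_lty Lw L TS)) => s fs.
rewrite /= in_itv/= => sS.
have /andP[s0 sS'] := sS.
have Ts := time_itv_sub TS s0 sS'.
have lw : L1loc (w s) by case: C1w => -[lw _] _ _; exact: lw.
rewrite normrM.
apply: le_trans (ler_wpM2r (normr_ge0 _) (cQ s sS)) _.
rewrite mulrDr !mulrA [leRHS](_ : _ = (Q * lam * beta s) * fine (normE q L w s) + (Q * l) * V)//.
have j1 : (\int[leb]_(x in eball L) (1 : R)%:E <= V%:E)%E.
  rewrite integral_cst ?mul1e; last exact: measurable_eball.
  by rewrite /V fineK// ge0_fin_numE// lebesgue_eball_fin.
apply: (@young_pair _ _ (w s) Y q L L _ _ _ V (cst 1)) => //; try by rewrite !mulr_ge0// ltW.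
- exact: suppw.
- exact: fs.
move=> x Lx; rewrite (Y1 Lx) normr1 !mulr1 -!mulrA -mulrDr ler_wpM2l//.
have kw : 0 <= k s * `|w s x| by rewrite mulr_ge0.
have := young_split kw ler01 q1 lam0; rewrite mulr1 powR1 mulr1 => /le_trans; apply.
by rewrite lerD2r ler_wpM2l ?(ltW lam0)// powRM// ler_wpM2r ?powR_ge0// kb.
Qed.

End energy.

Section time_multipliers.
Context {R : realType}.
Variables (chi chi1 chi2 : R -> R) (C0 : R).
Hypothesis st : is_step chi chi1 chi2 C0.
Variables (S : R) (m : nat).
Hypotheses (S1 : 1 <= S) (m2 : (2 < m)%N).
Local Notation eta := (eta chi S m).
Local Notation eta1 := (eta1 chi chi1 S m).
Local Notation eta2 := (eta2 chi chi1 chi2 S m).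
Local Notation weight := (weight chi).
Local Notation eta_cst := (eta_cst C0 m).

Let S0 : 0 < S. Proof. exact: lt_le_trans ltr01 S1. Qed.
Let m1 : (1 < m)%N. Proof. exact: ltnW. Qed.

(** Majorant of both derivatives of [eta] up to powers of [S]. It is set to 0 before [S / 2] to
    retain that [s] is comparable to [S], which turns the weight [(1 + s)^nu] into [S^nu]. *)
Definition cutoff s : R := if S / 2 <= s then chi (S^-1 * s) ^+ m.-2 else 0.

Lemma cutoff_ge0 s : 0 <= cutoff s.
Proof. by rewrite /cutoff; case: ifP => // _; rewrite exprn_ge0// (step_ge0 st). Qed.

Lemma cutoff_pow s (q : R) : 1 < q -> m%:R <= (m.-2)%:R * q -> cutoff s `^ q <= eta s.
Proof.
move=> q1 mq; rewrite /cutoff; case: ifP => _; last first.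
  by rewrite powR0 ?(eta_ge0 st)//; apply/eqP; lra.
have c0 := step_ge0 st (S^-1 * s); have c1 := step_le1 st (S^-1 * s).
rewrite -(powR_mulrn _ c0) -powRrM /eta -(powR_mulrn m c0).
have [e|cn] := eqVneq (chi (S^-1 * s)) 0.
  have h : (m.-2)%:R * q != 0.
    by rewrite gt_eqF// mulr_gt0// ?ltr0n; [lia|lra].
  by rewrite e (powR0 h) powR_ge0.
by rewrite ger_powR// c1 lt_def cn c0.
Qed.

Lemma eta1_cutoff s : `|eta1 s| <= eta_cst / S * cutoff s.
Proof.
rewrite /cutoff; case: ifPn => [_|]; first exact: (eta1_le st).
by rewrite -ltNge => sS; rewrite (eta1_eq0 st)// normr0 mulr0.
Qed.

Lemma eta2_cutoff s : `|eta2 s| <= eta_cst / S ^+ 2 * cutoff s.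
Proof.
rewrite /cutoff; case: ifPn => [_|]; first exact: (eta2_le st).
by rewrite -ltNge => sS; rewrite (eta2_eq0 st)// normr0 mulr0.
Qed.

Lemma eta2_continuous : continuous eta2.
Proof.
have [h1 d1 [h2 d2 ch2]] := Ck_Cn (Ck_eta st 2 S m).
have E1 : h1 = eta1.
  by apply/funext => s; exact: (is_derive_unique (d1 s I) (is_derive_eta st S m s)).
have -> : eta2 = h2; last by move=> s; exact: ch2.
apply/funext => s; apply/esym; rewrite E1 in d2.
exact: (is_derive_unique (d2 s I) (is_derive_eta1 st S m s)).
Qed.

Lemma eta1_continuous : continuous eta1.
Proof.
move=> s; apply: differentiable_continuous; apply/derivable1_diffP.
by case: (is_derive_eta1 st S m s).
Qed.

Lemma eta_continuous : continuous eta. Proof. exact: (Ck_eta st 0 S m). Qed.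

Lemma eta1_end : eta1 S = 0.
Proof.
rewrite /eta1 mulVf ?gt_eqF// (step0 st)// expr0n.
by rewrite (_ : m.-1 == 0%N = false) ?mulr0 ?mul0r//; lia.
Qed.

Lemma eta1_start : eta1 0 = 0. Proof. by rewrite (eta1_eq0 st)// divr_gt0. Qed.

Lemma eta_start : eta 0 = 1. Proof. by rewrite (eta_eq1 st)// divr_ge0// ltW. Qed.

Lemma eta_end s : S <= s -> eta s = 0.
Proof. by move=> Ss; rewrite (eta_eq0 st)//; lia. Qed.

Lemma C1seg_damped : C1seg 0 S (fun s => eta s - eta1 s) (fun s => eta1 s - eta2 s).
Proof.
apply: C1seg_global => [s|s].
  exact: (is_deriveB (is_derive_eta st S m s) (is_derive_eta1 st S m s)).
by apply: cvgB; [exact: eta1_continuous|exact: eta2_continuous].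
Qed.

(** The constant damping dominates: the wave part is of size [S^(-2)], at most [S^(-1)] since
    [S >= 1]. *)
Lemma damped_multiplier_le s : `|eta1 s - eta2 s| <= 2 * eta_cst / S * cutoff s.
Proof.
apply: le_trans (ler_normB _ _) _.
apply: le_trans (lerD (eta1_cutoff s) (eta2_cutoff s)) _.
rewrite -mulrDl; apply: ler_wpM2r; first exact: cutoff_ge0.
have c0 : 0 <= eta_cst := eta_cst_ge0 st m.
rewrite (_ : 2 * eta_cst / S = eta_cst / S + eta_cst / S); last by ring.
rewrite lerD2l ler_wpM2l// lef_pV2 ?posrE ?exprn_gt0//.
by rewrite expr2 ler_peMr// ltW.
Qed.

Section scale_invariant.
Variables (mu nu : R).
Hypotheses (nu0 : 0 <= nu) (nu1 : nu <= 1) (numu : (mu - nu) * (nu - 1) = 0).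

(** The multiplier [-a' + b a] for [a = (1 + s)^nu eta] and [b = mu / (1 + s)]. Explicit powers
    replace the globally smooth [weight], as only times [s >= 0] matter here. *)
Definition sinv_c s : R := (mu - nu) * (1 + s) `^ (nu - 1) * eta s - (1 + s) `^ nu * eta1 s.
Definition sinv_c' s : R := (mu - 2 * nu) * (1 + s) `^ (nu - 1) * eta1 s - (1 + s) `^ nu * eta2 s.

Lemma pow1D_within_continuous (a : R) : {within `[0, S], continuous (fun s => (1 + s) `^ a)}.
Proof.
apply/subspace_continuousP => s /=; rewrite in_itv/= => /andP[s0 _].
apply: cvg_within_filter; apply: differentiable_continuous; apply/derivable1_diffP.
by case: (is_derive_pow1D a s0).
Qed.

Lemma C1seg_sinv : C1seg 0 S sinv_c sinv_c'.
Proof.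
have w (a : R) (f : R -> R) : continuous f -> {within `[0, S], continuous (fun s => (1 + s) `^ a * f s)}.
  move=> cf; apply: within_continuousM; first exact: pow1D_within_continuous.
  exact: continuous_subspaceT.
have e1 : sinv_c = fun s => (mu - nu) * ((1 + s) `^ (nu - 1) * eta s) - (1 + s) `^ nu * eta1 s.
  by apply/funext => s; rewrite /sinv_c mulrA.
have e2 : sinv_c' = fun s => (mu - 2 * nu) * ((1 + s) `^ (nu - 1) * eta1 s) - (1 + s) `^ nu * eta2 s.
  by apply/funext => s; rewrite /sinv_c' mulrA.
split.
- rewrite e1; apply: within_continuousD; last exact/within_continuousN/w/eta1_continuous.
  apply: within_continuousM; last exact/w/eta_continuous.
  by apply: continuous_subspaceT => x; exact: cvg_cst.
- rewrite e2; apply: within_continuousD; last exact/within_continuousN/w/eta2_continuous.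
  apply: within_continuousM; last exact/w/eta1_continuous.
  by apply: continuous_subspaceT => x; exact: cvg_cst.
move=> s /andP[s0 _].
have d1 := is_derive_pow1D (nu - 1) (ltW s0); have d2 := is_derive_pow1D nu (ltW s0).
have D := is_deriveB (is_deriveZ (mu - nu) (is_deriveM d1 (is_derive_eta st S m s)))
  (is_deriveM d2 (is_derive_eta1 st S m s)).
rewrite e1; apply: (is_derive_eq D).
rewrite -[LHS]/((mu - nu) * ((1 + s) `^ (nu - 1) * eta1 s + eta s * ((nu - 1) * (1 + s) `^ (nu - 1 - 1)))
  - ((1 + s) `^ nu * eta2 s + eta1 s * (nu * (1 + s) `^ (nu - 1)))) e2.
move: (eta s) (eta1 s) (eta2 s) ((1 + s) `^ nu) ((1 + s) `^ (nu - 1))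
  ((1 + s) `^ (nu - 1 - 1)) => x y z a b c.
(* [numu] removes the one term in which [eta] is not differentiated. *)
rewrite (_ : _ - _ = (mu - nu) * (nu - 1) * (x * c) + ((mu - 2 * nu) * (b * y) - a * z)); last by ring.
by rewrite numu mul0r add0r.
Qed.

Lemma sinv_multiplier_le (s : R) : 0 <= s <= S ->
  `|sinv_c' s| <= 2 * (1 + `|mu - 2 * nu|) * eta_cst * (S `^ nu / S ^+ 2) * cutoff s.
Proof.
move=> /andP[s0 sS]; have h1 : 1 <= S := S1.
have h2 : nu <= 1 := nu1; have h3 : 0 <= nu := nu0; have c0 : 0 <= eta_cst := eta_cst_ge0 st m.
have k0 := cutoff_ge0 s; have s1 : 0 < 1 + s by lra.
have [sS2|sS2] := ltP s (S / 2).
  rewrite /sinv_c' (eta1_eq0 st)// (eta2_eq0 st)// !mulr0 subrr normr0.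
  by rewrite !mulr_ge0 ?c0 ?addr_ge0 ?invr_ge0 ?powR_ge0 ?exprn_ge0 ?(ltW S0).
(* For [S / 2 <= s <= S] the base [1 + s] lies between [S / 2] and [2 S]. The exponents [nu] and
   [1 - nu] lie in [[0, 1]], so a factor 2 suffices in both bounds. *)
have P1 : (1 + s) `^ nu <= 2 * S `^ nu.
  apply: (@le_trans _ _ ((2 * S) `^ nu)).
    by apply: ge0_ler_powR => //; rewrite ?nnegrE; lra.
  rewrite powRM ?(ltW S0)// ler_wpM2r ?powR_ge0//.
  by rewrite -[leRHS](powRr1 (_ : 0 <= 2))// ler_powR// ler1n.
have P2 : (1 + s) `^ (nu - 1) <= 2 * (S `^ nu / S).
  have -> : nu - 1 = - (1 - nu) by ring.
  have -> : S `^ nu / S = S `^ (- (1 - nu)).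
    rewrite (_ : - (1 - nu) = nu + -1); last by ring.
    rewrite powRD; last by rewrite (gt_eqF S0) implybT.
    by rewrite powR_inv1// ltW.
  rewrite !powRN ler_pdivlMr ?powR_gt0// mulrC ler_pdivrMr ?powR_gt0//.
  apply: (@le_trans _ _ ((2 * (1 + s)) `^ (1 - nu))).
    by apply: ge0_ler_powR; rewrite ?nnegrE; lra.
  rewrite powRM ?(ltW s1)// ler_wpM2r ?powR_ge0//.
  by rewrite -[leRHS](powRr1 (_ : 0 <= 2))// ler_powR ?ler1n//; lra.
rewrite /sinv_c'; apply: le_trans (ler_normB _ _) _.
have E1 := eta1_cutoff s; have E2 := eta2_cutoff s.
move: (eta1 s) (eta2 s) E1 E2 => e1 e2 E1 E2; rewrite !normrM.
rewrite (ger0_norm (powR_ge0 _ _)) (ger0_norm (powR_ge0 _ _)).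
have Sn0 : 0 <= S `^ nu by exact: powR_ge0.
have Q1 : `|mu - 2 * nu| * (1 + s) `^ (nu - 1) * `|e1| <=
    `|mu - 2 * nu| * (2 * (S `^ nu / S)) * (eta_cst / S * cutoff s).
  by apply: ler_pM; rewrite ?mulr_ge0 ?powR_ge0// ler_wpM2l.
have Q2 : (1 + s) `^ nu * `|e2| <= (2 * S `^ nu) * (eta_cst / S ^+ 2 * cutoff s).
  by apply: ler_pM; rewrite ?powR_ge0.
apply: le_trans (lerD Q1 Q2) _.
rewrite le_eqVlt; apply/orP; left; apply/eqP.
by field; rewrite gt_eqF.
Qed.

Lemma sinv_cE (s : R) : 0 <= s ->
  sinv_c s = - (nu * (1 + s) `^ (nu - 1) * eta s + weight nu s * eta1 s)
    + mu / (1 + s) * (weight nu s * eta s).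
Proof.
move=> s0; rewrite (weightE st)// /sinv_c.
have s1 : 0 < 1 + s by lra.
have -> : (1 + s) `^ nu = (1 + s) * (1 + s) `^ (nu - 1).
  transitivity ((1 + s) `^ (1 + (nu - 1))); first by congr (_ `^ _); ring.
  rewrite [LHS]powRD; last by rewrite (gt_eqF s1) implybT.
  by rewrite powRr1// ltW.
by field; rewrite gt_eqF.
Qed.

End scale_invariant.

Lemma smooth_weight_eta (nu : R) : smooth (fun s => weight nu s * eta s).
Proof. by move=> k; apply: CkM; [exact: (Ck_weight st)|exact: (Ck_eta st)]. Qed.

Lemma derive_weight_eta (nu s : R) : 0 <= s ->
  'D_1 (fun s => weight nu s * eta s) s = nu * (1 + s) `^ (nu - 1) * eta s + weight nu s * eta1 s.
Proof.
move=> s0.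
have [_ ->] := is_deriveM (is_derive_weight st nu s0) (is_derive_eta st S m s).
rewrite -[LHS]/(weight nu s * eta1 s + eta s * (nu * (1 + s) `^ (nu - 1))); ring.
Qed.

End time_multipliers.

Section mass.
Context {R : realType} {n : nat}.
Local Notation rV := 'rV[R]_n.
Local Notation leb := (lebesgue_rv R n).
Implicit Types (f Y : rV -> R) (rho L : R).

Definition mass rho f : R := \int[leb]_(x in eball rho) `|f x|.

Lemma L1loc_norm f : L1loc f -> L1loc (fun x => `|f x|).
Proof.
move=> [mf If]; split; first exact: measurableT_comp.
by move=> r; exact: integrable_abse (If r).
Qed.

Lemma mass_gt0 rho f : L1loc f -> admissible_datum rho f -> 0 < mass rho f.
Proof.
move=> [mf If] [f0 fn0 fr]; have mr := @measurable_eball R n rho.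
rewrite lt_def Rintegral_ge0// andbT; apply/negP => /eqP m0; apply: fn0.
have fin : (\int[leb]_(x in eball rho) `|f x|%:E)%E \is a fin_num.
  by apply: integrable_fin_num => //; exact: integrable_abse (If rho).
have i0 : (\int[leb]_(x in eball rho) `|(EFin \o f) x|)%E = 0%E.
  by rewrite -[LHS]fineK//; congr EFin.
have mf' : measurable_fun (eball rho) (EFin \o f).
  by apply/measurable_EFinP; exact: measurable_funS mf.
have /(_ i0) := (ae_eq_integral_abs leb mr mf').1.
move=> H; apply: filterS2 H fr => x /= H1 H2.
by have [xr|xr] := pselect (eball rho x); [have /= [] := H1 xr|exact: H2].
Qed.

(** The test functions depend on [S], but both kinds are at least 1 on the support of the data; this
    gives a lower bound for the data term that does not depend on [S]. *)
Lemma pair_ge_mass rho f Y : L1loc f -> admissible_datum rho f -> test_rv Y ->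
  (forall x, 0 <= Y x) -> (forall x, eball rho x -> 1 <= Y x) ->
  mass rho f <= pair f Y.
Proof.
move=> lf [f0 _ fr] tY Y0 Y1; have [mf If] := lf.
have mr := @measurable_eball R n rho.
have lnf := L1loc_norm lf.
have -> : pair f Y = pair (fun x => `|f x|) Y.
  apply: pair_ae_eq => //; first by case: lnf.
  by apply: filterS f0 => x /ger0_norm ->.
rewrite /mass Rintegral_mkcond; apply: le_Rintegral => //.
- have := (integrable_mkcond _ mr).1 (integrable_abse (If rho)).
  by rewrite restrict_EFin.
- exact: integrable_pair.
- move=> x _; rewrite patchE; case: ifPn => [|_]; last by rewrite mulr_ge0.
  by rewrite inE => xr; rewrite ler_peMr// Y1.
Qed.

Lemma pair_ge0 rho f Y : admissible_datum rho f -> L1loc f -> test_rv Y ->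
  (forall x, 0 <= Y x) -> 0 <= pair f Y.
Proof.
move=> [f0 _ _] lf tY Y0.
have -> : pair f Y = pair (fun x => `|f x|) Y.
  apply: pair_ae_eq => //; first by case: lf.
    by case: (L1loc_norm lf).
  by apply: filterS f0 => x /ger0_norm ->.
by apply: Rintegral_ge0 => x _; rewrite mulr_ge0.
Qed.

Lemma supported_inS L L' f : L <= L' -> supported_in L f -> supported_in L' f.
Proof.
move=> LL'; apply: filterS => x fx xL'; apply: fx => xL; apply: xL'.
exact: le_trans xL LL'.
Qed.

Lemma volume_le rho S : 0 < rho -> 1 <= S ->
  fine (leb (eball (rho + S))) <= (2 * (rho + 1)) ^+ n * S ^+ n.
Proof.
move=> r0 S1; rewrite -lee_fin fineK ?ge0_fin_numE ?lebesgue_eball_fin//.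
have rS : 0 <= rho + S by lra.
apply: le_trans (lebesgue_eball_le _ rS) _; rewrite lee_fin -exprMn.
by rewrite lerXn2r ?nnegrE ?mulr_ge0//; nra.
Qed.

End mass.

(** * The two coupled plateau estimates *)

Section system_estimates.
Context {R : realType} {n : nat}.
Local Notation rV := 'rV[R]_n.
Local Notation leb := (lebesgue_rv R n).
Local Notation lmu := (@lebesgue_measure R).
Variables (chi chi1 chi2 : R -> R) (C0 : R).
Hypothesis st : is_step chi chi1 chi2 C0.
Variables (m : nat) (p q mu nu rho : R).
Hypotheses (m2 : (2 < m)%N) (p1 : 1 < p) (q1 : 1 < q).
Hypotheses (mp : m%:R <= (m.-2)%:R * p) (mq : m%:R <= (m.-2)%:R * q).
Hypotheses (nu0 : 0 <= nu) (nu1 : nu <= 1) (numu : (mu - nu) * (nu - 1) = 0)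
  (nule : nu <= mu) (rho0 : 0 < rho).
Variables (u0 u1 v0 v1 : rV -> R).
Hypotheses (lu0 : L1loc u0) (lu1 : L1loc u1) (lv0 : L1loc v0) (lv1 : L1loc v1).
Hypotheses (du0 : admissible_datum rho u0) (du1 : admissible_datum rho u1)
  (dv0 : admissible_datum rho v0) (dv1 : admissible_datum rho v1).
Variables (eps : R) (T : \bar R) (u v ut vt : R -> rV -> R) (gu gv : 'I_n -> R -> rV -> R).
Hypotheses (eps0 : 0 < eps).
Hypotheses (Cu : C_W11loc T u gu) (C1u : C1_L1loc T u ut) (Lu : Lloc_spacetime T q u).
Hypotheses (Cv : C_W11loc T v gv) (C1v : C1_L1loc T v vt) (Lv : Lloc_spacetime T p v).
Hypothesis supp : forall t, 0 < t -> (t%:E < T)%E ->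
  supported_in (rho + t) (u t) /\ supported_in (rho + t) (v t).
Hypotheses (iu : {ae leb, forall x, u 0 x = eps * u0 x})
  (iv : {ae leb, forall x, v 0 x = eps * v0 x}).
Hypotheses (equ : weak_equation T (fun=> 1) p eps u1 ut gu v)
  (eqv : weak_equation T (fun t => mu / (1 + t)) q eps v1 vt gv u).
Variable S : R.
Hypotheses (S1 : 1 <= S) (ST : (S%:E < T)%E).
Local Notation eta := (eta chi S m).
Local Notation weight := (weight chi).
Local Notation L := (rho + S).

Let S0 : 0 < S. Proof. exact: lt_le_trans ltr01 S1. Qed.

Lemma init_support (f f0 : rV -> R) : supported_in rho f0 ->
  {ae leb, forall x, f x = eps * f0 x} -> supported_in rho f.
Proof.
by move=> sf0 E; apply: filterS2 sf0 E => x f0x -> xr; rewrite f0x// mulr0.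
Qed.

Lemma support_u s : 0 <= s <= S -> supported_in (rho + s) (u s).
Proof.
move=> /andP[]; rewrite le_eqVlt => /predU1P[<- _|s0 sS].
  by rewrite addr0; case: du0 => _ _ s0; exact: init_support s0 iu.
apply: (supp s0 _).1; apply: le_lt_trans ST; by rewrite lee_fin.
Qed.

Lemma support_v s : 0 <= s <= S -> supported_in (rho + s) (v s).
Proof.
move=> /andP[]; rewrite le_eqVlt => /predU1P[<- _|s0 sS].
  by rewrite addr0; case: dv0 => _ _ s0; exact: init_support s0 iv.
apply: (supp s0 _).2; apply: le_lt_trans ST; by rewrite lee_fin.
Qed.

Lemma support_uS s : 0 <= s <= S -> supported_in L (u s).
Proof.
by move=> sS; apply: supported_inS (support_u sS); rewrite lerD2l; case/andP: sS.
Qed.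

Lemma support_vS s : 0 <= s <= S -> supported_in L (v s).
Proof.
by move=> sS; apply: supported_inS (support_v sS); rewrite lerD2l; case/andP: sS.
Qed.

Lemma pair_init (f : R -> rV -> R) (f0 Y : rV -> R) : measurable_fun setT (f 0) ->
  L1loc f0 -> test_rv Y -> {ae leb, forall x, f 0 x = eps * f0 x} ->
  pair (f 0) Y = eps * pair f0 Y.
Proof.
move=> mf lf0 tY E; rewrite -pairZ//; apply: pair_ae_eq => //.
by case: lf0 => mf0 _; exact: measurable_funM.
Qed.

Definition int_v : R := \int[lmu]_(s in `[0, S]) (eta s * norm_pow p L v s).
Definition int_u : R := \int[lmu]_(s in `[0, S]) (weight nu s * eta s * norm_pow q L u s).

Let VC : R := (2 * (rho + 1)) ^+ n.

Let TS : time_itv T S. Proof. by split => //; exact: ltW. Qed.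

Lemma int_v_ge0 : 0 <= int_v.
Proof. by apply: Rintegral_ge0 => s _; rewrite mulr_ge0 ?norm_pow_ge0 ?(eta_ge0 st). Qed.

Lemma int_u_ge0 : 0 <= int_u.
Proof.
by apply: Rintegral_ge0 => s _; rewrite !mulr_ge0 ?norm_pow_ge0 ?(eta_ge0 st) ?weight_ge0.
Qed.

Lemma damped_estimate lam : 0 < lam ->
  eps * mass rho u1 + int_v <=
  2 * eta_cst C0 m / S * (lam * (2 `^ nu * S `^ (- nu) * int_u)
     + lam `^ (- (q - 1)^-1) * (VC * S ^+ n.+1)).
Proof.
move=> lam0.
have L0 : 0 <= L by rewrite addr_ge0 ?(ltW rho0)// (le_trans ler01).
have [Y [tY Y0 Y1 lapY]] := @exists_plateau_test R n L L0.
(* For [s >= S / 2] one has [S <= 2 (1 + s)], hence [1 <= w0 (1 + s)^nu]: the weight of [int_u] is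
   inserted at the price of [S^(-nu)]. *)
pose w0 : R := 2 `^ nu * S `^ (- nu).
pose beta s : R := w0 * (weight nu s * eta s).
have w00 : 0 <= w0 by rewrite mulr_ge0 ?powR_ge0.
have c0 : 0 <= eta_cst C0 m := eta_cst_ge0 st m.
have cwe : continuous (fun s => weight nu s * eta s).
  exact: (smooth_weight_eta st S m nu 0%N).
have cb : {within `[0, S], continuous beta}.
  by apply: continuous_subspaceT => s; apply: cvgM; [exact: cvg_cst|exact: cwe].
have b0 s : 0 <= beta s by rewrite mulr_ge0// mulr_ge0 ?(eta_ge0 st) ?weight_ge0.
have se : smooth eta by move=> k; exact: (Ck_eta st).
have c1 : eta S - eta1 chi chi1 S m S = 0.
  by rewrite (eta_end st S1 m2)// (eta1_end st S1 m2) subrr.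
have cE s : 0 <= s <= S -> eta s - eta1 chi chi1 S m s = - eta1 chi chi1 S m s + 1 * eta s.
  by move=> _; rewrite mul1r addrC.
have Q0 : 0 <= 2 * eta_cst C0 m / S by rewrite divr_ge0 ?(ltW S0)// mulr_ge0.
have kb s : 0 <= s <= S -> cutoff chi S m s `^ q <= beta s.
  move=> /andP[s0 sS]; have [sS2|sS2] := leP (S / 2) s; last first.
    rewrite /cutoff ifN -?ltNge// powR0//.
    by rewrite gt_eqF// (lt_trans ltr01).
  apply: le_trans (cutoff_pow st S1 m2 s q1 mq) _.
  rewrite /beta mulrA ler_peMl ?(eta_ge0 st)// (weightE st _ s0) /w0.
  rewrite powRN mulrAC ler_pdivlMr ?powR_gt0// mul1r -powRM//; last by lra.
  by apply: ge0_ler_powR => //; rewrite ?nnegrE; lra.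
have E := energy_bound p1 q1 Cu C1u Lu Lv lu1 equ S0 ST support_uS support_vS tY Y0 Y1 lapY
  se (is_derive_eta st S m) (eta_ge0 st S m) (eta_end st S1 m2) (C1seg_damped st S m)
  c1 cE Q0 (cutoff_ge0 st S m) b0 cb
  (fun s _ => damped_multiplier_le st S1 m2 s) kb lam0.
have Yrho x : eball rho x -> 1 <= Y x.
  by move=> xr; rewrite Y1//; apply: le_trans xr _; rewrite lerDl ltW.
have M1 := pair_ge_mass lu1 du1 tY Y0 Yrho.
have M0 := pair_ge0 du0 lu0 tY Y0.
rewrite (eta_start st m S1) (eta1_start st m S1) subr0 !mul1r in E.
have Tz : time_itv T 0 by exact: time_itv_sub TS (lexx 0) (ltW S0).
rewrite (pair_init (Lloc_section_measurable Lu Tz) lu0 tY iu) in E.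
(* The boundary term at time 0 may be dropped because [u0] is nonnegative. *)
apply: (@le_trans _ _ (eps * pair u1 Y + eps * pair u0 Y + int_v)).
  rewrite lerD2r -mulrDr ler_pM2l//; apply: le_trans M1 _; by rewrite lerDl.
apply: le_trans E _; apply: ler_wpM2l => //.
have -> : \int[lmu]_(s in `[0, S]) (beta s * norm_pow q L u s) = w0 * int_u.
  rewrite /int_u -RintegralZl//.
    by apply: eq_Rintegral => s _; rewrite /beta !mulrA.
  apply: integrable_continuousM; last exact: (integrable_norm_pow Lu L TS).
  by apply: continuous_subspaceT => s; exact: cwe.
rewrite lerD2l ler_wpM2l ?powR_ge0//.
apply: (@le_trans _ _ (S * (VC * S ^+ n))); last by rewrite exprS mulrCA.
by rewrite ler_pM2l// volume_le.
Qed.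

Lemma scale_invariant_estimate lam : 0 < lam ->
  eps * mass rho v1 + int_u <=
  2 * (1 + `|mu - 2 * nu|) * eta_cst C0 m * (S `^ nu / S ^+ 2) *
    (lam * int_v + lam `^ (- (p - 1)^-1) * (VC * S ^+ n.+1)).
Proof.
move=> lam0.
have L0 : 0 <= L by rewrite addr_ge0 ?(ltW rho0)// (le_trans ler01).
have [Y [tY Y0 Y1 lapY]] := @exists_plateau_test R n L L0.
have c0 : 0 <= eta_cst C0 m := eta_cst_ge0 st m.
pose a s := weight nu s * eta s.
have sa : smooth a by exact: (smooth_weight_eta st S m nu).
have da s : is_derive s (1 : R) a ('D_1 a s).
  by apply: derivableP; apply: diff_derivable; have [d _] := sa 1%N; exact: d.
have a0 s : 0 <= a s by rewrite mulr_ge0 ?(eta_ge0 st) ?weight_ge0.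
have aS s : S <= s -> a s = 0 by move=> /(eta_end st S1 m2) e; rewrite /a e mulr0.
have cS : sinv_c chi chi1 S m mu nu S = 0.
  by rewrite /sinv_c (eta_end st S1 m2)// (eta1_end st S1 m2) !mulr0 subrr.
have cE s : 0 <= s <= S -> sinv_c chi chi1 S m mu nu s = - 'D_1 a s + mu / (1 + s) * a s.
  move=> /andP[s0 _]; rewrite (sinv_cE st)// /a (derive_weight_eta st)//.
have Q0 : 0 <= 2 * (1 + `|mu - 2 * nu|) * eta_cst C0 m * (S `^ nu / S ^+ 2).
  by rewrite !mulr_ge0 ?c0 ?addr_ge0 ?invr_ge0 ?powR_ge0 ?exprn_ge0 ?(ltW S0).
have ce : {within `[0, S], continuous eta}.
  by apply: continuous_subspaceT => s; exact: (eta_continuous st).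
have E := energy_bound q1 p1 Cv C1v Lv Lu lv1 eqv S0 ST support_vS support_uS tY Y0 Y1 lapY
  sa da a0 aS (C1seg_sinv st S m numu) cS cE Q0 (cutoff_ge0 st S m) (eta_ge0 st S m) ce
  (sinv_multiplier_le st S1 m2 mu nu0 nu1)
  (fun s _ => cutoff_pow st S1 m2 s p1 mp) lam0.
have Yrho x : eball rho x -> 1 <= Y x.
  by move=> xr; rewrite Y1//; apply: le_trans xr _; rewrite lerDl ltW.
have M1 := pair_ge_mass lv1 dv1 tY Y0 Yrho.
have M0 := pair_ge0 dv0 lv0 tY Y0.
have Tz : time_itv T 0 by exact: time_itv_sub TS (lexx 0) (ltW S0).
have a00 : a 0 = 1.
  by rewrite /a (eta_start st m S1) (weightE st)// addr0 powR1 mulr1.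
have c00 : sinv_c chi chi1 S m mu nu 0 = mu - nu.
  by rewrite /sinv_c (eta_start st m S1) (eta1_start st m S1) addr0 !powR1 !mulr1 mulr0 subr0.
rewrite a00 c00 mul1r (pair_init (Lloc_section_measurable Lv Tz) lv0 tY iv) in E.
(* Here the boundary term has the coefficient [mu - nu], nonnegative by [nule]. *)
apply: (@le_trans _ _ (eps * pair v1 Y + (mu - nu) * (eps * pair v0 Y) + int_u)).
  rewrite lerD2r; apply: (@le_trans _ _ (eps * pair v1 Y)); first by rewrite ler_pM2l.
  by rewrite lerDl !mulr_ge0 ?subr_ge0// ltW.
apply: le_trans E _; apply: ler_wpM2l => //.
rewrite lerD2l ler_wpM2l ?powR_ge0//.
apply: (@le_trans _ _ (S * (VC * S ^+ n))); last by rewrite exprS mulrCA.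
by rewrite ler_pM2l// volume_le.
Qed.

End system_estimates.

(** * Growth of the Bessel mode *)

Section comparison.
Context {R : realType}.
Local Notation lmu := (@lebesgue_measure R).

(** Let [c] be the first point with [D <= 0]. Before [c] the integral only sees [D > 0], so
    [D' >= 0] there, and the mean value theorem gives [D c >= D 0 > 0]. *)
Lemma integral_inequality_pos (E : R) (w D D' : R -> R) : 0 <= E ->
  (forall t, 0 <= w t) -> C1seg 0 E D D' -> 0 < D 0 ->
  (forall t, 0 < t <= E -> 0 < w t /\
     \int[lmu]_(s in `[0, t]) (w s * D s) <= w t * D' t) ->
  forall t, 0 <= t <= E -> 0 < D t.
Proof.
move=> E0 w0 CD D0 H t0 /andP[t00 t0E]; rewrite ltNge; apply/negP => Dt0.
pose A := [set t | [/\ 0 <= t, t <= E & D t <= 0]].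
have At0 : A t0 by split.
have hA : has_inf A by split; [exists t0|exists 0 => t []].
pose c := inf A.
have c0 : 0 <= c by apply: lb_le_inf; [exists t0|move=> t []].
have ct0 : c <= t0 by apply: ge_inf => //; exists 0 => t [].
have cE : c <= E by exact: le_trans t0E.
have below t : 0 <= t -> t < c -> 0 < D t.
  move=> t0' tc; rewrite ltNge; apply/negP => Dt.
  have : A t by split => //; exact: le_trans (ltW tc) cE.
  by move=> At; have := ge_inf hA.2 At; rewrite leNgt tc.
have cD := C1seg_cont CD.
have Dc : D c <= 0.
  rewrite leNgt; apply/negP => Dc.
  have cin : [set` `[0, E]] c by rewrite /= in_itv/= c0.
  have /subspace_continuousP/(_ c cin) := cD.
  move=> /(_ [set y | 0 < y]) /=; rewrite nbhs_simpl/=.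
  move=> /(_ (lt_nbhsr Dc)) [e /= e0 He].
  have [x Ax xc] := inf_adherent e0 hA.
  have [x0 xE Dx] := Ax.
  have cx : c <= x by apply: ge_inf => //; exists 0 => t [].
  have : 0 < D x.
    apply: (He x) => /=; last by rewrite in_itv/= x0.
    by rewrite ltr_distlC; apply/andP; split; lra.
  by rewrite ltNge Dx.
have cpos : 0 < c by rewrite lt_def c0 andbT; apply/eqP => e; move: Dc; rewrite e leNgt D0.
have Cc := C1segS cE CD.
have [x xc xE] := MVT cpos (fun t tc => C1seg_der Cc tc) (C1seg_cont Cc).
move: xc; rewrite in_itv/= => /andP[x0 xc].
have xin : 0 < x <= E by rewrite x0 (le_trans (ltW xc)).
have [wx Hx] := H x xin.
have I0 : 0 <= \int[lmu]_(s in `[0, x]) (w s * D s).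
  apply: Rintegral_ge0 => s /=; rewrite in_itv/= => /andP[s0 sx].
  by rewrite mulr_ge0// ltW// below// (le_lt_trans sx).
have D'x : 0 <= D' x by have := le_trans I0 Hx; rewrite pmulr_rge0.
have : 0 <= D c - D 0 by rewrite xE mulr_ge0// subr_ge0.
by rewrite subr_ge0 leNgt (le_lt_trans Dc).
Qed.

(* With [tau = 1 + t] and [y = tau^(-mu/2) z] the operator
   [y'' + mu y' / tau - y] becomes [z'' - (1 + kappa / tau^2) z] up to a factor,
   [kappa = (mu/2) (mu/2 - 1) >= -1/4]; the last factor of [subsol_z] absorbs
   the negative values of [kappa]. *)
Definition subsol_z (t : R) : R := expR t * ((4 + t) / (2 + t)).
Definition subsol_z1 (t : R) : R := expR t * ((4 + t) / (2 + t) - 2 / (2 + t) ^+ 2).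
Definition subsol_z2 (t : R) : R :=
  expR t * ((4 + t) / (2 + t) - 4 / (2 + t) ^+ 2 + 4 / (2 + t) ^+ 3).

Let is_derive_shift2 (t : R) : is_derive t (1 : R) (fun t => 2 + t) 1.
Proof. by have := is_deriveD (is_derive_cst (2 : R) t 1) (is_derive_id t (1 : R)); rewrite add0r. Qed.

Let is_derive_inv2 (t : R) : 0 <= t ->
  is_derive t (1 : R) (fun t => (2 + t)^-1) (- (2 + t) ^- 2).
Proof.
move=> t0; have n0 : (fun t : R => 2 + t) t != 0 by rewrite /= gt_eqF//; lra.
have := is_deriveV n0 (is_derive_shift2 t).
by rewrite /GRing.scale/= mulr1.
Qed.

Let ratioE (t : R) : - 1 < t -> (4 + t) / (2 + t) = 1 + 2 * (2 + t)^-1.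
Proof. by move=> t0; field; rewrite gt_eqF//; lra. Qed.

(** Identities valid for [s > -1] hold on a full neighbourhood of any [t >= 0], so derivatives are
    two-sided even at [t = 0]. *)
Let near_nonneg (P : R -> Prop) (t : R) : 0 <= t -> (forall s, - 1 < s -> P s) ->
  \forall s \near t, P s.
Proof.
move=> t0 H; have t1 : - 1 < t by lra.
by near=> s; apply: H; near: s; exact: lt_nbhsr.
Unshelve. all: by end_near. Qed.

Lemma is_derive_subsol_z (t : R) : 0 <= t -> is_derive t (1 : R) subsol_z (subsol_z1 t).
Proof.
move=> t0; have t1 : - 1 < t by lra.
apply: (@near_eq_is_derive _ _ _ (fun t : R => expR t * (1 + 2 * (2 + t)^-1))).
  by apply: near_nonneg => // s s0; rewrite /subsol_z ratioE.
have d1 := is_deriveM (is_derive_expR t)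
  (is_deriveD (is_derive_cst (1 : R) t 1) (is_deriveZ (2 : R) (is_derive_inv2 t0))).
apply: (is_derive_eq d1).
rewrite -[LHS]/(expR t * (0 + 2 * - (2 + t) ^- 2) + (1 + 2 * (2 + t)^-1) * expR t).
by rewrite /subsol_z1 ratioE//; ring.
Qed.

Lemma is_derive_subsol_z1 (t : R) : 0 <= t -> is_derive t (1 : R) subsol_z1 (subsol_z2 t).
Proof.
move=> t0; have n0 : 2 + t != 0 by rewrite gt_eqF//; lra.
apply: (@near_eq_is_derive _ _ _ (fun t : R => expR t * (1 + 2 * (2 + t)^-1
    + (-2) * ((2 + t)^-1 * (2 + t)^-1)))).
  apply: near_nonneg => // s s0; rewrite /subsol_z1 ratioE//; congr (_ * _).
  by rewrite expr2 invfM; ring.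
have di := is_derive_inv2 t0.
have d1 := is_deriveM (is_derive_expR t)
  (is_deriveD (is_deriveD (is_derive_cst (1 : R) t 1) (is_deriveZ (2 : R) di))
     (is_deriveZ (-2 : R) (is_deriveM di di))).
apply: (is_derive_eq d1).
rewrite -[LHS]/(expR t * (0 + 2 * - (2 + t) ^- 2 + (-2) * ((2 + t)^-1 * - (2 + t) ^- 2 + (2 + t)^-1 * - (2 + t) ^- 2)) +
  (1 + 2 * (2 + t)^-1 + (-2) * ((2 + t)^-1 * (2 + t)^-1)) * expR t).
by rewrite /subsol_z2; field.
Qed.

Lemma continuous_subsol_z2 (t : R) : 0 <= t -> {for t, continuous subsol_z2}.
Proof.
move=> t0; have t2 : 2 + t != 0 by rewrite gt_eqF//; lra.
have ci : (2 + s)^-1 @[s --> t] --> (2 + t)^-1.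
  by apply: cvgV => //; apply: cvgD; [exact: cvg_cst|exact: cvg_id].
have -> : subsol_z2 = fun s => expR s * ((4 + s) * (2 + s)^-1 - 4 * ((2 + s)^-1 * (2 + s)^-1)
   + 4 * ((2 + s)^-1 * ((2 + s)^-1 * (2 + s)^-1))).
  by apply/funext => s; rewrite /subsol_z2 -!exprVn !exprS expr0 mulr1.
apply: cvgM; first exact: continuous_expR.
apply: cvgD; last by apply: cvgM; [exact: cvg_cst|do 2![apply: cvgM => //]].
apply: cvgB; last by apply: cvgM; [exact: cvg_cst|exact: cvgM].
by apply: cvgM => //; apply: cvgD; [exact: cvg_cst|exact: cvg_id].
Qed.

Lemma subsol_z_ge (t : R) : 0 <= t -> expR t <= subsol_z t.
Proof.
move=> t0; rewrite /subsol_z ler_peMr ?expR_ge0// ler_pdivlMr; first by lra.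
by lra.
Qed.

Lemma subsol_z2_le (mu t : R) : 0 <= t ->
  subsol_z2 t <= (1 + mu / 2 * (mu / 2 - 1) / (1 + t) ^+ 2) * subsol_z t.
Proof.
move=> t0; have t1 : 0 < 1 + t by lra.
have t2 : 0 < 2 + t by lra.
have k : - 4^-1 <= mu / 2 * (mu / 2 - 1).
  by have := sqr_ge0 (mu / 2 - 2^-1); nra.
apply: (@le_trans _ _ ((1 + (- 4^-1) / (1 + t) ^+ 2) * subsol_z t)); last first.
  apply: ler_wpM2r; first by rewrite (le_trans _ (subsol_z_ge t0))// expR_ge0.
  by rewrite lerD2l ler_wpM2r// invr_ge0 exprn_ge0// ltW.
rewrite /subsol_z2 /subsol_z mulrCA ler_wpM2l ?expR_ge0//.
rewrite -subr_ge0.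
(* Cleared of denominators, the claim is [16 (1 + t)^3 >= (4 + t) (2 + t)^2], an equality at
   [t = 0]. *)
have -> : (1 + - 4^-1 / (1 + t) ^+ 2) * ((4 + t) / (2 + t))
   - ((4 + t) / (2 + t) - 4 / (2 + t) ^+ 2 + 4 / (2 + t) ^+ 3) =
   (16 * (1 + t) ^+ 3 - (4 + t) * (2 + t) ^+ 2) / (4 * (1 + t) ^+ 2 * (2 + t) ^+ 3).
  by field; rewrite !gt_eqF.
rewrite divr_ge0 ?mulr_ge0 ?exprn_ge0 ?(ltW t1) ?(ltW t2)//.
by rewrite subr_ge0 !exprS expr0; nra.
Qed.

End comparison.

Section subsolution.
Context {R : realType}.
Local Notation lmu := (@lebesgue_measure R).
Variable mu : R.

Lemma C1seg_nonneg (E : R) (f f' : R -> R) :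
  (forall t : R, 0 <= t -> is_derive t (1 : R) f (f' t)) ->
  (forall t : R, 0 <= t -> {for t, continuous f'}) -> C1seg 0 E f f'.
Proof.
move=> df cf'; split.
- apply/subspace_continuousP => t /=; rewrite in_itv/= => /andP[t0 _].
  apply: cvg_within_filter; apply: differentiable_continuous; apply/derivable1_diffP.
  by case: (df t t0).
- apply/subspace_continuousP => t /=; rewrite in_itv/= => /andP[t0 _].
  by apply: cvg_within_filter; exact: (cf' t t0).
- by move=> t /andP[t0 _]; exact/df/ltW.
Qed.

Let der_continuous (f : R -> R) (t df : R) : is_derive t (1 : R) f df -> f s @[s --> t] --> f t.
Proof.
by move=> [d _]; apply: differentiable_continuous; apply/derivable1_diffP.
Qed.

Let continuous_pow1D (a t : R) : 0 <= t -> (1 + s) `^ a @[s --> t] --> (1 + t) `^ a.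
Proof. by move=> t0; exact: (der_continuous (is_derive_pow1D a t0)). Qed.

Definition subsol (t : R) : R := (1 + t) `^ (- (mu / 2)) * subsol_z t.

Definition subsol1 (t : R) : R :=
  (1 + t) `^ (- (mu / 2)) * subsol_z1 t - mu / 2 * (1 + t) `^ (- (mu / 2) - 1) * subsol_z t.

(** This is [(1 + t)^mu] times [subsol1 t] with the powers merged: the flux in the divergence form
    of [y'' + mu y' / (1 + t)]. In its derivative [flux1] the terms with [subsol_z1] cancel. *)
Let flux (t : R) : R :=
  (1 + t) `^ (mu / 2) * subsol_z1 t - mu / 2 * ((1 + t) `^ (mu / 2 - 1) * subsol_z t).

Let flux1 (t : R) : R :=
  (1 + t) `^ (mu / 2) * subsol_z2 t
  - mu / 2 * ((mu / 2 - 1) * (1 + t) `^ (mu / 2 - 1 - 1) * subsol_z t).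

Lemma C1seg_subsol (E : R) : C1seg 0 E subsol subsol1.
Proof.
apply: C1seg_nonneg => t t0.
  apply: (is_derive_eq (is_deriveM (is_derive_pow1D (- (mu / 2)) t0) (is_derive_subsol_z t0))).
  rewrite -[LHS]/((1 + t) `^ (- (mu / 2)) * subsol_z1 t
     + subsol_z t * (- (mu / 2) * (1 + t) `^ (- (mu / 2) - 1))).
  by rewrite /subsol1; ring.
apply: cvgB.
  by apply: cvgM; [exact: continuous_pow1D|exact: der_continuous (is_derive_subsol_z1 t0)].
apply: cvgM; last exact: der_continuous (is_derive_subsol_z t0).
by apply: cvgM; [exact: cvg_cst|exact: continuous_pow1D].
Qed.

Let C1seg_flux (E : R) : C1seg 0 E flux flux1.
Proof.
apply: C1seg_nonneg => t t0.
  have dz := is_derive_subsol_z t0.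
  apply: (is_derive_eq (is_deriveB
    (is_deriveM (is_derive_pow1D (mu / 2) t0) (is_derive_subsol_z1 t0))
    (is_deriveZ (mu / 2) (is_deriveM (is_derive_pow1D (mu / 2 - 1) t0) dz)))).
  rewrite -[LHS]/((1 + t) `^ (mu / 2) * subsol_z2 t
     + subsol_z1 t * (mu / 2 * (1 + t) `^ (mu / 2 - 1))
     - mu / 2 * ((1 + t) `^ (mu / 2 - 1) * subsol_z1 t
         + subsol_z t * ((mu / 2 - 1) * (1 + t) `^ (mu / 2 - 1 - 1)))).
  by rewrite /flux1; ring.
apply: cvgB.
  by apply: cvgM; [exact: continuous_pow1D|exact: continuous_subsol_z2].
apply: cvgM; first exact: cvg_cst.
apply: cvgM; last exact: der_continuous (is_derive_subsol_z t0).
by apply: cvgM; [exact: cvg_cst|exact: continuous_pow1D].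
Qed.

Let powD (t a b : R) : 0 <= t -> (1 + t) `^ a * (1 + t) `^ b = (1 + t) `^ (a + b).
Proof.
move=> t0; have t1 : 0 < 1 + t by lra.
by rewrite [RHS]powRD// (gt_eqF t1) implybT.
Qed.

Lemma subsol0 : subsol 0 = 2.
Proof. by rewrite /subsol /subsol_z !addr0 powR1 expR0; lra. Qed.

Lemma subsol_ge (t : R) : 0 <= t -> expR t * (1 + t) `^ (- (mu / 2)) <= subsol t.
Proof. by move=> t0; rewrite mulrC ler_wpM2l ?powR_ge0// subsol_z_ge. Qed.

Lemma subsol_integral_inequality (t : R) : 0 <= mu -> 0 <= t ->
  (1 + t) `^ mu * subsol1 t <=
  3 / 2 + \int[lmu]_(s in `[0, t]) ((1 + s) `^ mu * subsol s).
Proof.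
move=> mu0 t0.
have -> : (1 + t) `^ mu * subsol1 t = flux t.
  have e1 : (1 + t) `^ (mu / 2) = (1 + t) `^ mu * (1 + t) `^ (- (mu / 2)).
    by rewrite powD//; congr (_ `^ _); lra.
  have e2 : (1 + t) `^ (mu / 2 - 1) = (1 + t) `^ mu * (1 + t) `^ (- (mu / 2) - 1).
    by rewrite powD//; congr (_ `^ _); lra.
  by rewrite /subsol1 /flux e1 e2; ring.
(* The exact value is [3/2 - mu]. *)
have f0 : flux 0 <= 3 / 2.
  by rewrite /flux /subsol_z1 /subsol_z !addr0 !powR1 expR0; lra.
have := C1seg_FTC2 t0 (C1seg_flux t) => /eqP; rewrite eq_sym subr_eq => /eqP ->.
rewrite addrC; apply: lerD => //.
have cs : {within `[0, t], continuous (fun s => (1 + s) `^ mu * subsol s)}.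
  apply: within_continuousM; last exact: C1seg_cont (C1seg_subsol t).
  apply/subspace_continuousP => s /=; rewrite in_itv/= => /andP[s0 _].
  by apply: cvg_within_filter; exact: continuous_pow1D.
apply: le_Rintegral => //.
- exact: within_integrable (C1seg_cont' (C1seg_flux t)).
- exact: within_integrable cs.
move=> s /=; rewrite in_itv/= => /andP[s0 _]; have s1 : 0 < 1 + s by lra.
rewrite /subsol [leRHS]mulrA powD// /flux1.
have -> : (1 + s) `^ (mu / 2 - 1 - 1) = (1 + s) `^ (mu / 2) / (1 + s) ^+ 2.
  rewrite (_ : mu / 2 - 1 - 1 = mu / 2 + - 2%:R); last by ring.
  by rewrite -powD// powRN powR_mulrn// ltW.
have -> : mu + - (mu / 2) = mu / 2 by lra.
have := ler_wpM2l (powR_ge0 (1 + s) (mu / 2)) (subsol_z2_le mu s0).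
move: ((1 + s) `^ (mu / 2)) (subsol_z s) (subsol_z2 s) => a b c.
have -> : a * ((1 + mu / 2 * (mu / 2 - 1) / (1 + s) ^+ 2) * b) = a * b
   + mu / 2 * ((mu / 2 - 1) * (a / (1 + s) ^+ 2) * b) by field; rewrite gt_eqF.
by rewrite lerBlDr.
Qed.

End subsolution.

Section wave_mode.
Context {R : realType} {k : nat}.
Local Notation n := k.+1.
Local Notation rV := 'rV[R]_n.
Local Notation leb := (lebesgue_rv R n).
Local Notation lmu := (@lebesgue_measure R).
Variables (chi chi1 chi2 : R -> R) (C0 : R).
Hypothesis st : is_step chi chi1 chi2 C0.
Variables (m : nat) (p q mu rho : R).
Hypotheses (m2 : (2 < m)%N) (p1 : 1 < p) (mu0 : 0 <= mu) (rho0 : 0 < rho).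
Variables (v0 v1 : rV -> R).
Hypotheses (lv0 : L1loc v0) (lv1 : L1loc v1).
Hypotheses (dv0 : admissible_datum rho v0) (dv1 : admissible_datum rho v1).
Variables (eps : R) (T : \bar R) (u v vt : R -> rV -> R) (gv : 'I_n -> R -> rV -> R).
Hypotheses (eps0 : 0 < eps) (Lu : Lloc_spacetime T q u).
Hypotheses (Cv : C_W11loc T v gv) (C1v : C1_L1loc T v vt) (Lv : Lloc_spacetime T p v).
Variable S : R.
Hypotheses (S4 : 4 <= S) (ST : (S%:E < T)%E).
Local Notation L := (rho + S).
Hypothesis suppv : forall s, 0 <= s <= S -> supported_in (rho + s) (v s).
Hypothesis iv : {ae leb, forall x, v 0 x = eps * v0 x}.
Hypothesis eqv : weak_equation T (fun t => mu / (1 + t)) q eps v1 vt gv u.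
Local Notation eta := (eta chi S m).
Local Notation weight := (weight chi).

Let S0 : 0 < S. Proof. by have h : 4 <= S := S4; lra. Qed.
Let S1 : 1 <= S. Proof. by have h : 4 <= S := S4; lra. Qed.
Let TS : time_itv T S. Proof. by split => //; exact: ltW. Qed.

Let L0 : 0 <= L. Proof. by rewrite addr_ge0 ?ltW. Qed.

(** The subsolution starts at 2 with initial flux at most [3/2]; a quarter of the masses keeps its
    multiple below both data of [U], strictly for the initial value. *)
Let delta : R := Num.min (mass rho v0) (mass rho v1) / 4.

Let mass0 : 0 < mass rho v0. Proof. exact: mass_gt0. Qed.
Let mass1 : 0 < mass rho v1. Proof. exact: mass_gt0. Qed.

Let delta0 : 0 < delta. Proof. by rewrite divr_gt0// lt_min mass0. Qed.
Let delta_v0 : 4 * delta <= mass rho v0.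
Proof. by rewrite /delta mulrC divfK// ge_min lexx. Qed.
Let delta_v1 : 4 * delta <= mass rho v1.
Proof. by rewrite /delta mulrC divfK// ge_min lexx orbT. Qed.

Variable Y : rV -> R.
Hypotheses (tY : test_rv Y) (Y0 : forall x, 0 <= Y x).
Hypothesis YE : forall x, eball L x -> Y x = psum (bessel_c k) (nrm2 x).
Hypothesis lapY : forall x, eball L x -> lap Y x = 1 * Y x.

Local Notation U := (fun s => pair (v s) Y).

Let suppvS s : 0 <= s <= S -> supported_in L (v s).
Proof.
by move=> sS; apply: supported_inS (suppv sS); rewrite lerD2l; case/andP: sS.
Qed.

Let Y1 x : eball rho x -> 1 <= Y x.
Proof.
move=> xr; have xL : eball L x by apply: le_trans xr _; rewrite lerDl ltW.
have b1 := bessel_ge1 k (nrm2_ge0 x).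
by rewrite (YE xL); exact: b1.
Qed.

Lemma mode_start : eps * mass rho v0 <= U 0.
Proof.
have Tz : time_itv T 0 by exact: time_itv_sub TS (lexx 0) (ltW S0).
rewrite (pair_init (Lloc_section_measurable Lv Tz) lv0 tY iv) ler_pM2l//.
exact: pair_ge_mass.
Qed.

(** The weight [(1 + s)^mu] is the integrating factor of the damping: before the cutoff acts, the
    coefficient of [vt] vanishes, and the tested equation is already the once integrated equation
    for [U], with a nonnegative source that is dropped. The cutoff only provides compact support in
    time. *)
Lemma mode_integral_inequality (t : R) : 0 < t <= S / 3 ->
  eps * mass rho v1 + \int[lmu]_(s in `[0, t]) ((1 + s) `^ mu * U s) <=
  (1 + t) `^ mu * pair (vt t) Y.
Proof.
move=> /andP[t0 tS].
have tS2 : t <= S / 2 by have h := S0; lra.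
have tS' : t <= S by have h := S0; lra.
pose a s := weight mu s * eta s.
have sa : smooth a by exact: (smooth_weight_eta st S m mu).
have da s : is_derive s (1 : R) a ('D_1 a s).
  by apply: derivableP; apply: diff_derivable; have [d _] := sa 1%N; exact: d.
have a0 s : 0 <= a s by rewrite mulr_ge0 ?(eta_ge0 st) ?weight_ge0.
have aS s : S < s -> a s = 0 by move=> /ltW /(eta_end st S1 m2) e; rewrite /a e mulr0.
have um s : time_itv T s -> measurable_fun setT (u s) by exact: (Lloc_section_measurable Lu).
have tT : (t%:E < T)%E by apply: le_lt_trans ST; rewrite lee_fin.
have supt s : 0 <= s <= t -> supported_in L (v s).
  by move=> /andP[s0 s_t]; apply: suppvS; rewrite s0 (le_trans s_t).
have := tested_equation Cv C1v um lv1 eqv sa da a0 TS aS tY Y0 lapY t0 tT supt.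
have aE s : 0 <= s <= t -> a s = (1 + s) `^ mu.
  move=> /andP[s0 s_t]; rewrite /a (weightE st)// (eta_eq1 st) ?mulr1//.
  exact: le_trans tS2.
have a0E : a 0 = 1 by rewrite aE ?lexx ?(ltW t0)// addr0 powR1.
have atE : a t = (1 + t) `^ mu by rewrite aE// lexx ltW.
rewrite a0E mul1r atE.
have -> : \int[lmu]_(s in `[0, t]) ((- 'D_1 a s + mu / (1 + s) * a s) * pair (vt s) Y
    - 1 * (a s * pair (v s) Y)) = - \int[lmu]_(s in `[0, t]) ((1 + s) `^ mu * U s).
  rewrite -mulN1r -RintegralZl//; last first.
    apply: within_integrable; apply: within_continuousM.
      exact: pow1D_within_continuous.
    apply: (within_pair_continuous (T := T)) => //; first by case: C1v.
    by split=> //; exact: ltW.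
  apply: eq_Rintegral => s; rewrite inE/= in_itv/= => /andP[s0 s_t].
  have sS2 : s < S / 2 by have h := S0; lra.
  rewrite /a (derive_weight_eta st)// (eta1_eq0 st)// (eta_eq1 st) ?(ltW sS2)// (weightE st)//.
  have s1 : 0 < 1 + s by lra.
  have -> : (1 + s) `^ mu = (1 + s) * (1 + s) `^ (mu - 1).
    transitivity ((1 + s) `^ (1 + (mu - 1))); first by congr (_ `^ _); ring.
    rewrite [LHS]powRD; last by rewrite (gt_eqF s1) implybT.
    by rewrite powRr1// ltW.
  by field; rewrite gt_eqF.
move=> E.
have : 0 <= \int[lmu]_(s in `[0, t]) (a s * nonlin q u Y s).
  apply: Rintegral_ge0 => s _; rewrite mulr_ge0//.
  by apply: Rintegral_ge0 => x _; rewrite mulr_ge0 ?powR_ge0.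
have := pair_ge_mass lv1 dv1 tY Y0 Y1; rewrite -(ler_pM2l eps0) => h1 h2.
move: E => /eqP; rewrite addrC subr_eq => /eqP ->.
by rewrite lerD2r -[leLHS]addr0 lerD.
Qed.

Lemma mode_growth (t : R) : 0 <= t <= S / 3 ->
  delta * eps * (expR t * (1 + t) `^ (- (mu / 2))) <= U t.
Proof.
move=> tS3; have /andP[t0 tS] := tS3.
have E0 : 0 <= S / 3 by exact: le_trans tS.
have de0 : 0 < delta * eps by rewrite mulr_gt0.
(* [D] satisfies the inequality of [integral_inequality_pos], because the data term exceeds
   [delta * eps] times the initial flux bound [3/2]. *)
pose D s := U s - delta * eps * subsol mu s.
pose D' s := pair (vt s) Y - delta * eps * subsol1 mu s.
have TE : time_itv T (S / 3) by apply: time_itv_sub TS _ _ => //; have h := S0; lra.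
have CU := C1seg_pair C1v tY TE.
have Cy := C1seg_subsol mu (S / 3).
have cst_cont (c : R) : {within `[0, S / 3], continuous (fun=> c)}.
  by apply: continuous_subspaceT => x; exact: cvg_cst.
have CD : C1seg 0 (S / 3) D D'.
  split.
  - apply: within_continuousD; first exact: C1seg_cont CU.
    by apply/within_continuousN/within_continuousM => //; exact: C1seg_cont Cy.
  - apply: within_continuousD; first exact: C1seg_cont' CU.
    by apply/within_continuousN/within_continuousM => //; exact: C1seg_cont' Cy.
  - move=> s sE; have := is_deriveB (C1seg_der CU sE)
      (is_deriveZ (delta * eps) (C1seg_der Cy sE)).
    by [].
have D0 : 0 < D 0.
  rewrite /D subsol0; have h1 := mode_start; have h2 := delta_v0.
  rewrite subr_gt0; apply: lt_le_trans h1.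
  rewrite mulrAC mulrC ltr_pM2l//; apply: lt_le_trans h2.
  by rewrite mulrC ltr_pM2r// ltr_nat.
apply: ltW; rewrite -subr_gt0; apply: (@lt_le_trans _ _ (D t)); last first.
  by rewrite lerD2l lerN2 ler_pM2l// subsol_ge.
apply: (integral_inequality_pos E0 (w := fun s => (1 + s) `^ mu) _ CD D0 _ tS3).
  by move=> s; exact: powR_ge0.
move=> s sS; have /andP[s0 sS'] := sS; split; first by rewrite powR_gt0//; lra.
have I1 := mode_integral_inequality sS.
have I2 := subsol_integral_inequality mu0 (ltW s0).
have cw : {within `[0, s], continuous (fun r => (1 + r) `^ mu)}.
  exact: pow1D_within_continuous.
have Cs := C1segS sS' CU; have Cys := C1segS sS' Cy.
have i1 : lmu.-integrable `[0, s] (EFin \o (fun r => (1 + r) `^ mu * U r)).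
  by apply: within_integrable; apply: within_continuousM cw (C1seg_cont Cs).
have i2 : lmu.-integrable `[0, s] (EFin \o (fun r => (1 + r) `^ mu * subsol mu r)).
  by apply: within_integrable; apply: within_continuousM cw (C1seg_cont Cys).
have -> : \int[lmu]_(r in `[0, s]) ((1 + r) `^ mu * D r) =
    \int[lmu]_(r in `[0, s]) ((1 + r) `^ mu * U r)
    - delta * eps * \int[lmu]_(r in `[0, s]) ((1 + r) `^ mu * subsol mu r).
  rewrite -RintegralZl// -RintegralB//; last exact: integrable_EFinZ.
  by apply: eq_Rintegral => r _; rewrite /D; ring.
have h : delta * eps * (3 / 2) <= eps * mass rho v1.
  rewrite mulrAC mulrC ler_pM2l//; apply: le_trans delta_v1.
  by rewrite mulrC ler_pM2r// ler_pdivrMr//; lra.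
rewrite /D' mulrBr mulrCA.
rewrite -(ler_pM2l de0) in I2.
move: I1 I2 h; set I := Rintegral _ _ _; set J := Rintegral _ _ _.
move: (_ * pair _ _) (_ * subsol1 _ _) (mass _ _) (delta * eps) => a b c d.
move: I J => I J I1 I2 h.
rewrite lerBrDr; apply: le_trans I1.
rewrite -addrA addrC lerD2r addrC -lerBrDr opprK.
by apply: le_trans I2 _; rewrite mulrDr lerD2r.
Qed.

Let p' : R := p / (p - 1).
Let beta : R := k%:R - k%:R / 2 * p'.
Variable K : R.
Hypothesis K0 : 0 < K.
Hypothesis KE : forall t : R, 1 <= t ->
  (\int[leb]_(x in eball (rho + t)) (psum (bessel_c k) (nrm2 x) `^ p')%:E
   <= (K * (t `^ beta * expR (p' * t)))%:E)%E.

Let p'1 : 1 <= p'.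
Proof.
have h : 1 < p := p1; rewrite /p' ler_pdivlMr; last by lra.
by rewrite mul1r gerBl.
Qed.

Let Lv_L1loc (t : R) : 0 <= t <= S -> L1loc (v t).
Proof.
move=> /andP[t0 tS]; have Tt := time_itv_sub TS t0 tS.
by case: C1v => -[lw _] _ _; exact: lw.
Qed.

(** Multiplying by [exp (-t)] before Young's inequality balances the growth of the mode with the
    [exp (p' t)] from the integral of [Y^p']. On the window [S / 4 <= t <= S / 3] the growth bound
    is available, [t] is comparable to [S] at the cost of [4^|beta|], and [S >= 4] ensures
    [t >= 1]. *)
Lemma mode_pointwise (lam : R) : 0 < lam ->
  {ae lmu, forall t, S / 4 <= t <= S / 3 ->
    delta * eps * S `^ (- (mu / 2)) <= lam * norm_pow p L v t
      + lam `^ (- (p - 1)^-1) * (K * (4 `^ `|beta| * S `^ beta))}.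
Proof.
move=> lam0; have h4 : 4 <= S := S4.
apply: (@filterS _ _ (ae_filter_ringOfSetsType lmu) _ _ _ (ae_normE_lty Lv L TS)) => t ft.
move=> /andP[t4 t3].
have t1 : 1 <= t by lra.
have t0 : 0 < t by lra.
have tS : t <= S by lra.
have t0S : 0 <= t <= S by rewrite (ltW t0).
have t0S3 : 0 <= t <= S / 3 by rewrite (ltW t0).
have tL : rho + t <= L by rewrite lerD2l.
pose j (x : rV) := psum (bessel_c k) (nrm2 x) `^ p'.
have j0 x : 0 <= j x by exact: powR_ge0.
have B0 : 0 <= lam `^ (- (p - 1)^-1) * expR (- (p' * t)).
  by rewrite mulr_ge0 ?powR_ge0 ?expR_ge0.
have pw x : eball (rho + t) x -> expR (- t) * (`|v t x| * `|Y x|) <=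
    lam * `|v t x| `^ p + lam `^ (- (p - 1)^-1) * expR (- (p' * t)) * j x.
  move=> xt; have xL : eball L x by exact: le_trans xt tL.
  have Yx : 0 <= expR (- t) * Y x by rewrite mulr_ge0 ?expR_ge0.
  rewrite (ger0_norm (Y0 x)) mulrCA.
  apply: le_trans (young_split (normr_ge0 (v t x)) Yx p1 lam0) _.
  rewrite powRM ?expR_ge0// -/p' (YE xL) -/(j x) lerD2l mulrA.
  by rewrite -expRM mulNr (mulrC t).
have H := young_pair (Lv_L1loc t0S) tY (suppv t0S) tL (ft t0S) (expR_ge0 (- t)) (ltW lam0) B0
  (@measurable_bessel_pow R k p') j0 pw (KE t1).
have G := mode_growth t0S3.
have Up : expR (- t) * (delta * eps * (expR t * (1 + t) `^ (- (mu / 2)))) <=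
    expR (- t) * `|pair (v t) Y|.
  by rewrite ler_wpM2l ?expR_ge0//; apply: le_trans G (ler_norm _).
have {}H := le_trans Up H.
have -> : delta * eps * S `^ (- (mu / 2)) = expR (- t) * (delta * eps * (expR t * S `^ (- (mu / 2)))).
  by rewrite mulrCA (mulrA (expR (- t))) -expRD addNr expR0 mul1r.
have d1 : delta * eps * (expR t * S `^ (- (mu / 2))) <=
    delta * eps * (expR t * (1 + t) `^ (- (mu / 2))).
  apply: ler_wpM2l; first by rewrite ltW// mulr_gt0.
  apply: ler_wpM2l; first exact: expR_ge0.
  rewrite !powRN lef_pV2 ?posrE ?powR_gt0//; last by lra.
  by apply: ge0_ler_powR; rewrite ?nnegrE ?divr_ge0//; lra.
apply: le_trans (ler_wpM2l (expR_ge0 (- t)) d1) _.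
apply: le_trans H _; rewrite -/(norm_pow p L v t); rewrite lerD2l.
have -> : lam `^ (- (p - 1)^-1) * expR (- (p' * t)) * (K * (t `^ beta * expR (p' * t))) =
   lam `^ (- (p - 1)^-1) * (K * t `^ beta).
  rewrite -!mulrA; congr (_ * _); rewrite mulrC -!mulrA -expRD subrr expR0 mulr1; ring.
rewrite ler_wpM2l ?powR_ge0// ler_pM2l//.
have [b0|b0] := leP 0 beta.
  apply: (@le_trans _ _ (S `^ beta)); first by apply: ge0_ler_powR; rewrite ?nnegrE; lra.
  rewrite ler_peMl ?powR_ge0//.
  by rewrite -[leLHS](powRr0 4) ler_powR// ler1n.
rewrite ltr0_norm// powRN ler_pdivlMl ?powR_gt0// -powRM ?(ltW t0)//.
have -> : beta = - (- beta) by rewrite opprK.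
have S0' : 0 < S := S0.
have tt0 : 0 < 4 * t by rewrite mulr_gt0.
rewrite ![_ `^ (- (- beta))]powRN lef_pV2 ?posrE ?powR_gt0//.
by apply: ge0_ler_powR; rewrite ?nnegrE; lra.
Qed.

(** Integrates the pointwise bound over the window, of length [S / 12], on which [eta] equals 1. *)
Lemma mode_estimate (lam : R) : 0 < lam ->
  delta * eps * S `^ (- (mu / 2)) * (S / 12) <= lam * int_v chi m p rho v S
      + lam `^ (- (p - 1)^-1) * (K * (4 `^ `|beta| * S `^ beta)) * S.
Proof.
move=> lam0; have h4 : 4 <= S := S4.
set c := delta * eps * _; set B := lam `^ _ * _.
have c0 : 0 <= c.
  by apply: mulr_ge0; [exact: (mulr_ge0 (ltW delta0) (ltW eps0))|exact: powR_ge0].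
have B0 : 0 <= B by rewrite !mulr_ge0 ?powR_ge0// ltW.
pose I := [set` `[S / 4, S / 3]] : set (measurableTypeR R).
have mI : measurable I by exact: measurable_itv.
have mIE : fine (lmu I) = S / 12.
  rewrite /I lebesgue_measure_itv/= lte_fin ifT; last by lra.
  by rewrite /=; field.
have cst_int (e : R) : lmu.-integrable I (EFin \o (fun=> e)).
  by apply: within_integrable; apply: continuous_subspaceT => x; exact: cvg_cst.
have IS : I `<=` [set` `[0, S]].
  by move=> t; rewrite /I/= !in_itv/= => /andP[t1 t2]; apply/andP; split; lra.
have nv := integrable_norm_pow Lv L TS (q := p).
have nvI : lmu.-integrable I (EFin \o norm_pow p L v).
  by apply: integrableS nv => //; exact: measurable_itv.
have := @ae_ge0_le_Rintegral _ I (fun=> c) (fun t => lam * norm_pow p L v t + B) mI (cst_int c).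
have i2 : lmu.-integrable I (EFin \o (fun t => lam * norm_pow p L v t + B)).
  by apply: integrable_EFinD => //; exact: integrable_EFinZ.
move=> /(_ i2 (fun _ _ => c0)).
have g0 x : I x -> 0 <= lam * norm_pow p L v x + B.
  by move=> _; apply: addr_ge0 => //; apply: mulr_ge0; [exact: ltW|exact: norm_pow_ge0].
move=> /(_ g0); rewrite Rintegral_cst// mIE RintegralD//; last exact: integrable_EFinZ.
rewrite Rintegral_cst// mIE RintegralZl// => H.
apply: (@le_trans _ _ (lam * (\int[lmu]_(x in I) norm_pow p L v x) + B * (S / 12))).
  apply: H; apply: (@filterS _ _ (ae_filter_ringOfSetsType lmu) _ _ _ (mode_pointwise lam0)).
  by move=> t Ht; rewrite /I/= in_itv/= => /Ht.
apply: lerD; last by rewrite ler_wpM2l//; lra.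
rewrite ler_pM2l// /int_v.
have -> : \int[lmu]_(x in I) norm_pow p L v x = \int[lmu]_(x in I) (eta x * norm_pow p L v x).
  apply: eq_Rintegral => t; rewrite inE /I/= in_itv/= => /andP[t4 t3].
  by rewrite (eta_eq1 st) ?mul1r//; lra.
have ie : lmu.-integrable `[0, S] (EFin \o (fun t => eta t * norm_pow p L v t)).
  apply: integrable_continuousM => //; apply: continuous_subspaceT => s.
  exact: (eta_continuous st).
have e0 t : (0 <= (eta t * norm_pow p L v t)%:E)%E.
  by rewrite lee_fin mulr_ge0 ?norm_pow_ge0 ?(eta_ge0 st).
apply: fine_le.
- by apply: integrable_fin_num => //; apply: integrableS ie => //; exact: measurable_itv.
- by apply: integrable_fin_num ie; exact: measurable_itv.
apply: ge0_subset_integral => //; exact: measurable_int ie.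
Qed.

End wave_mode.

(** * Closing the estimates *)

Section exponents.
Context {R : realType}.

(** Inserting the second inequality into the first feeds back at most [X / 2]. *)
Lemma absorb_feedback (F X Y A1 A2 B1 B2 : R) : 0 <= X -> 0 <= A1 ->
  A1 * A2 <= 2^-1 -> F + X <= A1 * Y + B1 -> Y <= A2 * X + B2 ->
  F + X / 2 <= A1 * B2 + B1.
Proof.
move=> X0 A0 AA H1 H2.
have h1 : A1 * Y <= A1 * (A2 * X + B2) by rewrite ler_wpM2l.
have h2 : A1 * A2 * X <= 2^-1 * X by rewrite ler_wpM2r.
by lra.
Qed.

Variables (n : nat) (p q nu a a' b V : R).
Hypotheses (p1 : 1 < p) (q1 : 1 < q).
Hypotheses (a0 : 0 <= a) (a'0 : 0 <= a') (b0 : 0 <= b) (V0 : 0 <= V).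

Let pq0 : 0 < p * q - 1.
Proof. by have h1 : 1 < p := p1; have h2 : 1 < q := q1; nra. Qed.
Let p10 : p - 1 != 0. Proof. by rewrite gt_eqF// subr_gt0. Qed.
Let q10 : q - 1 != 0. Proof. by rewrite gt_eqF// subr_gt0. Qed.

(** Chosen so that [l a a' b <= 1/2]; the added 1 keeps it meaningful when the product vanishes. *)
Let l : R := (2 * (a * a' * b + 1))^-1.

Let aab0 : 0 <= a * a' * b. Proof. by rewrite !mulr_ge0. Qed.
Let l0 : 0 < l. Proof. by rewrite invr_gt0 mulr_gt0// ltr_wpDl. Qed.

(** One constant for both ways of closing the system: the two bracketed groups are the remainders
    when [F1], respectively [F2], is estimated, and the 1 makes it positive. *)
Definition feedback_cst : R :=
  1 + (l * a * a' * b * V + a * V * l `^ (- (q - 1)^-1))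
    + (a * b * V * l `^ (- (q - 1)^-1) + b * V).

Lemma feedback_cst_gt0 : 0 < feedback_cst.
Proof.
have la := powR_ge0 l (- (q - 1)^-1).
by rewrite /feedback_cst -addrA ltr_pwDl// !addr_ge0// !mulr_ge0// ltW.
Qed.

Variables (S F1 F2 X Y : R).
Hypotheses (S1 : 1 <= S) (X0 : 0 <= X) (Y0 : 0 <= Y) (F10 : 0 <= F1) (F20 : 0 <= F2).
Hypothesis H1 : forall lam, 0 < lam ->
  F1 + X <= a / S * (lam * (a' * S `^ (- nu) * Y)
     + lam `^ (- (q - 1)^-1) * (V * S ^+ n.+1)).
Hypothesis H2 : forall lam, 0 < lam ->
  F2 + Y <= b * (S `^ nu / S ^+ 2) * (lam * X + lam `^ (- (p - 1)^-1) * (V * S ^+ n.+1)).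

Let S0 : 0 < S. Proof. exact: lt_le_trans ltr01 S1. Qed.

Let powD (x y : R) : S `^ x * S `^ y = S `^ (x + y).
Proof. by rewrite [RHS]powRD// (gt_eqF S0) implybT. Qed.

Let powN1 : S^-1 = S `^ (-1). Proof. by rewrite powR_inv1// ltW. Qed.
Let powN2 : (S ^+ 2)^-1 = S `^ (- 2). Proof. by rewrite powRN powR_mulrn// ltW. Qed.
Let powS : S ^+ n.+1 = S `^ (n%:R + 1).
Proof. by rewrite natr1 powR_mulrn// ltW. Qed.

(** The Young parameter is [l * S^x], and [S^y] in [F2_le]; the exponents stay free until the powers
    of [S] are balanced. *)
Let F1_le (x : R) : F1 + X <= l * a * a' * S `^ (x - 1 - nu) * Y
   + a * V * l `^ (- (q - 1)^-1) * S `^ (n%:R - x / (q - 1)).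
Proof.
have lS : 0 < l * S `^ x by rewrite mulr_gt0// powR_gt0.
apply: le_trans (H1 lS) _.
rewrite (powRM _ (ltW l0) (powR_ge0 _ _)) -powRrM powS powN1 le_eqVlt; apply/orP; left; apply/eqP.
rewrite (_ : n%:R - x / (q - 1) = (-1) + x * - (q - 1)^-1 + (n%:R + 1)); last by ring.
by rewrite -!powD; ring.
Qed.

Let F2_le (y : R) : F2 + Y <= b * S `^ (y + nu - 2) * X
   + b * V * S `^ (n%:R - 1 + nu - y / (p - 1)).
Proof.
have lS : 0 < S `^ y by rewrite powR_gt0.
apply: le_trans (H2 lS) _.
rewrite -powRrM powS powN2 le_eqVlt; apply/orP; left; apply/eqP.
rewrite (_ : n%:R - 1 + nu - y / (p - 1) = nu + (- 2) + y * - (p - 1)^-1 + (n%:R + 1)); last by ring.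
by rewrite -!powD; ring.
Qed.

Let la_ge0 : 0 <= l `^ (- (q - 1)^-1). Proof. exact: powR_ge0. Qed.

(** With [x + y = 3] the powers of [S], those with [nu] included, cancel in the product, so the
    feedback is absorbed uniformly in [S]. *)
Let AA (x y : R) : x + y = 3 ->
  l * a * a' * S `^ (x - 1 - nu) * (b * S `^ (y + nu - 2)) <= 2^-1.
Proof.
move=> xy.
rewrite (_ : _ * _ = l * (a * a' * b) * (S `^ (x - 1 - nu) * S `^ (y + nu - 2))); last by ring.
rewrite powD (_ : _ + _ = x + y - 3); last by ring.
have h := aab0; move: l0; rewrite xy subrr powRr0 mulr1 /l invr_gt0 => h2.
by rewrite mulrC ler_pdivrMr//; lra.
Qed.

Lemma feedback_damped :
  F1 + X / 2 <= feedback_cst * S `^ (n%:R - (2 * p + 1) / (p * q - 1)).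
Proof.
(* Under [x + y = 3], the value that gives both remainders the same power of [S]: it solves
   [- x / (q - 1) = x - 2 - y / (p - 1)]. *)
pose x := (2 * p + 1) * (q - 1) / (p * q - 1); pose y := 3 - x.
have A0 : 0 <= l * a * a' * S `^ (x - 1 - nu).
  by rewrite mulr_ge0 ?powR_ge0// mulr_ge0// mulr_ge0// ltW.
have H2' : Y <= b * S `^ (y + nu - 2) * X + b * V * S `^ (n%:R - 1 + nu - y / (p - 1)).
  by apply: le_trans (F2_le y); rewrite lerDr.
have AAx : l * a * a' * S `^ (x - 1 - nu) * (b * S `^ (y + nu - 2)) <= 2^-1.
  by apply: AA; rewrite /y; ring.
apply: le_trans (absorb_feedback X0 A0 AAx (F1_le x) H2') _.
have pqn : p * q - 1 != 0 by rewrite gt_eqF.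
rewrite (_ : _ * _ = l * a * a' * b * V *
  (S `^ (x - 1 - nu) * S `^ (n%:R - 1 + nu - y / (p - 1)))); last by ring.
rewrite powD (_ : x - 1 - nu + _ = n%:R - (2 * p + 1) / (p * q - 1)); last first.
  by rewrite /y /x; field; rewrite pqn.
rewrite (_ : n%:R - x / (q - 1) = n%:R - (2 * p + 1) / (p * q - 1)); last first.
  by rewrite /x; field; rewrite pqn.
rewrite -mulrDl ler_wpM2r ?powR_ge0// /feedback_cst.
have h : 0 <= a * b * V * l `^ (- (q - 1)^-1) + b * V.
  by rewrite addr_ge0// mulr_ge0// mulr_ge0// mulr_ge0.
by lra.
Qed.

Lemma feedback_scale_invariant :
  F2 <= feedback_cst * S `^ (n%:R - 1 + nu - (q + 2) / (p * q - 1)).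
Proof.
(* The same balance for the other order of substitution: [1 - y / (p - 1) = y - x / (q - 1)]. *)
pose y := (q + 2) * (p - 1) / (p * q - 1); pose x := 3 - y.
have A0 : 0 <= b * S `^ (y + nu - 2) by rewrite mulr_ge0 ?powR_ge0.
have H1' : X <= l * a * a' * S `^ (x - 1 - nu) * Y
   + a * V * l `^ (- (q - 1)^-1) * S `^ (n%:R - x / (q - 1)).
  by apply: le_trans (F1_le x); rewrite lerDr.
have AAx : b * S `^ (y + nu - 2) * (l * a * a' * S `^ (x - 1 - nu)) <= 2^-1.
  by rewrite mulrC; apply: AA; rewrite /x; ring.
have F2' : F2 <= F2 + Y / 2 by rewrite lerDl divr_ge0.
apply: le_trans F2' (le_trans (absorb_feedback Y0 A0 AAx (F2_le y) H1') _).
have pqn : p * q - 1 != 0 by rewrite gt_eqF.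
rewrite (_ : _ * _ = a * b * V * l `^ (- (q - 1)^-1) *
  (S `^ (y + nu - 2) * S `^ (n%:R - x / (q - 1)))); last by ring.
rewrite powD (_ : y + nu - 2 + _ = n%:R - 1 + nu - (q + 2) / (p * q - 1)); last first.
  by rewrite /x /y; field; rewrite pqn.
rewrite (_ : n%:R - 1 + nu - y / (p - 1) = n%:R - 1 + nu - (q + 2) / (p * q - 1)); last first.
  by rewrite /y; field; rewrite pqn.
rewrite -mulrDl ler_wpM2r ?powR_ge0// /feedback_cst.
have h : 0 <= l * a * a' * b * V + a * V * l `^ (- (q - 1)^-1).
  by rewrite addr_ge0// !mulr_ge0// ltW.
by lra.
Qed.

Variables (k : nat) (mu F3 K : R).
Hypothesis nE : n = k.+1.
Hypothesis H3 : forall lam, 0 < lam ->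
  F3 * S `^ (- (mu / 2)) * (S / 12) <= lam * X + lam `^ (- (p - 1)^-1) *
    (K * S `^ (k%:R - k%:R / 2 * (p / (p - 1)))) * S.

Lemma feedback_mode : F3 <= 12 * (2 * feedback_cst + K) *
  S `^ ((n%:R + mu - 1) / 2 - (2 + p^-1) / (p * q - 1)).
Proof.
pose th := (2 * p + 1) / (p * q - 1); have nk : n%:R = k%:R + 1 :> R by rewrite nE natr1.
have hH := H3; move: k%:R nk hH => k' nk hH.
(* With the Young parameter [S^g], both terms on the right of the mode estimate get the same power
   [S^e], once [X] is replaced by its upper bound. *)
pose g := th * (p - 1) / p - k' / 2.
have p0 : p != 0 by rewrite gt_eqF// (lt_trans ltr01).
have pqn : p * q - 1 != 0 by rewrite gt_eqF.
have G : X <= 2 * feedback_cst * S `^ (n%:R - th).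
  have := feedback_damped; rewrite -/th => h; have hF := F10.
  rewrite -mulrA -ler_pdivrMl//; apply: le_trans h; rewrite mulrC; lra.
have Sg : 0 < S `^ g by rewrite powR_gt0.
have := hH _ Sg; rewrite -powRrM => h.
have {}h : F3 * S `^ (- (mu / 2)) * (S / 12) <= S `^ g * (2 * feedback_cst * S `^ (n%:R - th)) +
   S `^ (g * - (p - 1)^-1) * (K * S `^ (k' - k' / 2 * (p / (p - 1)))) * S.
  by apply: le_trans h _; rewrite lerD2r ler_pM2l.
pose e := g + (n%:R - th).
have E1 : S `^ g * (2 * feedback_cst * S `^ (n%:R - th)) = 2 * feedback_cst * S `^ e.
  by rewrite mulrCA powD.
have E2 : S `^ (g * - (p - 1)^-1) * (K * S `^ (k' - k' / 2 * (p / (p - 1)))) * S = K * S `^ e.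
  have -> : e = g * - (p - 1)^-1 + (k' - k' / 2 * (p / (p - 1))) + 1.
    by rewrite /e /g nk; field; rewrite p10 p0.
  by rewrite -!powD powRr1 ?(ltW S0)//; ring.
rewrite E1 E2 -mulrDl in h.
have -> : (n%:R + mu - 1) / 2 - (2 + p^-1) / (p * q - 1) = e + (mu / 2) + (-1).
  by rewrite /e /g /th nk; field; rewrite pqn p0.
rewrite -(powD (e + mu / 2)) -(powD e) powR_inv1 ?(ltW S0)//.
rewrite powRN in h.
have m0 : 0 < S `^ (mu / 2) by rewrite powR_gt0.
rewrite [leRHS](_ : _ = 12 * ((2 * feedback_cst + K) * S `^ e) * S `^ (mu / 2) / S); last by ring.
rewrite ler_pdivlMr// -ler_pdivrMr// mulrC -ler_pdivrMl//.
by apply: le_trans h; rewrite le_eqVlt; apply/orP; left; apply/eqP; field; rewrite !gt_eqF.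
Qed.

End exponents.

(** * From decay in [S] to the lifespan *)

Section lifespan.
Context {R : realType}.

Lemma exists_cutoff_power (p q : R) : 1 < p -> 1 < q ->
  exists m : nat, [/\ (2 < m)%N, m%:R <= (m.-2)%:R * p & m%:R <= (m.-2)%:R * q].
Proof.
move=> p1 q1; pose m := (Num.bound (2 / (p - 1) + 2 / (q - 1))).+1.
have p10 : 0 < p - 1 by rewrite subr_gt0.
have q10 : 0 < q - 1 by rewrite subr_gt0.
have hp : 0 <= 2 / (p - 1) by rewrite divr_ge0// ltW.
have hq : 0 <= 2 / (q - 1) by rewrite divr_ge0// ltW.
have hm : 2 / (p - 1) + 2 / (q - 1) <= m%:R.
  apply: (@le_trans _ _ (Num.bound (2 / (p - 1) + 2 / (q - 1)))%:R); last by rewrite ler_nat.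
  by rewrite ltW// archi_boundP// addr_ge0.
have h1 : 2 <= m%:R * (p - 1) by rewrite -ler_pdivrMr//; lra.
have h2 : 2 <= m%:R * (q - 1) by rewrite -ler_pdivrMr//; lra.
by exists m.+2; split => //=; rewrite -[m.+2]addn2 natrD; lra.
Qed.

(** If [T] exceeded the claimed bound [M], then [S = M] would be admissible and force
    [M <= (C / eps)^(1/G)]. The summand 4 serves twice: with [eps <= 1] it gives [M >= 4], and it
    makes [M] strictly larger than that. *)
Lemma lifespan_le (G C eps : R) (T : \bar R) : 0 < G -> 0 < C -> 0 < eps -> eps <= 1 ->
  (forall S, 4 <= S -> (S%:E < T)%E -> eps <= C * S `^ (- G)) ->
  (T <= ((4 + C `^ (1 / G)) * eps `^ (- (1 / G)))%:E)%E.
Proof.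
move=> G0 C0 e0 e1 H; rewrite leNgt; apply/negP; set M := _ * _ => MT.
have Ge : 0 <= 1 / G by rewrite divr_ge0// ltW.
have E1 : 1 <= eps `^ (- (1 / G)).
  rewrite powRN invf_ge1 ?powR_gt0//; apply: (@le_trans _ _ (1 `^ (1 / G))).
    by apply: ge0_ler_powR => //; rewrite nnegrE ?ler01// ltW.
  by rewrite powR1.
have C1 : 0 < C `^ (1 / G) by rewrite powR_gt0.
have M4 : 4 <= M by rewrite /M; nra.
have M0 : 0 < M by lra.
have := H M M4 MT; rewrite powRN ler_pdivlMr ?powR_gt0// => h.
have {}h : M `^ G <= C / eps by rewrite ler_pdivlMr// mulrC.
have : M <= (C / eps) `^ (1 / G).
  have -> : M = (M `^ G) `^ (1 / G).
    by rewrite -powRrM mul1r divff ?gt_eqF// powRr1// ltW.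
  apply: ge0_ler_powR => //; rewrite nnegrE ?powR_ge0//.
  by rewrite divr_ge0// ltW.
have ei : 0 <= eps^-1 by rewrite invr_ge0 ltW.
rewrite (powRM _ (ltW C0) ei) -(powR_inv1 (ltW e0)) -powRrM mulN1r.
by rewrite leNgt => /negP; apply; rewrite /M ltr_pM2r ?powR_gt0// ltrDr.
Qed.

End lifespan.

Section decay.
Context {R : realType}.
Variables (k : nat).
Local Notation n := k.+1.
Local Notation rV := 'rV[R]_n.
Variables (mu rho p q : R) (u0 u1 v0 v1 : rV -> R).
Hypotheses (mu0 : 0 <= mu) (rho0 : 0 < rho) (p1 : 1 < p) (q1 : 1 < q).
Hypotheses (lu0 : L1loc u0) (lu1 : L1loc u1) (lv0 : L1loc v0) (lv1 : L1loc v1).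
Hypotheses (du0 : admissible_datum rho u0) (du1 : admissible_datum rho u1)
  (dv0 : admissible_datum rho v0) (dv1 : admissible_datum rho v1).

Lemma data_size_decay : exists2 C : R, 0 < C & forall eps : R, 0 < eps ->
  forall (T : \bar R) (u v : R -> rV -> R),
  weak_solution (fun t => mu / (1 + t)) p q rho eps u0 u1 v0 v1 T u v ->
  forall S : R, 4 <= S -> (S%:E < T)%E -> eps <= C * S `^ (- Gamma_exponent n p q mu).
Proof.
have [chi [chi1 [chi2 [C0 st]]]] := @exists_smooth_step R.
have [m [m2 mp mq]] := exists_cutoff_power p1 q1.
(* [1 - nu] is the positive part of [1 - mu], which is how that term enters [Gamma_exponent]. *)
pose nu := Num.min mu 1.
have nu0 : 0 <= nu by rewrite le_min mu0 ler01.
have nu1 : nu <= 1 by rewrite ge_min lexx orbT.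
have nule : nu <= mu by rewrite ge_min lexx.
have numu : (mu - nu) * (nu - 1) = 0.
  by rewrite /nu; case: leP => _; rewrite subrr ?mul0r ?mulr0.
have p'1 : 1 <= p / (p - 1).
  by rewrite ler_pdivlMr ?subr_gt0// mul1r gerBl.
have [K K0 KE] := bessel_ball k rho0 p'1.
have Mu := mass_gt0 lu1 du1; have Mv0 := mass_gt0 lv0 dv0; have Mv := mass_gt0 lv1 dv1.
pose d := Num.min (mass rho v0) (mass rho v1) / 4.
have d0 : 0 < d by rewrite divr_gt0// lt_min Mv0.
pose a := 2 * eta_cst C0 m.
pose b := 2 * (1 + `|mu - 2 * nu|) * eta_cst C0 m.
pose V := (2 * (rho + 1)) ^+ n.
have c0 := eta_cst_ge0 st m.
have a0 : 0 <= a by rewrite mulr_ge0.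
have b0 : 0 <= b by rewrite mulr_ge0// mulr_ge0// addr_ge0.
have a'0 : 0 <= 2 `^ nu :> R by exact: powR_ge0.
have V0 : 0 <= V by rewrite exprn_ge0// mulr_ge0// addr_ge0// ltW.
pose Fc := feedback_cst q a (2 `^ nu) b V.
pose be : R := k%:R - k%:R / 2 * (p / (p - 1)).
pose K' := K * 4 `^ `|be|.
have K'0 : 0 <= K' by rewrite mulr_ge0 ?powR_ge0// ltW.
have Fc0 : 0 < Fc by exact: feedback_cst_gt0.
pose C1 := 12 * (2 * Fc + K') / d; pose C2 := Fc / mass rho v1; pose C3 := Fc / mass rho u1.
have C10 : 0 < C1 by rewrite divr_gt0// mulr_gt0// ltr_wpDr// mulr_gt0.
have C20 : 0 < C2 by rewrite divr_gt0.
have C30 : 0 < C3 by rewrite divr_gt0.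
exists (C1 + C2 + C3); first by rewrite !addr_gt0.
move=> eps eps0 T u v [ut [vt [gu [gv [[Cu C1u Lu] [Cv C1v Lv] supp [iu iv] [equ eqv]]]]]].
move=> S S4 ST.
have S1 : 1 <= S by lra.
have S0 : 0 < S by lra.
have X0 := int_v_ge0 st m p rho v S.
have Y0 := int_u_ge0 st m q nu rho u S.
have H1 (lam : R) (lam0 : 0 < lam) := damped_estimate st m2 p1 q1 mq nu0 rho0 lu0 lu1 du0 du1 dv0
  eps0 Cu C1u Lu Lv supp iu iv equ S1 ST lam0.
have H2 (lam : R) (lam0 : 0 < lam) := scale_invariant_estimate st m2 p1 q1 mp nu0 nu1 numu nule rho0
  lv0 lv1 du0 dv0 dv1 eps0 Lu Cv C1v Lv supp iu iv eqv S1 ST lam0.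
have suppv s : 0 <= s <= S -> supported_in (rho + s) (v s).
  exact: (support_v dv0 supp iv ST).
have L0 : 0 <= rho + S by rewrite addr_ge0// ltW.
have [Y [tY Yge YE lapY]] := @exists_bessel_test R k (rho + S) L0.
have H3 (lam : R) (lam0 : 0 < lam) := mode_estimate st m2 p1 mu0 lv0 lv1 dv0 dv1 eps0 Lu Cv C1v Lv
  S4 ST suppv iv eqv tY Yge YE lapY K0 KE lam0.
have H3' lam : 0 < lam -> d * eps * S `^ (- (mu / 2)) * (S / 12) <= lam * int_v chi m p rho v S
   + lam `^ (- (p - 1)^-1) * (K' * S `^ be) * S.
  by move=> /H3; rewrite /K' -[K * _ * _]mulrA.
move: (int_v _ _ _ _ _ _) (int_u _ _ _ _ _ _ _) X0 Y0 H1 H2 H3' => X Y' X0 Y0 H1 H2 H3'.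
have F1 : 0 <= eps * mass rho u1 by rewrite mulr_ge0// ltW.
have F2 : 0 <= eps * mass rho v1 by rewrite mulr_ge0// ltW.
have B3 := feedback_damped p1 q1 a0 a'0 b0 V0 S1 X0 F2 H1 H2.
have B2 := feedback_scale_invariant p1 q1 a0 a'0 b0 V0 S1 Y0 F1 H1 H2.
have B1 := feedback_mode p1 q1 a0 a'0 b0 V0 S1 X0 F1 F2 H1 H2 (erefl _) H3'.
have {}B3 : eps * mass rho u1 <= Fc * S `^ (n%:R - (2 * p + 1) / (p * q - 1)).
  by apply: le_trans B3; rewrite lerDl divr_ge0.
have {}B2 : eps * mass rho v1 <= Fc * S `^ (n%:R - 1 + nu - (q + 2) / (p * q - 1)) := B2.
have {}B1 : d * eps <= 12 * (2 * Fc + K') *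
  S `^ ((n%:R + mu - 1) / 2 - (2 + p^-1) / (p * q - 1)) := B1.
(* [Gamma_exponent] equals one of the three exponents, so it suffices to have all three estimates
   with a common constant. *)
have D (G Ci : R) : Ci <= C1 + C2 + C3 -> eps <= Ci * S `^ (- G) ->
    eps <= (C1 + C2 + C3) * S `^ (- G).
  by move=> cC /le_trans; apply; rewrite ler_wpM2r ?powR_ge0.
have D1 : eps <= (C1 + C2 + C3) * S `^ (- ((2 + p^-1) / (p * q - 1) - (n%:R + mu - 1) / 2)).
  apply: (D _ C1); first by rewrite -addrA lerDl addr_ge0// ltW.
  by rewrite opprB /C1 mulrAC ler_pdivlMr// mulrC.
have D2 : eps <= (C1 + C2 + C3) * S `^ (- ((q + 2) / (p * q - 1) - n%:R + Num.max (1 - mu) 0)).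
  apply: (D _ C2); first by rewrite addrAC lerDr addr_ge0// ltW.
  have -> : - ((q + 2) / (p * q - 1) - n%:R + Num.max (1 - mu) 0) =
      n%:R - 1 + nu - (q + 2) / (p * q - 1).
    have -> : Num.max (1 - mu) 0 = 1 - nu.
      by rewrite /nu; case: (leP mu 1) => h; [rewrite max_l ?subr_ge0|rewrite max_r ?subrr// subr_le0 ltW].
    by ring.
  by rewrite /C2 mulrAC ler_pdivlMr.
have D3 : eps <= (C1 + C2 + C3) * S `^ (- ((2 * p + 1) / (p * q - 1) - n%:R)).
  apply: (D _ C3); first by rewrite lerDr addr_ge0// ltW.
  by rewrite opprB /C3 mulrAC ler_pdivlMr.
by rewrite /Gamma_exponent /Num.max; case: ifP => // _; case: ifP.
Qed.

End decay.

Unset Implicit Arguments.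

Theorem theorem2p1 (R : realType) (n : nat) (mu rho p q : R)
    (u0 u1 v0 v1 : 'rV[R]_n -> R)
    (hn : (1 <= n)%N) (hmu : 0 <= mu) (hrho : 0 < rho)
    (hu0 : W11loc u0) (hu1 : L1loc u1) (hv0 : W11loc v0) (hv1 : L1loc v1)
    (du0 : admissible_datum rho u0) (du1 : admissible_datum rho u1)
    (dv0 : admissible_datum rho v0) (dv1 : admissible_datum rho v1)
    (hp : 1 < p) (hq : 1 < q) (hGamma : 0 < Gamma_exponent n p q mu) :
  exists eps0 C : R, [/\ 0 < eps0, 0 < C &
    forall eps : R, 0 < eps -> eps <= eps0 ->
    forall (T : \bar R) (u v : R -> 'rV[R]_n -> R), (0%:E < T)%E ->
      weak_solution (fun t => mu / (1 + t)) p q rho eps u0 u1 v0 v1 T u v ->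
      (T < +oo)%E /\
      (T <= (C * eps `^ (- (1 / Gamma_exponent n p q mu)))%:E)%E].
Proof.
case: n hn u0 u1 v0 v1 hu0 hu1 hv0 hv1 du0 du1 dv0 dv1 hGamma => // k _.
move=> u0 u1 v0 v1 [hu0 _] hu1 [hv0 _] hv1 du0 du1 dv0 dv1 hGamma.
have [C C0 HC] := data_size_decay hmu hrho hp hq hu0 hu1 hv0 hv1 du0 du1 dv0 dv1.
set G := Gamma_exponent _ _ _ _ in hGamma HC *.
(* The threshold [eps <= 1] ensures that the lifespan bound is at least 4, the smallest [S] for
   which the decay estimate is available. *)
exists 1, (4 + C `^ (1 / G)); split => //.
  by rewrite ltr_wpDr// powR_ge0.
move=> eps eps0 eps1 T u v _ sol.
have TC := lifespan_le hGamma C0 eps0 eps1 (HC eps eps0 T u v sol).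
by split => //; apply: le_lt_trans TC _; rewrite ltry.
Qed.
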